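(* Let $n\ge1$, let $\{G_k\}_{k\in\mathbb{N}}$ be a sequence in $\mathfrak{G}_n$ and let $G_0\in\mathfrak{G}_n$. Then $\{G_k\}_{k\in\mathbb{N}}\to G_0$ in the topology of $\mathfrak{G}_n$ if and only if $\{G_k\}_{k\in\mathbb{N}}$ converges to $G_0$ uniformly on compact subsets of $\{x_3=0\}$ (that is, the functions $u_k:\mathbb{R}^2\to\mathbb{R}$ defining the graphs $G_k$ converge to the function $u_0$ defining $G_0$ uniformly on compact subsets of $\mathbb{R}^2$).
   Context: $\mathbb{L}^3$ is $\mathbb{R}^3$ with the metric $dx_1^2+dx_2^2-dx_3^2$; a maximal surface is a spacelike surface (induced metric Riemannian) with zero mean curvature. $\mathfrak{G}_n$ is the set of all entire graphs $G=\{(x,u(x)):x\in\mathbb{R}^2\}\subset\mathbb{L}^3$ over $\{x_3=0\}$, $u:\mathbb{R}^2\to\mathbb{R}$ continuous, that are complete maximal surfaces away from exactly $n+1$ conelike singularities and whose normal direction tends to the vertical direction at infinity. A conelike singularity is an isolated point where the conformal factor of the induced metric tends to $0$ and a punctured neighbourhood of which is conformally an annulus $\{0<r<|z|<1\}$; the graph is asymptotic to a half light cone there. Complete means that divergent curves have infinite length for the induced metric. Every $G\in\mathfrak{G}_n$ satisfies $u(x)=c\log|x|+b+O(|x|^{-1})$ as $|x|\to\infty$ for real constants $b,c$; $c$ is the logarithmic growth of $G$. A mark in $G$ is an ordering $\mathfrak{m}=(q_0,\ldots,q_n)\in\mathbb{R}^{3n+3}$ of its singular points in $\mathbb{R}^3$,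 and $\mathfrak{M}_n$ is the set of marked graphs $(G,\mathfrak{m})$. The map $\mathfrak{s}_2:\mathfrak{M}_n\to\mathbb{R}^{3n+4}$, $(G,\mathfrak{m})\mapsto(\mathfrak{m},c)$, is injective with open image, and $\mathfrak{M}_n$ has the topology making $\mathfrak{s}_2$ a homeomorphism onto its image. The topology of $\mathfrak{G}_n$ is the quotient topology under $\mathfrak{s}_1:\mathfrak{M}_n\to\mathfrak{G}_n$, $(G,\mathfrak{m})\mapsto G$, i.e. $\mathfrak{G}_n$ is the quotient of $\mathfrak{M}_n$ by the action of the symmetric group permuting the marks (and $\mathfrak{s}_1$ is an $(n+1)!$-sheeted covering). *)

(* Defs.v *)
From HB Require Import structures.
From mathcomp Require Import all_boot all_order all_algebra.
From mathcomp Require Import all_classical all_reals all_analysis.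

Set Implicit Arguments.
Unset Strict Implicit.
Unset Printing Implicit Defensive.

Import Order.TTheory GRing.Theory Num.Theory numFieldNormedType.Exports.
Local Open Scope classical_set_scope.
Local Open Scope ring_scope.

(* Points of R^2 and of L^3 are row vectors.  The norm that the library puts on
   row vectors is the sup norm; the Euclidean one is [enorm]. *)

Definition dot (R : realType) (v w : 'rV[R]_2) : R :=
  \sum_(i < 2) v 0 i * w 0 i.

Definition enorm (R : realType) (v : 'rV[R]_2) : R := Num.sqrt (dot v v).

Definition lorentz (R : realType) (a b : 'rV[R]_3) : R :=
  a 0 0 * b 0 0 + a 0 1 * b 0 1 - a 0 2 * b 0 2.

(* The filter |x| -> oo on R^2. *)
Definition at_infinity (R : realType) : set_system 'rV[R]_2 :=
  [set P | exists M : R, forall x, M < enorm x -> P x].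
Arguments at_infinity R : clear implicits.

Definition annulus (R : realType) (r : R) : set 'rV[R]_2 :=
  [set z | r < enorm z < 1].

Fixpoint iter_derive (R : realType) (V W : normedModType R) (l : seq V)
    (f : V -> W) : V -> W :=
  if l is v :: l' then fun x => 'D_v (iter_derive l' f) x else f.

(* For open [A] this is C^oo on [A]. *)
Definition smooth_on (R : realType) (V W : normedModType R) (A : set V)
    (f : V -> W) : Prop :=
  forall (l : seq V) (x : V), A x -> differentiable (iter_derive l f) x.

Section Graphs.
Variable R : realType.
Implicit Types (u : 'rV[R]_2 -> R) (p x v w : 'rV[R]_2).

Definition graph_map u x : 'rV[R]_3 := row_mx x (u x)%:M.

Definition first_form u x v w : R :=
  lorentz ('D_v (graph_map u) x) ('D_w (graph_map u) x).

Definition spacelike_at u x : Prop :=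
  forall v, v != 0 -> 0 < first_form u x v v.

Definition partial (W : normedModType R) (i : 'I_2) (f : 'rV[R]_2 -> W) :
    'rV[R]_2 -> W :=
  fun x => 'D_(delta_mx 0 i) f x.

(* (u_1, u_2, 1) / sqrt (1 - u_1^2 - u_2^2): the upward timelike vector which is
   Lorentz-orthogonal to the graph and has Lorentz square -1. *)
Definition unit_normal u x : 'rV[R]_3 :=
  (Num.sqrt (1 - partial 0 u x ^+ 2 - partial 1 u x ^+ 2))^-1 *:
  (row_mx (\row_(i < 2) partial i u x) 1%:M : 'rV[R]_3).

Definition second_form u x (i j : 'I_2) : R :=
  lorentz (partial i (partial j (graph_map u)) x) (unit_normal u x).

(* Half the trace of the second fundamental form with respect to the first. *)
Definition mean_curvature u x : R :=
  let g (i j : 'I_2) := first_form u x (delta_mx 0 i) (delta_mx 0 j) in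
  (g 0 0 * second_form u x 1 1 - 2 * g 0 1 * second_form u x 0 1
     + g 1 1 * second_form u x 0 0)
  / (2 * (g 0 0 * g 1 1 - g 0 1 ^+ 2)).

Definition maximal_on (A : set 'rV[R]_2) u : Prop :=
  smooth_on A u /\
  forall x, A x -> spacelike_at u x /\ mean_curvature u x = 0.

(* [psi] is a conformal coordinate on the punctured neighbourhood [U `\ p], with
   values in an annulus of inner radius r > 0; in this coordinate the induced
   metric is h |dz|^2. *)
Definition conelike_singularity u p : Prop :=
  exists (U : set 'rV[R]_2) (r : R) (psi : 'rV[R]_2 -> 'rV[R]_2)
         (h : 'rV[R]_2 -> R),
    [/\ open_nbhs p U, maximal_on (U `\ p) u & 0 < r < 1] /\
    [/\ set_bij (U `\ p) (annulus r) psi,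
        smooth_on (U `\ p) psi,
        forall x, (U `\ p) x -> 0 < h x /\
          forall v w, first_form u x v w = h x * dot ('D_v psi x) ('D_w psi x) &
        h x @[x --> p^'] --> (0 : R)].

Definition singular_set u : set 'rV[R]_2 := [set p | conelike_singularity u p].

(* The induced metric is only defined off the singular set, so the curves
   considered are the ones that avoid it; as the singular set is finite, every
   divergent curve has a tail of this form. *)
Definition complete_graph u : Prop :=
  forall gamma : R -> 'rV[R]_2,
    (forall t, derivable gamma t 1) -> continuous (derive1 gamma) ->
    (forall t, 0 <= t -> ~ singular_set u (gamma t)) ->
    gamma t @[t --> +oo] --> at_infinity R ->
    (\int[lebesgue_measure]_(t in `[0%R, +oo[)
       (Num.sqrt (first_form u (gamma t) (derive1 gamma t) (derive1 gamma t)))%:E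
     = +oo)%E.

Definition in_Gn (n : nat) u : Prop :=
  [/\ continuous u,
      (singular_set u #= `I_n.+1)%card &
      maximal_on (~` singular_set u) u] /\
  [/\ complete_graph u &
      unit_normal u x @[x --> at_infinity R] --> (delta_mx 0 2 : 'rV[R]_3)].

Record Gn (n : nat) := MkGn { Gn_fun :> 'rV[R]_2 -> R ; GnP : in_Gn n Gn_fun }.

(* u(x) = c log |x| + b + O(|x|^-1) *)
Definition has_log_growth u (c : R) : Prop :=
  exists b C : R,
    at_infinity R
      [set x | `|u x - (c * ln (enorm x) + b)| <= C * (enorm x)^-1].

(* Graphs in [Gn] have exactly one logarithmic growth; the default 0 is only used
   for functions outside [Gn]. *)
Definition log_growth u : R := xget 0 [set c | has_log_growth u c].

(* The rows of [m] list the singular points of the graph, each exactly once. *)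
Definition is_mark (n : nat) u (m : 'M[R]_(n.+1, 3)) : Prop :=
  set_bij [set: 'I_n.+1] (graph_map u @` singular_set u) (fun i => row i m).

Record Mn (n : nat) := MkMn {
  Mn_graph : Gn n ;
  Mn_mark : 'M[R]_(n.+1, 3) ;
  MnP : is_mark Mn_graph Mn_mark }.

Definition s1 (n : nat) (M : Mn n) : Gn n := Mn_graph M.

(* 'M[R]_(n.+1, 3) * R plays the role of R^(3n+4). *)
Definition s2 (n : nat) (M : Mn n) : 'M[R]_(n.+1, 3) * R :=
  (Mn_mark M, log_growth (Mn_graph M)).

Lemma graph_map_inj u : injective (graph_map u).
Proof. by move=> x y xy; have [] := @eq_row_mx R 1 2 1 _ _ _ _ xy. Qed.

Lemma s1_surj n (G : Gn n) : exists M : Mn n, s1 M = G.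
Proof.
have [[_ card_sing _] _] := GnP G.
suff [m mP] : exists m : 'M[R]_(n.+1, 3), is_mark G m.
  by exists (@MkMn n G m mP).
have /card_esym/card_set_bijP[f fP] :
    (graph_map G @` singular_set G #= [set: 'I_n.+1])%card.
  apply: (card_eq_trans _ card_II); apply: (card_eq_trans _ card_sing).
  by apply: inj_card_eq => x y _ _; exact: graph_map_inj.
exists (\matrix_i f i).
by rewrite /is_mark (_ : (fun i => row i _) = f)//; apply/funext => i; rewrite rowK.
Qed.

Definition s1_repr n (G : Gn n) : Mn n := sval (cid (s1_surj G)).

Lemma s1_reprK n : cancel (@s1_repr n) (@s1 n).
Proof. by move=> G; rewrite /s1_repr; case: cid. Qed.

End Graphs.

HB.instance Definition _ (R : realType) (n : nat) := gen_eqMixin (Mn R n).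
HB.instance Definition _ (R : realType) (n : nat) := gen_choiceMixin (Mn R n).
HB.instance Definition _ (R : realType) (n : nat) :=
  Topological.copy (Mn R n) (initial_topology (@s2 R n)).

HB.instance Definition _ (R : realType) (n : nat) :=
  isQuotient.Build (Mn R n) (Gn R n) (@s1_reprK R n).
HB.instance Definition _ (R : realType) (n : nat) :=
  Topological.copy (Gn R n) (quotient_topology (Gn R n)).

(* Main.v *)
(** For a divergence-free field Z with |Dv|^2 <= K Z.Dv and a cutoff T, the flux
    of T(v) Z through the circle of radius e^t is nondecreasing in t; when it
    tends to 0 along a sequence of circles, it vanishes, which gives maximum
    principles outside discs and in punctured discs.  For two maximal graphs
    v = u - u' and Z = W(Du) - W(Du'), W(p) = p / sqrt (1 - |p|^2), are such a pair.

    Comparing u at infinity with the catenoid of the same flux, the sharp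
    Wirtinger inequality gives u(x) = c log|x| + b + O(1/|x|), with 2 pi c the flux
    of W(Du).  The flux of the truncated difference of two graphs is at most
    2 pi |c - c'|; if the marks and growths are close, so are the graphs.

    Conversely, let u_k tend to u_0 and suppose that the u_k have no singular point
    near a singular point p of u_0.  The maximum principle for differences of
    translates of u_k carries the Lipschitz constant of u_0 on a circle around p
    into the disc, so that u_0 is a contraction near p.  Then the conformal
    coordinate at p is quasiconformal, its modulus stays away from the bounds of the
    annulus, and it cannot be injective.  Hence the marks converge; so do the
    growths, by comparison with catenoids. *)

(* All integrals are over circles, parametrised by the logarithm t of the radius, so plane arguments
   become differential inequalities in one variable. With y(t) the flux of v Z and E = y' the
   energy, Cauchy-Schwarz on the circle gives y^2 <= C E when v is bounded and |Z|^2 <= L Z.Dv. This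
   Riccati inequality would blow up if y were positive. It is used for the gradient near infinity
   and, with time reversed, for ln|psi| at a puncture. The sharp decay takes two rounds: Wirtinger
   for the gradient with crude constants gives some power decay of |Du|; then W(Du) agrees with Du
   up to an error integrable in t, and the constant 1 of Wirtinger gives exactly the rate 1/|x|. The
   difference of two graphs is not differentiable at their singular points. Close marks and the
   Lipschitz constant 1 keep it below the truncation level there, so that T(v) Z extends by 0 to a
   C^1 field on the plane. The constants of the expansion at infinity depend on the graph. In
   uniform estimates they disappear in a limit, or give way to a bound on the oscillation outside a
   disc that uses only the Lipschitz constant. *)
Require Import Defs.
From HB Require Import structures.
From mathcomp Require Import all_boot all_order all_algebra.
From mathcomp Require Import all_classical all_reals all_analysis.
From mathcomp Require Import ring lra.

Set Implicit Arguments.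
Unset Strict Implicit.
Unset Printing Implicit Defensive.

Import Order.TTheory GRing.Theory Num.Theory numFieldNormedType.Exports.
Local Open Scope classical_set_scope.
Local Open Scope ring_scope.

(** * Real calculus and circle integrals *)

Section Continuity.
Variables (R : realType) (T : topologicalType).
Implicit Types (f g : T -> R) (x : T).

Lemma cts_cst k x : continuous_at x (fun=> k : R).
Proof. exact: cvg_cst. Qed.

Lemma cts_add f g x : continuous_at x f -> continuous_at x g ->
  continuous_at x (fun t => f t + g t).
Proof. exact: cvgD. Qed.

Lemma cts_opp f x : continuous_at x f -> continuous_at x (fun t => - f t).
Proof. exact: cvgN. Qed.

Lemma cts_mul f g x : continuous_at x f -> continuous_at x g ->
  continuous_at x (fun t => f t * g t).
Proof. exact: cvgM. Qed.

Lemma cts_exp n f x : continuous_at x f ->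
  continuous_at x (fun t => f t ^+ n).
Proof.
move=> cf; elim: n => [|n ih]; first exact: cts_cst.
rewrite (_ : (fun t => _) = (fun t => f t * f t ^+ n)); first exact: cts_mul.
by apply/funext => t; rewrite exprS.
Qed.

Lemma cts_comp (g : R -> R) f x : continuous_at x f ->
  continuous_at (f x) g -> continuous_at x (fun t => g (f t)).
Proof. exact: continuous_comp. Qed.

Lemma cts_inv f x : continuous_at x f -> f x != 0 ->
  continuous_at x (fun t => (f t)^-1).
Proof. by move=> cf fx; exact: cvgV. Qed.

Lemma cts_near f g x : (\forall y \near x, f y = g y) -> continuous_at x f ->
  continuous_at x g.
Proof.
move=> fg; rewrite /continuous_at (nbhs_singleton fg); apply: cvg_trans.
exact: near_eq_cvg.
Qed.

End Continuity.

Ltac cts1 := lazymatch goal with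
  | |- continuous_at _ (fun _ => ?k) => exact: cts_cst
  | |- continuous_at _ (fun t => @?f t + @?g t) => apply: (@cts_add _ _ f g)
  | |- continuous_at _ (fun t => - @?f t) => apply: (@cts_opp _ _ f)
  | |- continuous_at _ (fun t => @?f t * @?g t) => apply: (@cts_mul _ _ f g)
  | |- continuous_at _ (fun t => @?f t ^+ ?n) => apply: (@cts_exp _ _ n f)
  | |- continuous_at _ (fun t => (@?f t)^-1) => apply: (@cts_inv _ _ f)
  | |- continuous_at _ (fun t => cos (@?f t)) =>
      apply: (@cts_comp _ _ cos f); [|exact: continuous_cos]
  | |- continuous_at _ (fun t => sin (@?f t)) =>
      apply: (@cts_comp _ _ sin f); [|exact: continuous_sin]
  | |- continuous_at _ (fun t => expR (@?f t)) =>
      apply: (@cts_comp _ _ expR f); [|exact: continuous_expR]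
  | |- continuous_at _ (fun t => t) => exact: cvg_id
  | |- continuous_at _ (fun t => ?P t) => match goal with
      | h : continuous_at _ P |- _ => exact: h
      | h : forall t, continuous_at t P |- _ => exact: h
      | h : continuous P |- _ => exact: h end
  | |- continuous_at _ ?f => first [match goal with
      | h : continuous_at _ f |- _ => exact: h
      | h : forall t, continuous_at t f |- _ => exact: h
      | h : continuous f |- _ => exact: h end
      | match goal with
      | h : continuous_at _ _ |- _ => exact: h
      | h : forall t, continuous_at t _ |- _ => exact: h
      | h : continuous _ |- _ => exact: h end]
  end.
Ltac cts := repeat cts1.

Section RealLine.
Variable R : realType.
Implicit Types (f g df dg : R -> R) (a b t x y : R).

Lemma is_derive1_continuous f x l : is_derive x 1 f l -> {for x, continuous f}.
Proof. by move=> h; exact/differentiable_continuous/derivable1_diffP. Qed.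

Lemma MVT_closed f df a b : a < b ->
  (forall x, a <= x <= b -> is_derive x 1 f (df x)) ->
  exists2 c, a < c < b & f b - f a = df c * (b - a).
Proof.
move=> ab h; have [||c cab ->] := @MVT R f df a b ab.
- by move=> x; rewrite in_itv/= => /andP[ax xb]; apply: h; rewrite !ltW.
- apply: derivable_within_continuous => x; rewrite in_itv/= => /h hx.
  exact: ex_derive.
- by exists c => //; move: cab; rewrite in_itv.
Qed.

Lemma derive_ge0_le f df a b : a <= b ->
  (forall x, a <= x <= b -> is_derive x 1 f (df x)) ->
  (forall x, a <= x <= b -> 0 <= df x) -> f a <= f b.
Proof.
rewrite le_eqVlt => /predU1P[->//|ab] h h0.
have [c /andP[ac cb]] := MVT_closed ab h.
move=> e; rewrite -subr_ge0 e mulr_ge0 ?h0 ?subr_ge0 ?ltW//.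
Qed.

Lemma derive_le0_ge f df a b : a <= b ->
  (forall x, a <= x <= b -> is_derive x 1 f (df x)) ->
  (forall x, a <= x <= b -> df x <= 0) -> f b <= f a.
Proof.
move=> ab h h0; rewrite -lerN2.
apply: (@derive_ge0_le (- f) (- df)) => // x hx; last by rewrite oppr_ge0 h0.
by have := h _ hx => ?; exact: is_deriveN.
Qed.

Lemma derive0_const f a b : (forall x, a <= x <= b -> is_derive x 1 f 0) ->
  a <= b -> f a = f b.
Proof.
move=> h ab; apply/eqP; rewrite eq_le.
by rewrite (@derive_ge0_le f (cst 0))// (@derive_le0_ge f (cst 0)).
Qed.

Lemma der_eq f x l l' : is_derive x 1 f l -> l = l' -> is_derive x 1 f l'.
Proof. by move=> h <-. Qed.

Lemma der_cst k x : is_derive x 1 (fun=> k : R) 0.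
Proof. exact: is_derive_cst. Qed.

Lemma der_id x : is_derive x 1 (fun t : R => t) 1.
Proof. exact: is_derive_id. Qed.

Lemma der_add f g x l m : is_derive x 1 f l -> is_derive x 1 g m ->
  is_derive x 1 (fun t => f t + g t) (l + m).
Proof. by move=> hf hg; exact: is_deriveD. Qed.

Lemma der_opp f x l : is_derive x 1 f l -> is_derive x 1 (fun t => - f t) (- l).
Proof. by move=> hf; exact: is_deriveN. Qed.

Lemma der_mul f g x l m : is_derive x 1 f l -> is_derive x 1 g m ->
  is_derive x 1 (fun t => f t * g t) (l * g x + f x * m).
Proof.
move=> hf hg; have h := is_deriveM hf hg.
by apply: (der_eq h); rewrite addrC; congr (_ + _); exact: mulrC.
Qed.

Lemma der_comp f g x l m : is_derive (f x) 1 g m -> is_derive x 1 f l ->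
  is_derive x 1 (fun t => g (f t)) (m * l).
Proof.
move=> hg hf; have h := @is_derive1_comp R g f x m l hg hf.
by apply: (der_eq h).
Qed.

Lemma der_exp f x l n : is_derive x 1 f l ->
  is_derive x 1 (fun t => f t ^+ n) (n%:R * f x ^+ n.-1 * l).
Proof.
move=> hf; elim: n => [|n ih]; first by apply: (der_eq (der_cst _ _)); ring.
rewrite (_ : (fun t => _) = (fun t => f t * f t ^+ n)); last first.
  by apply/funext => t; rewrite exprS.
apply: (der_eq (der_mul hf ih)); case: n {ih} => [|n] /=; first by ring.
by rewrite (exprS _ n) -!natr1; ring.
Qed.

Lemma der_inv f x l : is_derive x 1 f l -> f x != 0 ->
  is_derive x 1 (fun t => (f t)^-1) (- l / f x ^+ 2).
Proof.
move=> hf fx; apply: (der_eq (is_deriveV fx hf)).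
by rewrite -[_ *: _]/(_ * _) !mulNr mulrC.
Qed.

Lemma der_sin f x l : is_derive x 1 f l ->
  is_derive x 1 (fun t => sin (f t)) (cos (f x) * l).
Proof. exact: der_comp. Qed.

Lemma der_cos f x l : is_derive x 1 f l ->
  is_derive x 1 (fun t => cos (f t)) (- sin (f x) * l).
Proof. exact: der_comp. Qed.

Lemma der_expR f x l : is_derive x 1 f l ->
  is_derive x 1 (fun t => expR (f t)) (expR (f x) * l).
Proof. exact: der_comp. Qed.

Lemma der_ln f x l : is_derive x 1 f l -> 0 < f x ->
  is_derive x 1 (fun t => ln (f t)) ((f x)^-1 * l).
Proof. by move=> hf fx; apply: der_comp => //; exact: is_derive1_ln. Qed.

Lemma der_sqrt f x l : is_derive x 1 f l -> 0 < f x ->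
  is_derive x 1 (fun t => Num.sqrt (f t)) ((2 * Num.sqrt (f x))^-1 * l).
Proof. by move=> hf fx; apply: der_comp => //; exact: is_derive1_sqrt. Qed.

(** Serves the piecewise cubic cutoff [sstep]: a quadratic bound on the remainder can be checked by
    cases, with no one-sided derivatives at the joints. *)
Lemma is_derive_quadratic f x l K :
  (forall y, `|f y - f x - (y - x) * l| <= K * (y - x) ^+ 2) ->
  is_derive x 1 f l.
Proof.
move=> hK.
have K0 : 0 <= K.
  have := hK (x + 1); rewrite [x + 1 - x](_ : _ = 1) ?expr1n ?mulr1; last by ring.
  exact: le_trans.
suff h : h^-1 *: (f (h *: 1 + x) - f x) @[h --> 0^'] --> l.
  by apply: DeriveDef; [exact: (cvgP _ h)|exact: (cvg_lim _ h)].
apply/cvgrPdist_le => e e0; near=> h.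
have h0 : h != 0 by near: h; exact: nbhs_dnbhs_neq.
have := hK (h *: 1 + x).
rewrite addrK [h *: 1]mulr1.
set X := f _ - f x => hh.
have -> : l - h^-1 *: X = - (h^-1 * (X - h * l)).
  by rewrite mulrBr mulrA mulVf// mul1r opprB.
rewrite normrN normrM normfV ler_pdivrMl ?normr_gt0// (le_trans hh)//.
rewrite -real_normK ?num_real// expr2 mulrA [K * _]mulrC -mulrA ler_wpM2l//.
suff : `|h| < e / (K + 1).
  by rewrite ltr_pdivlMr ?ltr_wpDl//; nra.
near: h; apply: dnbhs0_lt; rewrite divr_gt0//; lra.
Unshelve. all: by end_near. Qed.

End RealLine.

(** As [is_derive] is a class, [notypeclasses refine] keeps instance search away from the premises,
    which are left to the next rounds of [der1]. *)
Ltac der1 := lazymatch goal with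
  | |- is_derive _ _ (fun _ => ?k) _ => exact: der_cst
  | |- is_derive _ _ (fun t => t) _ => exact: der_id
  | |- is_derive _ _ (fun t => @?f t + @?g t) _ => notypeclasses refine (@der_add _ f g _ _ _ _ _)
  | |- is_derive _ _ (fun t => - @?f t) _ => notypeclasses refine (@der_opp _ f _ _ _)
  | |- is_derive _ _ (fun t => @?f t * @?g t) _ => notypeclasses refine (@der_mul _ f g _ _ _ _ _)
  | |- is_derive _ _ (fun t => @?f t ^+ ?n) _ => notypeclasses refine (@der_exp _ f _ _ n _)
  | |- is_derive _ _ (fun t => (@?f t)^-1) _ => notypeclasses refine (@der_inv _ f _ _ _ _)
  | |- is_derive _ _ (fun t => sin (@?f t)) _ => notypeclasses refine (@der_sin _ f _ _ _)
  | |- is_derive _ _ (fun t => cos (@?f t)) _ => notypeclasses refine (@der_cos _ f _ _ _)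
  | |- is_derive _ _ (fun t => expR (@?f t)) _ => notypeclasses refine (@der_expR _ f _ _ _)
  | |- is_derive _ _ (fun t => ln (@?f t)) _ => notypeclasses refine (@der_ln _ f _ _ _ _)
  | |- is_derive _ _ (fun t => Num.sqrt (@?f t)) _ => notypeclasses refine (@der_sqrt _ f _ _ _ _)
  | |- is_derive _ _ (fun t => ?P t) _ =>
      match goal with h : is_derive _ _ P _ |- _ => exact h end
  | |- is_derive _ _ ?f _ =>
      first [match goal with h : is_derive _ _ f _ |- _ => exact h end|eassumption]
  | _ => assumption
  end.
Ltac der := repeat der1.
Ltac der_by := notypeclasses refine (der_eq _ _); [solve [der]|rewrite /=].

(** * Integrals over a period and the Wirtinger inequality *)

Section CircleIntegral.
Variable R : realType.
Implicit Types (f g F df P : R -> R) (a b t x y k : R).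
Notation mu := (@lebesgue_measure R).

Definition cint f : R := \int[mu]_(t in `[0, 2 * pi]) f t.

Let pi2 : 0 < 2 * pi :> R. Proof. by rewrite mulr_gt0// pi_gt0. Qed.

Lemma cint_integrable f : continuous f -> mu.-integrable `[0, 2 * pi] (EFin \o f).
Proof.
move=> cf; apply: continuous_compact_integrable; first exact: segment_compact.
exact: continuous_subspaceT.
Qed.
Hint Resolve cint_integrable : core.

Lemma cintD f g : continuous f -> continuous g ->
  cint (fun t => f t + g t) = cint f + cint g.
Proof. by move=> cf cg; rewrite /cint RintegralD//; apply: cint_integrable. Qed.

Lemma cintB f g : continuous f -> continuous g ->
  cint (fun t => f t - g t) = cint f - cint g.
Proof. by move=> cf cg; rewrite /cint RintegralB//; apply: cint_integrable. Qed.

Lemma cintZ k f : continuous f -> cint (fun t => k * f t) = k * cint f.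
Proof. by move=> cf; rewrite /cint RintegralZl//; apply: cint_integrable. Qed.

Lemma cintN f : continuous f -> cint (fun t => - f t) = - cint f.
Proof.
move=> cf; rewrite -mulN1r -cintZ//; congr cint.
by apply/funext => t; rewrite mulN1r.
Qed.

Lemma cint_le f g : continuous f -> continuous g ->
  (forall t, 0 <= t <= 2 * pi -> f t <= g t) -> cint f <= cint g.
Proof.
move=> cf cg fg; apply: le_Rintegral => [//|||t /=].
- exact: cint_integrable.
- exact: cint_integrable.
- by rewrite in_itv/=; exact: fg.
Qed.

Lemma cint_ge0 f : (forall t, 0 <= f t) -> 0 <= cint f.
Proof. by move=> f0; apply: Rintegral_ge0. Qed.

Lemma cint_cst k : cint (fun=> k) = k * (2 * pi).
Proof.
rewrite /cint Rintegral_cst//; congr (_ * _).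
have h : mu `[0, 2 * pi] = (2 * pi)%:E.
  by rewrite lebesgue_measure_itv/= lte_fin pi2 oppr0 adde0.
transitivity (fine (2 * pi : R)%:E) => //; congr fine; exact: h.
Qed.

Lemma cint_deriv f F : continuous f ->
  (forall t, 0 <= t <= 2 * pi -> is_derive t 1 F (f t)) ->
  cint f = F (2 * pi) - F 0.
Proof.
move=> cf dF; rewrite /cint /Rintegral.
have pi2' := ltW pi2.
rewrite (@continuous_FTC2 R f F)//.
- exact: continuous_subspaceT.
- split.
  + by move=> t; rewrite in_itv/= => /andP[t0 t1]; have /dF : 0 <= t <= 2 * pi
      by rewrite !ltW.
  + apply: cvg_at_right_filter; apply: (@is_derive1_continuous _ _ _ (f 0)).
    by apply: dF; rewrite lexx.
  + apply: cvg_at_left_filter; apply: (@is_derive1_continuous _ _ _ (f (2 * pi))).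
    by apply: dF; rewrite lexx andbT.
- move=> t; rewrite in_itv/= => /andP[t0 t1]; rewrite derive1E.
  have /dF ? : 0 <= t <= 2 * pi by rewrite !ltW.
  by rewrite derive_val.
Qed.

Lemma antiderivative f a b : continuous f ->
  exists F, forall x, a <= x <= b -> is_derive x 1 F (f x).
Proof.
(* Starting the integral at a - 1 makes every point of [a, b], both ends included, interior, so the
   derivatives are two-sided. *)
move=> cf; exists (fun x => \int[mu]_(t in `[a - 1, x]) f t) => x /andP[ax xb].
have xb1 : x < b + 1 by rewrite ltr_pwDr.
have ax1 : a - 1 < x by rewrite ltrBlDr ltr_pwDr.
have hi : mu.-integrable `[a - 1, b + 1] (EFin \o f).
  apply: continuous_compact_integrable; first exact: segment_compact.
  exact: continuous_subspaceT.
have [h1 h2] := @continuous_FTC1_closed R f (a - 1) x (b + 1) xb1 hi ax1 (cf x).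
apply: DeriveDef; first exact: h1.
by rewrite -derive1E; exact: h2.
Qed.

Lemma cint_eq0 f : continuous f -> (forall t, 0 <= f t) -> cint f = 0 ->
  forall t, 0 <= t <= 2 * pi -> f t = 0.
Proof.
move=> cf f0 if0 t /andP[t0 t1].
apply/eqP; rewrite eq_le f0 andbT leNgt; apply/negP => ft.
have [F dF] := antiderivative 0 (2 * pi) cf.
have Fmon x y : 0 <= x -> x <= y -> y <= 2 * pi -> F x <= F y.
  move=> x0 xy y1; apply: (@derive_ge0_le _ F f) => // z /andP[? ?].
  by apply: dF; rewrite (le_trans x0)//= (le_trans _ y1).
have [d /= d0 hd] : \forall s \near t, 0 < f s.
  by have /cvgr_gt/(_ _ ft) := cf t.
(* The neighbourhood of t on which f is positive is clipped to [0, 2 pi]; [c < e] holds even when t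
   is an endpoint. *)
pose c := Num.max 0 (t - d / 2); pose e := Num.min (2 * pi) (t + d / 2).
have ce : c < e.
  by rewrite /c /e gt_max !lt_min; rewrite pi2/=; apply/and3P; split; lra.
have cd : t - d < c by rewrite lt_max; apply/orP; right; lra.
have ed : e < t + d by rewrite gt_min; apply/orP; right; lra.
have c0 : 0 <= c by rewrite le_max lexx.
have e1 : e <= 2 * pi by rewrite ge_min lexx.
have [|x /andP[cx xe] Fx] := @MVT_closed R F f c e ce.
  move=> x /andP[cx xe]; apply: dF.
  by rewrite (le_trans c0)//= (le_trans xe).
have : 0 < f x.
  by apply: hd => /=; rewrite ltr_norml; apply/andP; split; lra.
have : F e = F c.
  apply/eqP; rewrite eq_le; apply/andP; split; last by apply: Fmon => //; exact: ltW.
  have := cint_deriv cf dF; rewrite if0 => /esym/eqP.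
  rewrite subr_eq0 => /eqP F02.
  rewrite (le_trans (Fmon e (2 * pi) _ _ _))//; first exact: le_trans (ltW ce).
  by rewrite F02; apply: Fmon => //; rewrite (le_trans (ltW ce)).
move=> Fec; move: Fx; rewrite Fec subrr => /esym/eqP; rewrite mulf_eq0 subr_eq0.
by rewrite (gt_eqF ce) orbF => /eqP ->; rewrite ltxx.
Qed.

(** Cauchy-Schwarz against the constant 1, read off from the nonnegativity of the variance of f
    about its mean [m]. *)
Lemma cint_sqr f : continuous f ->
  cint f ^+ 2 <= 2 * pi * cint (fun t => f t ^+ 2).
Proof.
move=> cf; pose m := cint f / (2 * pi).
have cX : continuous (fun t => f t ^+ 2) by move=> t; cts.
have cm : continuous (fun t => m * f t) by move=> t; cts.
have : 0 <= cint (fun t => (f t - m) ^+ 2).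
  by apply: cint_ge0 => t; exact: sqr_ge0.
rewrite (_ : (fun t => _) = (fun t => f t ^+ 2 - ((m * f t + m * f t) - m ^+ 2))).
  have c2 : continuous (fun t => m * f t + m * f t - m ^+ 2) by move=> t; cts.
  have c3 : continuous (fun t => m * f t + m * f t) by move=> t; cts.
  have c4 : continuous (fun _ : R => m ^+ 2) by move=> t; cts.
  rewrite cintB// cintB// cintD// cintZ// cint_cst.
  have -> : cint f = m * (2 * pi) by rewrite divfK// gt_eqF.
  by move: (cint _) pi2 => I; nra.
by apply/funext => t; ring.
Qed.

Lemma cint_diff (f df : R -> R -> R) t0 d G : 0 < d ->
  (forall t s, `|t - t0| < d -> is_derive t 1 (f^~ s) (df t s)) ->
  (forall t, `|t - t0| < d -> continuous (f t)) ->
  (forall t s, `|t - t0| < d -> 0 <= s <= 2 * pi -> `|df t s| <= G) ->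
  is_derive t0 1 (fun t => cint (f t)) (cint (df t0)).
Proof.
move=> d0 dfE cf dfG.
have itvE t : `]t0 - d, t0 + d[%classic t -> `|t - t0| < d.
  by rewrite /= in_itv/= => /andP[? ?]; rewrite ltr_norml; apply/andP; split; lra.
have It0 : `]t0 - d, t0 + d[%classic t0.
  by rewrite /= in_itv/=; apply/andP; split; lra.
have hint t : `]t0 - d, t0 + d[%classic t ->
    mu.-integrable `[0, 2 * pi] (EFin \o f t).
  by move=> /itvE/cf; exact: cint_integrable.
have hder t s : `]t0 - d, t0 + d[%classic t ->
    `[0, 2 * pi]%classic s -> derivable (f ^~ s) t 1.
  by move=> /itvE h _; have := dfE t s h => ?; exact: ex_derive.
have G0 : 0 <= G.
  apply: le_trans (dfG t0 0 _ _) => //; rewrite ?subrr ?normr0//.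
  by rewrite lexx ltW.
have hG : mu.-integrable `[0, 2 * pi] (EFin \o cst G).
  by apply: cint_integrable; exact: cst_continuous.
have hub t s : `]t0 - d, t0 + d[%classic t ->
    `[0, 2 * pi]%classic s -> `|partial1of2 f t s| <= cst G s.
  move=> /itvE ht; rewrite /= in_itv/= => hs; rewrite partial1of2E.
  by have := dfE t s ht => ?; rewrite derive_val dfG.
have m02 : measurable (`[0, 2 * pi] : set R) by [].
have := @derivable_under_integral R _ _ mu f _ m02 t0 _ _ It0 hint hder
  (cst G) (fun=> G0) hG hub.
have := @differentiation_under_integral R _ _ mu f _ m02 t0 _ _ It0 hint hder
  (cst G) (fun=> G0) hG hub.
move=> h1 h2; apply: DeriveDef => //; rewrite -derive1E h1.
apply: eq_Rintegral => s _; rewrite partial1of2E.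
have := dfE t0 s (itvE _ It0) => ?; exact: derive_val.
Qed.


(** Tames the cotangent at the ends of the half circle in [dirichlet_halfcircle]. *)
Lemma sin_ge_half : exists2 d : R, 0 < d &
  forall s, 0 <= s <= d -> s / 2 <= sin s.
Proof.
have [d /= d0 hd] : \forall s \near (0 : R), 2^-1 < cos s.
  have /cvgr_gt := @continuous_cos R 0; rewrite cos0; apply.
  by rewrite invf_lt1 ?ltr1n.
exists (d / 2); first by rewrite divr_gt0.
move=> s /andP[s0 sd].
rewrite -subr_ge0 -[X in X <= _](_ : sin 0 - 0 / 2 = 0); last first.
  by rewrite sin0 mul0r subrr.
apply: (@derive_ge0_le _ (fun x => sin x - x / 2) (fun x => cos x - 2^-1)) => //.
  by move=> x _; der_by; ring.
move=> x /andP[x0 xs]; rewrite subr_ge0 ltW//; apply: hd => /=.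
rewrite sub0r normrN ger0_norm//; lra.
Qed.

(** Completion of the square: the derivative of P - f^2 cot(t - b) is (f' - f cot(t - b))^2. The
    cotangent is singular at both ends, but f vanishes there and is Lipschitz, so the boundary terms
    tend to 0. *)
Lemma dirichlet_halfcircle f df P b (L K : R) :
  (forall t, b <= t <= b + pi -> is_derive t 1 f (df t)) ->
  (forall t, b <= t <= b + pi -> is_derive t 1 P (df t ^+ 2 - f t ^+ 2)) ->
  f b = 0 -> f (b + pi) = 0 ->
  (forall t, b <= t <= b + pi -> `|df t| <= L) ->
  (forall t, b <= t <= b + pi -> `|df t ^+ 2 - f t ^+ 2| <= K) ->
  P b <= P (b + pi).
Proof.
move=> dF dP fb fbp hL hK.
have pi0 : 0 < pi :> R by exact: pi_gt0.
pose H t := P t - f t ^+ 2 * (cos (t - b) / sin (t - b)).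
have Hmon x y : b < x -> x <= y -> y < b + pi -> H x <= H y.
  move=> bx xy yb.
  apply: (@derive_ge0_le _ H
    (fun t => (df t - f t * (cos (t - b) / sin (t - b))) ^+ 2)) => //.
    move=> t /andP[xt ty].
    have ht : b <= t <= b + pi by apply/andP; split; lra.
    have s0 : sin (t - b) != 0.
      by rewrite gt_eqF// sin_gt0_pi//; apply/andP; split; lra.
    have ? := dF t ht; have ? := dP t ht.
    rewrite /H; der_by.
    by field.
  by move=> t _; exact: sqr_ge0.
have lip (g dg : R -> R) (M x y : R) : (forall t, b <= t <= b + pi -> is_derive t 1 g (dg t)) ->
    (forall t, b <= t <= b + pi -> `|dg t| <= M) ->
    b <= x -> x <= y -> y <= b + pi -> `|g y - g x| <= M * (y - x).
  move=> dG hM bx; rewrite le_eqVlt => /predU1P[->|xy] yb.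
    by rewrite !subrr normr0 mulr0.
  have [t /andP[bt tb]|c /andP[xc cy] ->] := @MVT_closed R g dg x y xy.
    by apply: dG; rewrite (le_trans bx)//= (le_trans tb).
  have yx : 0 <= y - x by rewrite subr_ge0 ltW.
  rewrite normrM (ger0_norm yx).
  apply: ler_wpM2r; first by [].
  by apply: hM; apply/andP; split; lra.
have [d d0 hd] := sin_ge_half.
rewrite leNgt; apply/negP => PP.
have L0 : 0 <= L by apply: le_trans (normr_ge0 (df b)) (hL b _); lra.
have K0 : 0 <= K by apply: le_trans (normr_ge0 _) (hK b _); lra.
pose D := P b - P (b + pi).
have D0 : 0 < D by rewrite subr_gt0.
have M0 : 0 < 4 * L ^+ 2 + 2 * K + 1 by nra.
(* At distance s from the ends each of the two terms f^2 cot is at most 2 L^2 s, and P changes by at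
   most K s on each end piece; s makes the total smaller than the supposed defect [D]. *)
pose s := Num.min (Num.min d (pi / 4)) (D / (4 * L ^+ 2 + 2 * K + 1) / 2).
have s0 : 0 < s by rewrite !lt_min d0 !divr_gt0.
have sd : s <= d by rewrite !ge_min lexx.
have sp : s <= pi / 4 by rewrite !ge_min lexx orbT.
have sD : s * (4 * L ^+ 2 + 2 * K + 1) < D.
  rewrite -ltr_pdivlMr//.
  have : s <= D / (4 * L ^+ 2 + 2 * K + 1) / 2 by rewrite !ge_min lexx orbT.
  have : 0 < D / (4 * L ^+ 2 + 2 * K + 1) by rewrite divr_gt0.
  lra.
have ss : s / 2 <= sin s by apply: hd; rewrite ltW.
have bnd v c : `|v| <= L * s -> `|c| <= 1 -> `|v ^+ 2 * (c / sin s)| <= 2 * L ^+ 2 * s.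
  move=> hv hc.
  have -> : 2 * L ^+ 2 * s = (L * s) ^+ 2 * (2 / s) by field; rewrite gt_eqF.
  rewrite normrM ler_pM//.
    by rewrite normrX lerXn2r ?nnegrE// mulr_ge0// ltW.
  have sn0 : 0 < sin s by apply: lt_le_trans ss; lra.
  rewrite normrM normfV (gtr0_norm sn0) ler_pdivrMr//.
  rewrite (le_trans hc)// mulrAC ler_pdivlMr//; lra.
have cos1 t : `|cos t| <= 1 :> R.
  rewrite ler_norml; apply/andP; split; [exact: cos_geN1|exact: cos_le1].
have e1 : b + s - b = s by ring.
have e2 : b + pi - s - b = pi - s by ring.
have [q1 q2 q3] : [/\ b <= b + s, b + s <= b + pi & b < b + s].
  by clear -s0 sp pi0; split; lra.
have [q4 q5 q6 q7] : [/\ b <= b + pi - s, b + pi - s <= b + pi,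
    b + pi - s < b + pi & b + s <= b + pi - s].
  by clear -s0 sp pi0; split; lra.
have Hs : H (b + s) <= H (b + pi - s) by exact: Hmon.
have f1 : `|f (b + s)| <= L * s.
  by have := @lip f df L b (b + s) dF hL; rewrite fb subr0 e1; exact.
have f2 : `|f (b + pi - s)| <= L * s.
  have := @lip f df L (b + pi - s) (b + pi) dF hL; rewrite fbp sub0r normrN.
  by rewrite [b + pi - (b + pi - s)](_ : _ = s); [exact|ring].
have P1 : `|P (b + s) - P b| <= K * s.
  by have := @lip P _ K b (b + s) dP hK; rewrite e1; exact.
have P2 : `|P (b + pi) - P (b + pi - s)| <= K * s.
  have := @lip P _ K (b + pi - s) (b + pi) dP hK.
  by rewrite [b + pi - (b + pi - s)](_ : _ = s); [exact|ring].
have es : sin (pi - s) = sin s by rewrite sinB sinpi cospi mul0r sub0r mulN1r opprK.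
move: Hs; rewrite /H e1 e2 es.
have := bnd _ (cos s) f1 (cos1 _); have := bnd _ (cos (pi - s)) f2 (cos1 _).
move: P1 P2; rewrite !ler_norml.
move: (f _ ^+ 2 * _) (f _ ^+ 2 * _) => A B /andP[? ?] /andP[? ?] /andP[? ?] /andP[? ?].
by move: sD; rewrite /D; nra.
Qed.

(** No Fourier series: t |-> f(t + pi) - f(t) changes sign over half a period, so f takes the same
    value m at some al and al + pi. Then f - m vanishes at both ends of two half circles, to which
    the Dirichlet form of the inequality applies. So m is a value of f rather than its mean. *)
Lemma wirtinger f df : (forall t, is_derive t 1 f (df t)) -> continuous df ->
  (forall t, f (t + 2 * pi) = f t) -> (forall t, df (t + 2 * pi) = df t) ->
  exists m, cint (fun t => (f t - m) ^+ 2) <= cint (fun t => df t ^+ 2).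
Proof.
move=> dF cdf fper dfper.
have pi0 : 0 < pi :> R by exact: pi_gt0.
have cf : forall t, continuous_at t f.
  by move=> t; exact: (is_derive1_continuous (dF t)).
pose g t := f (t + pi) - f t.
have dg t : is_derive t 1 g (df (t + pi) - df t).
  have ? : is_derive (t + pi) 1 f (df (t + pi)) by exact: dF.
  have ? := dF t.
  have ? : is_derive t 1 (fun t => f (t + pi)) (df (t + pi) * (1 + 0)).
    by apply: der_comp => //; der.
  by rewrite /g; der_by; ring.
have cg : continuous g by move=> t; exact: (is_derive1_continuous (dg t)).
have g0pi : g pi = - g 0.
  by rewrite /g -[pi + pi]mulr2n -mulr_natl -[2 * pi]add0r fper add0r opprB.
have [al /andP[al0 alpi] gal] : exists2 al, 0 <= al <= pi & g al = 0.
  have [||al + gal] := @IVT R g 0 pi 0 (ltW pi0).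
  - exact: continuous_subspaceT.
  - rewrite g0pi ge_min le_max; have [h|h] := leP 0 (g 0).
      by rewrite oppr_le0 h orbT.
    by rewrite (ltW h)/= oppr_ge0 (ltW h).
  by rewrite in_itv/= => hal; exists al.
have {gal} ealpi : f (al + pi) = f al by move/eqP: gal; rewrite subr_eq0 => /eqP.
exists (f al); pose F t := f t - f al.
have dFF t : is_derive t 1 F (df t) by have ? := dF t; rewrite /F; der_by; ring.
have cdf' : forall t, continuous_at t df by exact: cdf.
have cF t : continuous_at t F by exact: (is_derive1_continuous (dFF t)).
pose k t := df t ^+ 2 - F t ^+ 2.
have ck : continuous k by move=> t; rewrite /k; cts.
have [P dP] := antiderivative (-1) (4 * pi + 1) ck.
have bounded (h : R -> R) : continuous h -> exists M : R, forall t, 0 <= t <= 4 * pi -> `|h t| <= M.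
  move=> ch; have [||c _ hc] := @EVT_max R (fun t => `|h t|) 0 (4 * pi).
  - by rewrite mulr_ge0// ltW.
  - by apply: continuous_subspaceT => t; apply: continuous_comp; [exact: ch|exact: norm_continuous].
  - by exists `|h c| => t ht; apply: hc; rewrite in_itv.
have [L hL] := bounded _ cdf; have [K hK] := bounded _ ck.
have half b : 0 <= b -> b <= 2 * pi -> F b = 0 -> F (b + pi) = 0 -> P b <= P (b + pi).
  move=> b0 b1 Fb Fbp; apply: (@dirichlet_halfcircle F df P b L K) => // t /andP[bt tb].
  - by apply: dP; apply/andP; split; lra.
  - by apply: hL; apply/andP; split; lra.
  - by apply: hK; apply/andP; split; lra.
have Fal : F al = 0 by rewrite /F subrr.
have Falp : F (al + pi) = 0 by rewrite /F ealpi subrr.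
have Falpp : F (al + pi + pi) = 0.
  by rewrite -addrA -[pi + pi]mulr2n -mulr_natl /F fper subrr.
have h1 : P al <= P (al + pi) by apply: half => //; lra.
have h2 : P (al + pi) <= P (al + pi + pi) by apply: half => //; lra.
(* By periodicity the integral of [k] over [al, al + 2 pi] is its integral over [0, 2 pi]. *)
have h3 : P (0 + 2 * pi) - P 0 = P (al + 2 * pi) - P al.
  apply: (@derive0_const R (fun t => P (t + 2 * pi) - P t)) => // t /andP[t0 tal].
  have ? : is_derive (t + 2 * pi) 1 P (k (t + 2 * pi)) by apply: dP; apply/andP; split; lra.
  have ? : is_derive t 1 P (k t) by apply: dP; apply/andP; split; lra.
  have ? : is_derive t 1 (fun t => P (t + 2 * pi)) (k (t + 2 * pi) * (1 + 0)).
    by apply: der_comp => //; der.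
  by der_by; rewrite /k /F fper dfper; ring.
have h4 : cint k = P (2 * pi) - P 0.
  apply: cint_deriv => // t /andP[t0 t1].
  by apply: dP; apply/andP; split; lra.
have : 0 <= cint k.
  have e : al + pi + pi = al + 2 * pi by ring.
  by rewrite h4 -[2 * pi]add0r h3 subr_ge0 (le_trans h1)// -e.
have c1 : continuous (fun t => df t ^+ 2) by move=> t; cts.
have c2 : continuous (fun t => F t ^+ 2) by move=> t; cts.
by rewrite /k cintB// subr_ge0.
Qed.

End CircleIntegral.

(** * Plane calculus in log-polar coordinates *)

(** Differentiability depends on the germ only: the differential of f serves as that of g in the
    little-o characterisation. *)
Lemma near_eq_differentiable (R : realType) (V W : normedModType R) (f g : V -> W)
  (x : V) : (\forall y \near x, f y = g y) -> differentiable f x ->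
  differentiable g x.
Proof.
move=> fg /diff_locallyP[cd hd].
have gx : g x = f x by rewrite (nbhs_singleton fg).
suff hg : g \o shift x = cst (g x) + 'd f x +o_ 0 id.
  by apply/diff_locallyP; rewrite (diff_unique cd hg).
apply/eqaddoP => e e0; have /eqaddoP/(_ e e0) := hd.
have : \forall k \near 0, f (k + x) = g (k + x).
  by have := fg; rewrite (near_shift 0 x)/=; apply: filterS => k;
    rewrite subr0.
apply: filterS2 => k e1; rewrite -[leLHS]/(`|f (k + x) - (f x + 'd f x k)|).
by rewrite -[X in _ -> X <= _]/(`|g (k + x) - (g x + 'd f x k)|) gx e1.
Qed.

Section Plane.
Variable R : realType.
Implicit Types (f g : 'rV[R]_2 -> R) (x y v w a : 'rV[R]_2) (A : set 'rV[R]_2).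

Definition mk (p q : R) : 'rV[R]_2 := p *: delta_mx 0 0 + q *: delta_mx 0 1.

Lemma mk0 p q : mk p q 0 0 = p.
Proof. by rewrite !mxE/= mulr1 mulr0 addr0. Qed.

Lemma mk1 p q : mk p q 0 1 = q.
Proof. by rewrite !mxE/= mulr1 mulr0 add0r. Qed.

Lemma mkE v : v = mk (v 0 0) (v 0 1).
Proof.
apply/rowP => j; case: j => -[|[|//]] h.
  by rewrite (_ : Ordinal h = 0) ?mk0//; exact: val_inj.
by rewrite (_ : Ordinal h = 1) ?mk1//; exact: val_inj.
Qed.

Lemma rV2P v w : v 0 0 = w 0 0 -> v 0 1 = w 0 1 -> v = w.
Proof. by move=> h0 h1; rewrite (mkE v) (mkE w) h0 h1. Qed.

(* [partial 0] and [partial 1] behind an opaque constant: unification would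
   otherwise compare the indices [0] and [1] of ['I_2] by computation. *)
Fact pd_fact : {pd : bool -> ('rV[R]_2 -> R) -> 'rV[R]_2 -> R |
  forall b, pd b = partial (if b then 1 else 0)}.
Proof. by exists (fun b => partial (if b then 1 else 0)). Qed.
Definition pd := sval pd_fact.
Lemma pdE b : pd b = partial (if b then 1 else 0).
Proof. exact: svalP pd_fact b. Qed.
Local Notation px := (pd false).
Local Notation py := (pd true).

Lemma derive_partial f x v : differentiable f x ->
  'D_v f x = v 0 0 * px f x + v 0 1 * py f x.
Proof.
move=> df; rewrite !pdE /partial !deriveE// {1}(mkE v) /mk linearD !linearZ/=.
by [].
Qed.

Lemma is_derive_mk (g0 g1 : R -> R) (t l0 l1 : R) : is_derive t 1 g0 l0 ->
  is_derive t 1 g1 l1 -> is_derive t 1 (fun t => mk (g0 t) (g1 t)) (mk l0 l1).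
Proof.
move=> d0 d1; have dm : derivable (fun t => mk (g0 t) (g1 t)) t 1.
  apply/derivable_mxP => i j; rewrite [i]ord1; case: j => -[|[|//]] h.
    rewrite (_ : Ordinal h = 0); last exact: val_inj.
    by under eq_fun do rewrite mk0; exact: ex_derive.
  rewrite (_ : Ordinal h = 1); last exact: val_inj.
  by under eq_fun do rewrite mk1; exact: ex_derive.
apply: DeriveDef => //; rewrite derive_mx//; apply: rV2P; rewrite mxE.
  rewrite mk0 (_ : (fun t => _) = g0) ?derive_val//.
  by apply/funext => ?; rewrite mk0.
rewrite mk1 (_ : (fun t => _) = g1) ?derive_val//.
by apply/funext => ?; rewrite mk1.
Qed.

Lemma der_chain f (g0 g1 : R -> R) (t l0 l1 : R) :
  differentiable f (mk (g0 t) (g1 t)) -> is_derive t 1 g0 l0 ->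
  is_derive t 1 g1 l1 ->
  is_derive t 1 (fun t => f (mk (g0 t) (g1 t)))
    (l0 * px f (mk (g0 t) (g1 t)) + l1 * py f (mk (g0 t) (g1 t))).
Proof.
move=> df d0 d1; have dm := is_derive_mk d0 d1.
have dfm : differentiable (fun t => mk (g0 t) (g1 t)) t.
  by apply/derivable1_diffP; exact: ex_derive.
apply: DeriveDef; first by apply/derivable1_diffP; exact: differentiable_comp.
rewrite deriveE; last exact: differentiable_comp.
rewrite (diff_comp dfm df)/= -(deriveE (1 : R) dfm) derive_val -deriveE//.
by rewrite derive_partial// mk0 mk1.
Qed.

Lemma cts_mk (T : topologicalType) (g0 g1 : T -> R) t : continuous_at t g0 ->
  continuous_at t g1 -> continuous_at t (fun t => mk (g0 t) (g1 t)).
Proof.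
move=> c0 c1; apply: cvgD.
  by apply: cvgZr_tmp; exact: c0.
by apply: cvgZr_tmp; exact: c1.
Qed.
Definition C1 A f := forall x, A x ->
  [/\ differentiable f x, continuous_at x (px f)
   & continuous_at x (py f)].

Lemma C1_cts A f x : C1 A f -> A x -> continuous_at x f.
Proof. by move=> cf /cf[/differentiable_continuous]. Qed.

Lemma C1_sub A B f : A `<=` B -> C1 B f -> C1 A f.
Proof. by move=> AB cf x /AB/cf. Qed.

Lemma C1_pd A f x b : C1 A f -> A x -> continuous_at x (pd b f).
Proof. by move=> cf /cf[]; case: b. Qed.

Arguments C1_pd {A f x} b _ _.

Lemma near_pd A f g x b : open A -> A x -> (forall y, A y -> f y = g y) ->
  pd b f x = pd b g x.
Proof.
move=> oA Ax fg; rewrite pdE; apply: near_eq_derive; near=> y; apply: fg.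
by near: y; exact: open_nbhs_nbhs.
Unshelve. all: by end_near. Qed.

Lemma cts_open (f g : 'rV[R]_2 -> R) A x : open A -> A x ->
  (forall y, A y -> f y = g y) -> continuous_at x f -> continuous_at x g.
Proof.
move=> oA Ax fg; apply: cts_near.
have : \forall y \near x, A y by exact: open_nbhs_nbhs.
exact: filterS.
Qed.

(** Derivative formulas hold on A only, so continuity is proved for the formula [df] and carried
    over to the actual partial derivatives by the openness of A. *)
Lemma C1_intro A f (df : bool -> 'rV[R]_2 -> R) : open A ->
  (forall x, A x -> differentiable f x) ->
  (forall b x, A x -> df b x = pd b f x) ->
  (forall b x, A x -> continuous_at x (df b)) -> C1 A f.
Proof.
move=> oA dif e c x Ax.
have h b : continuous_at x (pd b f) by exact: cts_open oA Ax (e b) (c b x Ax).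
by split; [exact: dif|exact: h|exact: h].
Qed.

Lemma C1_diff A f x : C1 A f -> A x -> differentiable f x.
Proof. by move=> cf /cf[]. Qed.

Lemma C1_eq A f g : open A -> (forall y, A y -> f y = g y) -> C1 A f -> C1 A g.
Proof.
move=> oA fg cf; apply: (@C1_intro A g (fun b => pd b f)) => //.
- move=> x Ax; apply: near_eq_differentiable (C1_diff cf Ax).
  have : \forall y \near x, A y by exact: open_nbhs_nbhs.
  exact: filterS.
- by move=> b x Ax; exact: near_pd fg.
- by move=> b x; exact: C1_pd.
Qed.

Lemma pd_add f g x b : differentiable f x -> differentiable g x ->
  pd b (fun y => f y + g y) x = pd b f x + pd b g x.
Proof. by move=> df dg; rewrite pdE; apply: deriveD; exact: diff_derivable. Qed.

Lemma pd_opp f x b : differentiable f x -> pd b (fun y => - f y) x = - pd b f x.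
Proof. by move=> df; rewrite pdE; apply: deriveN; exact: diff_derivable. Qed.

Lemma pd_mul f g x b : differentiable f x -> differentiable g x ->
  pd b (fun y => f y * g y) x = pd b f x * g x + f x * pd b g x.
Proof.
move=> df dg; rewrite pdE /partial (@deriveM _ _ f g); try exact: diff_derivable.
by rewrite addrC; congr (_ + _); exact: mulrC.
Qed.

Lemma pd_cst k x b : pd b (fun=> k : R) x = 0.
Proof. by rewrite pdE; exact: derive_cst. Qed.

Lemma differentiable_comp1 (h : R -> R) l f x : is_derive (f x) 1 h l ->
  differentiable f x -> differentiable (fun y => h (f y)) x.
Proof.
move=> dh df; apply: differentiable_comp => //.
by apply/derivable1_diffP; exact: ex_derive.
Qed.

Lemma pd_comp (h : R -> R) l f x b : is_derive (f x) 1 h l ->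
  differentiable f x -> pd b (fun y => h (f y)) x = l * pd b f x.
Proof.
move=> dh df; have dh' : differentiable h (f x).
  by apply/derivable1_diffP; exact: ex_derive.
rewrite pdE /partial deriveE; last exact: differentiable_comp.
rewrite (diff_comp df dh')/= -(deriveE _ df) -[X in 'd h _ X](mulr1).
by rewrite -[X in 'd h _ X]/(_ *: 1) linearZ/= -deriveE// derive_val mulrC.
Qed.

Lemma C1_cst A k : open A -> C1 A (fun=> k).
Proof.
move=> oA; apply: (@C1_intro A _ (fun _ _ => 0)) => //.
- by move=> b x Ax; rewrite pd_cst.
- by move=> b x Ax; exact: cts_cst.
Qed.

Lemma C1_add A f g : open A -> C1 A f -> C1 A g -> C1 A (fun y => f y + g y).
Proof.
move=> oA cf cg; apply: (@C1_intro A _ (fun b x => pd b f x + pd b g x)) => //.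
- by move=> x Ax; apply: differentiableD; [exact: C1_diff cf Ax|exact: C1_diff cg Ax].
- by move=> b x Ax; rewrite pd_add//; [exact: C1_diff cf Ax|exact: C1_diff cg Ax].
- by move=> b x Ax; have ? := C1_pd b cf Ax; have ? := C1_pd b cg Ax; cts.
Qed.

Lemma C1_opp A f : open A -> C1 A f -> C1 A (fun y => - f y).
Proof.
move=> oA cf; apply: (@C1_intro A _ (fun b x => - pd b f x)) => //.
- by move=> x Ax; apply: differentiableN; exact: C1_diff cf Ax.
- by move=> b x Ax; rewrite pd_opp//; exact: C1_diff cf Ax.
- by move=> b x Ax; have ? := C1_pd b cf Ax; cts.
Qed.

Lemma C1_mul A f g : open A -> C1 A f -> C1 A g -> C1 A (fun y => f y * g y).
Proof.
move=> oA cf cg; apply: (@C1_intro A _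
  (fun b x => pd b f x * g x + f x * pd b g x)) => //.
- by move=> x Ax; apply: differentiableM; [exact: C1_diff cf Ax|exact: C1_diff cg Ax].
- by move=> b x Ax; rewrite pd_mul//; [exact: C1_diff cf Ax|exact: C1_diff cg Ax].
- move=> b x Ax; have ? := C1_pd b cf Ax; have ? := C1_pd b cg Ax.
  by have ? := C1_cts cf Ax; have ? := C1_cts cg Ax; cts.
Qed.

Lemma C1_comp A (h dh : R -> R) f : open A -> C1 A f ->
  (forall x, A x -> is_derive (f x) 1 h (dh (f x))) ->
  (forall x, A x -> continuous_at (f x) dh) -> C1 A (fun y => h (f y)).
Proof.
move=> oA cf ch cdh; apply: (@C1_intro A _ (fun b x => dh (f x) * pd b f x)) => //.
- by move=> x Ax; apply: (differentiable_comp1 (ch x Ax)); exact: C1_diff cf Ax.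
- by move=> b x Ax; rewrite (pd_comp _ (ch x Ax))//; exact: C1_diff cf Ax.
- move=> b x Ax; have ? := C1_pd b cf Ax; have ? := C1_cts cf Ax.
  by apply: cts_mul => //; apply: cts_comp => //; exact: cdh.
Qed.

Lemma pd_coord b c x :
  pd b (fun x => x 0 (if c then 1 else 0)) x = (b == c)%:R.
Proof.
have := @derive_mx R 'rV[R]_2 1 2 id x (delta_mx 0 (if b then 1 else 0))
  (@derivable_id _ _ x _).
rewrite derive_id => /matrixP/(_ 0 (if c then 1 else 0)).
by rewrite pdE !mxE/=; case: b; case: c.
Qed.

Lemma C1_coord A (c : bool) : open A -> C1 A (fun x => x 0 (if c then 1 else 0)).
Proof.
move=> oA; apply: (@C1_intro A _ (fun b _ => (b == c)%:R)) => //.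
- by move=> x Ax; exact: differentiable_coord.
- by move=> b x Ax; rewrite pd_coord.
- by move=> b x Ax; exact: cts_cst.
Qed.

(* Log-polar coordinates about [a]: the circle of index [t] has radius e^t. *)
Definition pol a (t s : R) : 'rV[R]_2 :=
  mk (a 0 0 + expR t * cos s) (a 0 1 + expR t * sin s).

Lemma cosD2 (s : R) : cos (s + 2 * pi) = cos s.
Proof. by rewrite mulr_natl; exact: cosD2pi. Qed.

Lemma sinD2 (s : R) : sin (s + 2 * pi) = sin s.
Proof. by rewrite mulr_natl; exact: sinD2pi. Qed.

Lemma pol_per a t s : pol a t (s + 2 * pi) = pol a t s.
Proof. by rewrite /pol cosD2 sinD2. Qed.

Lemma der_pol_t f a t s : differentiable f (pol a t s) ->
  is_derive t 1 (fun t => f (pol a t s))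
    (expR t * (cos s * px f (pol a t s) + sin s * py f (pol a t s))).
Proof.
move=> df; notypeclasses refine (der_eq (@der_chain f
  (fun t => a 0 0 + expR t * cos s) (fun t => a 0 1 + expR t * sin s)
  t _ _ df _ _) _); [by der|by der|].
by rewrite /pol /=; ring.
Qed.

Lemma der_pol_s f a t s : differentiable f (pol a t s) ->
  is_derive s 1 (fun s => f (pol a t s))
    (expR t * (- sin s * px f (pol a t s) + cos s * py f (pol a t s))).
Proof.
move=> df; notypeclasses refine (der_eq (@der_chain f
  (fun s => a 0 0 + expR t * cos s) (fun s => a 0 1 + expR t * sin s)
  s _ _ df _ _) _); [by der|by der|].
by rewrite /pol /=; ring.
Qed.

Lemma cts_pol f a (p : R * R) : continuous_at (pol a p.1 p.2) f ->
  continuous_at p (fun p => f (pol a p.1 p.2)).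
Proof.
move=> cf; apply: (@continuous_comp _ _ _ (fun p : R * R => pol a p.1 p.2) f) => //.
have c1 : continuous_at p (fun p : R * R => p.1) by exact: cvg_fst.
have c2 : continuous_at p (fun p : R * R => p.2) by exact: cvg_snd.
by apply: cts_mk; cts.
Qed.

Lemma cts_pol_s f a t s : continuous_at (pol a t s) f ->
  continuous_at s (fun s => f (pol a t s)).
Proof.
move=> cf; apply: (@continuous_comp _ _ _ (fun s : R => pol a t s) f) => //.
by apply: cts_mk; cts.
Qed.

(** Continuity on a compact rectangle gives the constant that dominates a t-derivative under the
    circle integral. *)
Lemma bounded_pol (h : R -> R -> R) t0 d : 0 <= d ->
  (forall t s, `|t - t0| <= d -> continuous_at (t, s) (fun p : R * R => h p.1 p.2)) ->
  exists G, forall t s, `|t - t0| <= d -> 0 <= s <= 2 * pi -> `|h t s| <= G.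
Proof.
move=> d0 ch; pose K := `[t0 - d, t0 + d]%classic `*` `[0, 2 * pi : R]%classic.
have cK : compact K by apply: compact_setX; exact: segment_compact.
have pi0 : 0 < pi :> R by exact: pi_gt0.
have K0 : K !=set0.
  by exists (t0, 0); split => /=; rewrite in_itv/=; apply/andP; split; lra.
have cf : {within K, continuous (fun p => `|h p.1 p.2|)}.
  apply/subspace_continuousP => -[t s] [/= ht hs].
  apply: cvg_within_filter.
  apply: (@cvg_norm _ _ _ _ _ (fun p => h p.1 p.2)).
  by apply: ch; move: ht; rewrite in_itv/= ler_norml => /andP[? ?]; apply/andP; split; lra.
have [c _ hc] := compact_EVT_max K0 cK cf.
exists `|h c.1 c.2| => t s ht hs.
apply: (hc (t, s)); rewrite inE; split => /=; rewrite in_itv//=.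
by move: ht; rewrite ler_norml => /andP[? ?]; apply/andP; split; lra.
Qed.

Definition flux (Y0 Y1 : 'rV[R]_2 -> R) a t : R :=
  cint (fun s => expR t * (Y0 (pol a t s) * cos s + Y1 (pol a t s) * sin s)).

(** The divergence theorem, infinitesimally in the radius. Differentiation under the integral gives
    e^(2t) div Y minus the derivative along the circle of the tangential term e^t (-sin s Y0 + cos s
    Y1), and the latter integrates to 0 over a period. *)
Theorem der_flux (Y0 Y1 : 'rV[R]_2 -> R) A a t0 d : open A -> C1 A Y0 -> C1 A Y1 ->
  0 < d -> (forall t s, `|t - t0| <= d -> A (pol a t s)) ->
  is_derive t0 1 (flux Y0 Y1 a)
    (cint (fun s => expR t0 ^+ 2 *
       (px Y0 (pol a t0 s) + py Y1 (pol a t0 s)))).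
Proof.
move=> oA c0 c1 d0 hA.
pose P00 p := px Y0 p; pose P01 p := py Y0 p.
pose P10 p := px Y1 p; pose P11 p := py Y1 p.
pose df t s := expR t * (Y0 (pol a t s) * cos s + Y1 (pol a t s) * sin s) +
   expR t ^+ 2 * ((cos s * P00 (pol a t s) + sin s * P01 (pol a t s)) * cos s +
   (cos s * P10 (pol a t s) + sin s * P11 (pol a t s)) * sin s).
have ct (p : R * R) f : A (pol a p.1 p.2) ->
    (A (pol a p.1 p.2) -> continuous_at (pol a p.1 p.2) f) ->
    continuous_at p (fun p => f (pol a p.1 p.2)).
  by move=> Ap cf; apply: cts_pol; exact: cf.
have cY0 x : A x -> continuous_at x Y0 by exact: C1_cts.
have cY1 x : A x -> continuous_at x Y1 by exact: C1_cts.
have cP00 x : A x -> continuous_at x P00 by exact: C1_pd.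
have cP01 x : A x -> continuous_at x P01 by exact: C1_pd.
have cP10 x : A x -> continuous_at x P10 by exact: C1_pd.
have cP11 x : A x -> continuous_at x P11 by exact: C1_pd.
have [G hG] : exists G, forall t s, `|t - t0| <= d -> 0 <= s <= 2 * pi -> `|df t s| <= G.
  apply: bounded_pol; first exact: ltW.
  move=> t s ht; have Ap := hA t s ht.
  have e1 : continuous_at (t, s) (fun p : R * R => p.1) by exact: cvg_fst.
  have e2 : continuous_at (t, s) (fun p : R * R => p.2) by exact: cvg_snd.
  have f1 := @ct (t, s) Y0 Ap (cY0 _). have f2 := @ct (t, s) Y1 Ap (cY1 _).
  have f3 := @ct (t, s) P00 Ap (cP00 _). have f4 := @ct (t, s) P01 Ap (cP01 _).
  have f5 := @ct (t, s) P10 Ap (cP10 _). have f6 := @ct (t, s) P11 Ap (cP11 _).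
  by rewrite /df; cts.
have cs t f : `|t - t0| <= d -> (forall x, A x -> continuous_at x f) ->
    continuous (fun s => f (pol a t s)).
  by move=> ht cf s; apply: cts_pol_s; apply: cf; exact: hA.
have h0 : `|t0 - t0| <= d by rewrite subrr normr0 ltW.
have k1 := cs t0 _ h0 cY0; have k2 := cs t0 _ h0 cY1.
have k3 := cs t0 _ h0 cP00; have k4 := cs t0 _ h0 cP01.
have k5 := cs t0 _ h0 cP10; have k6 := cs t0 _ h0 cP11.
have key : cint (df t0) = cint (fun s => expR t0 ^+ 2 * (P00 (pol a t0 s) + P11 (pol a t0 s))).
  pose k s := expR t0 * (- sin s * Y1 (pol a t0 s) - cos s * Y0 (pol a t0 s)) +
     expR t0 ^+ 2 * (- sin s * (- sin s * P00 (pol a t0 s) + cos s * P01 (pol a t0 s)) +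
     cos s * (- sin s * P10 (pol a t0 s) + cos s * P11 (pol a t0 s))).
  have ck : continuous k by move=> s; rewrite /k; cts.
  have cdiv : continuous (fun s => expR t0 ^+ 2 * (P00 (pol a t0 s) + P11 (pol a t0 s))).
    by move=> s; cts.
  have -> : df t0 = fun s => expR t0 ^+ 2 * (P00 (pol a t0 s) + P11 (pol a t0 s)) - k s.
    apply/funext => s; rewrite /df /k.
    have -> : P00 (pol a t0 s) + P11 (pol a t0 s) =
      (cos s ^+ 2 + sin s ^+ 2) * (P00 (pol a t0 s) + P11 (pol a t0 s)).
      by rewrite cos2Dsin2 mul1r.
    by ring.
  rewrite cintB//.
  have -> : cint k = 0; last by rewrite subr0.
  pose F s := expR t0 * (- sin s * Y0 (pol a t0 s) + cos s * Y1 (pol a t0 s)).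
  have -> : cint k = F (2 * pi) - F 0; last first.
    rewrite /F -[2 * pi]add0r pol_per cosD2 sinD2.
    by rewrite subrr.
  apply: cint_deriv => // s _; have Ap := hA t0 s h0.
  have [D0 _ _] := c0 _ Ap; have [D1 _ _] := c1 _ Ap.
  have d1 := der_pol_s D0; have d2 := der_pol_s D1.
  by rewrite /F; der_by; rewrite /k /P00 /P01 /P10 /P11; ring.
rewrite -key; apply: (@cint_diff R (fun t s => expR t *
  (Y0 (pol a t s) * cos s + Y1 (pol a t s) * sin s)) df t0 d G) => //.
- move=> t s /ltW ht; have Ap := hA t s ht.
  have [D0 _ _] := c0 _ Ap; have [D1 _ _] := c1 _ Ap.
  have ? := der_pol_t D0; have ? := der_pol_t D1.
  by der_by; rewrite /df /P00 /P01 /P10 /P11; ring.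
- move=> t /ltW ht s; have q1 := cs t _ ht cY0; have q2 := cs t _ ht cY1.
  by cts.
- by move=> t s /ltW; exact: hG.
Qed.

End Plane.

(** * Cutoffs and growth inequalities *)

Section Smoothstep.
Variable R : realType.
Implicit Types x y : R.

(** The projection of x to [0, 1], written with absolute values so that continuity is immediate. *)
Definition clamp x : R := 2^-1 * (`|x| - `|x - 1| + 1).
(** The cubic smoothstep: C^1, bounded by 1, and zero exactly for x <= 0. Boundedness makes
    truncated fluxes controllable without a bound on the function itself, and the exact zero set
    lets a vanishing truncation be read as an inequality. *)
Definition sstep x : R := 3 * clamp x ^+ 2 - 2 * clamp x ^+ 3.
Definition dsstep x : R := 6 * clamp x * (1 - clamp x).

Lemma clampP x : [\/ x <= 0 /\ clamp x = 0, 0 <= x <= 1 /\ clamp x = x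
  | 1 <= x /\ clamp x = 1].
Proof.
rewrite /clamp; have [x0|x0] := leP x 0.
  by constructor 1; split=> //; rewrite ler0_norm ?ler0_norm//; lra.
have [x1|x1] := leP x 1.
  constructor 2; split; first by rewrite (ltW x0).
  by rewrite gtr0_norm// ler0_norm; lra.
constructor 3; split; first exact: ltW.
by rewrite gtr0_norm// ger0_norm; lra.
Qed.

Lemma sstep_le0 x : x <= 0 -> sstep x = 0.
Proof.
move=> x0; rewrite /sstep; have [[_ ->]|[h ->]|[h ->]] := clampP x; try by ring.
  have -> : x = 0 by lra.
  ring.
lra.
Qed.

Lemma sstep_ge1 x : 1 <= x -> sstep x = 1.
Proof.
move=> x1; rewrite /sstep; have [[h ->]|[h ->]|[h ->]] := clampP x; try by ring.
  lra.
have -> : x = 1 by lra.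
ring.
Qed.

Let cubic_itv x : 0 <= x <= 1 -> 0 <= 3 * x ^+ 2 - 2 * x ^+ 3 <= 1.
Proof.
move=> /andP[x0 x1]; have e1 : 0 <= x ^+ 2 * (3 - 2 * x).
  by rewrite mulr_ge0 ?sqr_ge0//; lra.
have e2 : 0 <= (1 - x) ^+ 2 * (1 + 2 * x) by rewrite mulr_ge0 ?sqr_ge0//; lra.
have e3 : 3 * x ^+ 2 - 2 * x ^+ 3 = x ^+ 2 * (3 - 2 * x) by ring.
have e4 : 1 - (3 * x ^+ 2 - 2 * x ^+ 3) = (1 - x) ^+ 2 * (1 + 2 * x) by ring.
by apply/andP; split; [rewrite e3|rewrite -subr_ge0 e4].
Qed.

Lemma sstep_itv x : 0 <= sstep x <= 1.
Proof.
rewrite /sstep; have [[_ ->]|[h ->]|[h ->]] := clampP x; try lra.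
exact: cubic_itv.
Qed.

Lemma sstep_mono x y : x <= y -> sstep x <= sstep y.
Proof.
move=> xy; have [x0|x0] := leP x 0.
  by rewrite sstep_le0//; have /andP[] := sstep_itv y.
have [y1|y1] := leP 1 y.
  by rewrite (sstep_ge1 y1); have /andP[] := sstep_itv x.
rewrite /sstep; have [[h _]|[_ ->]|[h _]] := clampP x; try lra.
have [[h _]|[_ ->]|[h _]] := clampP y; try lra.
rewrite -subr_ge0.
have -> : 3 * y ^+ 2 - 2 * y ^+ 3 - (3 * x ^+ 2 - 2 * x ^+ 3) =
  (y - x) * (2 * (x * (1 - x)) + 2 * (y * (1 - y)) + x * (1 - y) + y * (1 - x)) by ring.
have a1 : 0 <= x * (1 - x) by rewrite mulr_ge0//; lra.
have a2 : 0 <= y * (1 - y) by rewrite mulr_ge0//; lra.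
have a3 : 0 <= x * (1 - y) by rewrite mulr_ge0//; lra.
have a4 : 0 <= y * (1 - x) by rewrite mulr_ge0//; lra.
by rewrite mulr_ge0//; lra.
Qed.

Lemma sstep_gt0 x : 0 < x -> 0 < sstep x.
Proof.
move=> x0; rewrite /sstep; have [[h _]|[h ->]|[_ ->]] := clampP x; try lra.
have -> : 3 * x ^+ 2 - 2 * x ^+ 3 = x ^+ 2 * (3 - 2 * x) by ring.
by rewrite mulr_gt0 ?exprn_gt0//; lra.
Qed.

Lemma sstep_eq0 x : sstep x = 0 -> x <= 0.
Proof. by move=> e; rewrite leNgt; apply/negP => /sstep_gt0; rewrite e ltxx. Qed.

Lemma dsstep_itv x : 0 <= dsstep x <= 2.
Proof. by rewrite /dsstep; have [[_ ->]|[h ->]|[h ->]] := clampP x; nra. Qed.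

Lemma dsstep_le0 x : x <= 0 -> dsstep x = 0.
Proof.
move=> x0; rewrite /dsstep; have [[_ ->]|[h ->]|[h ->]] := clampP x; try by ring.
have -> : x = 0 by lra.
ring.
Qed.

Let sqr_le x y : 0 <= x -> x <= y -> x ^+ 2 <= y ^+ 2.
Proof. by move=> x0 xy; rewrite lerXn2r// nnegrE// (le_trans x0). Qed.

(** For one point x inside [0, 1] and the other beyond the joint at 0, with y the distance between
    them. The joint at 1 follows by x |-> 1 - x. *)
Let half x y : 0 <= x <= 1 -> x <= y ->
  `|- (3 * x ^+ 2 - 2 * x ^+ 3) + y * (6 * x * (1 - x))| <= 3 * y ^+ 2.
Proof.
move=> /andP[x0 x1] xy.
have a1 : 0 <= (y - x) ^+ 2 by exact: sqr_ge0.
have a2 : 0 <= x ^+ 2 * (3 * y - x) by rewrite mulr_ge0 ?sqr_ge0//; lra.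
have a3 : 0 <= y * (x * (1 - x)) by rewrite !mulr_ge0//; lra.
have a4 : x ^+ 2 <= y ^+ 2 by exact: sqr_le.
have a5 : 0 <= x ^+ 3 by rewrite exprn_ge0.
rewrite ler_norml; apply/andP; split; rewrite -subr_ge0.
  have -> : - (3 * x ^+ 2 - 2 * x ^+ 3) + y * (6 * x * (1 - x)) - - (3 * y ^+ 2) =
    3 * (y ^+ 2 - x ^+ 2) + 2 * x ^+ 3 + 6 * (y * (x * (1 - x))) by ring.
  lra.
have -> : 3 * y ^+ 2 - (- (3 * x ^+ 2 - 2 * x ^+ 3) + y * (6 * x * (1 - x))) =
  3 * (y - x) ^+ 2 + 2 * (x ^+ 2 * (3 * y - x)) by ring.
lra.
Qed.

Lemma der_sstep x : is_derive x 1 sstep (dsstep x).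
Proof.
(* For x, y in [0, 1] the remainder is (3 - 2y - 4x)(y - x)^2, and the factor lies in [-3, 3]; the
   same 3 covers the other cases. *)
apply: (@is_derive_quadratic _ _ _ _ 3) => y.
rewrite /sstep /dsstep.
have [[hx ->]|[hx ->]|[hx ->]] := clampP x.
- have -> : (y - x) * (6 * 0 * (1 - 0)) = 0 by ring.
  rewrite !expr0n/= !mulr0 !subr0.
  have [[hy ->]|[hy ->]|[hy ->]] := clampP y.
  + by rewrite !expr0n/= !mulr0 subrr normr0 mulr_ge0// sqr_ge0.
  + have /andP[h0 h1] := cubic_itv hy; rewrite ger0_norm//.
    have : y ^+ 2 <= (y - x) ^+ 2 by apply: sqr_le; lra.
    have : 0 <= y ^+ 3 by rewrite exprn_ge0//; lra.
    by move=> *; lra.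
  + have : 1 ^+ 2 <= (y - x) ^+ 2 by apply: sqr_le; lra.
    by rewrite !expr1n ger0_norm; lra.
- have [[hy ->]|[hy ->]|[hy ->]] := clampP y.
  + have := @half x (x - y) hx.
    have -> : (x - y) ^+ 2 = (y - x) ^+ 2 by ring.
    have -> : - (3 * x ^+ 2 - 2 * x ^+ 3) + (x - y) * (6 * x * (1 - x)) =
      3 * 0 ^+ 2 - 2 * 0 ^+ 3 - (3 * x ^+ 2 - 2 * x ^+ 3) - (y - x) * (6 * x * (1 - x)).
      by ring.
    by apply; lra.
  + have -> : 3 * y ^+ 2 - 2 * y ^+ 3 - (3 * x ^+ 2 - 2 * x ^+ 3) -
      (y - x) * (6 * x * (1 - x)) = (3 - 2 * y - 4 * x) * (y - x) ^+ 2 by ring.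
    rewrite normrM (ger0_norm (sqr_ge0 _)) ler_wpM2r ?sqr_ge0//.
    by rewrite ler_norml; apply/andP; split; lra.
  + have hx' : 0 <= 1 - x <= 1 by lra.
    have := @half (1 - x) (y - x) hx'; rewrite -normrN.
    have -> : - (- (3 * (1 - x) ^+ 2 - 2 * (1 - x) ^+ 3) +
        (y - x) * (6 * (1 - x) * (1 - (1 - x)))) =
      3 * 1 ^+ 2 - 2 * 1 ^+ 3 - (3 * x ^+ 2 - 2 * x ^+ 3) - (y - x) * (6 * x * (1 - x)).
      by ring.
    by apply; lra.
- have -> : (y - x) * (6 * 1 * (1 - 1)) = 0 by ring.
  rewrite !expr1n subr0.
  have [[hy ->]|[hy ->]|[hy ->]] := clampP y.
  + have : 1 ^+ 2 <= (x - y) ^+ 2 by apply: sqr_le; lra.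
    have -> : (x - y) ^+ 2 = (y - x) ^+ 2 by ring.
    by rewrite !expr1n !expr0n/= ler0_norm; lra.
  + have hy' : 0 <= 1 - y <= 1 by lra.
    have /andP[h0 h1] := cubic_itv hy'.
    have -> : 3 * y ^+ 2 - 2 * y ^+ 3 - (3 * 1 - 2 * 1) =
      - (3 * (1 - y) ^+ 2 - 2 * (1 - y) ^+ 3) by ring.
    rewrite normrN ger0_norm//.
    have : (1 - y) ^+ 2 <= (x - y) ^+ 2 by apply: sqr_le; lra.
    have : 0 <= (1 - y) ^+ 3 by rewrite exprn_ge0//; lra.
    have -> : (x - y) ^+ 2 = (y - x) ^+ 2 by ring.
    by move=> *; lra.
  + by rewrite !expr1n subrr normr0 mulr_ge0// sqr_ge0.
Qed.

Lemma cts_norm (T : topologicalType) (f : T -> R) t : continuous_at t f ->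
  continuous_at t (fun t => `|f t|).
Proof. exact: cvg_norm. Qed.

Lemma cts_clamp x : continuous_at x clamp.
Proof.
have h1 : continuous_at x (fun x => `|x|) by apply: cts_norm; exact: cvg_id.
have h2 : continuous_at x (fun x => `|x - 1|) by apply: cts_norm; cts.
by rewrite /clamp; cts.
Qed.

Lemma cts_dsstep x : continuous_at x dsstep.
Proof. by have ? := @cts_clamp x; rewrite /dsstep; cts. Qed.

End Smoothstep.

(** * Differential inequalities for a flux y and its energy E = y' *)

Section Growth.
Variable R : realType.
Implicit Types (y E : R -> R) (t : R).

(** Cauchy-Schwarz on [s1, s2], from the nonnegativity of the integral of (f' - l)^2 with l the
    slope of the chord. *)
Lemma osc_sqr (f df : R -> R) (s1 s2 : R) : continuous df ->
  (forall t, is_derive t 1 f (df t)) ->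
  0 <= s1 <= 2 * pi -> 0 <= s2 <= 2 * pi ->
  (f s2 - f s1) ^+ 2 <= 2 * pi * cint (fun t => df t ^+ 2).
Proof.
move=> cdf dF; wlog s12 : s1 s2 / s1 <= s2 => [hw|].
  have [s12|/ltW s21] := leP s1 s2 => h1 h2; first exact: hw.
  by rewrite -sqrrN opprB; exact: hw.
move=> /andP[s10 s1p] /andP[s20 s2p].
have c2 : continuous (fun t => df t ^+ 2) by move=> t; cts.
have [G dG] := antiderivative 0 (2 * pi) c2.
have IG : cint (fun t => df t ^+ 2) = G (2 * pi) - G 0 by exact: cint_deriv.
have Gmon (x z : R) : 0 <= x -> x <= z -> z <= 2 * pi -> G x <= G z.
  move=> x0 xy y1; apply: (@derive_ge0_le _ G (fun t => df t ^+ 2)) => //.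
    by move=> w /andP[xw wz]; apply: dG; rewrite (le_trans x0)//= (le_trans wz).
  by move=> w _; exact: sqr_ge0.
have GG : G s2 - G s1 <= cint (fun t => df t ^+ 2).
  by rewrite IG lerB ?Gmon.
move: s12; rewrite le_eqVlt => /predU1P[->|s12].
  rewrite subrr expr0n/= mulr_ge0 ?mulr_ge0 ?pi_ge0//.
  by apply: cint_ge0 => t; exact: sqr_ge0.
pose l := (f s2 - f s1) / (s2 - s1).
have s21 : 0 < s2 - s1 by rewrite subr_gt0.
have hq : G s1 - 2 * l * f s1 + l ^+ 2 * s1 <= G s2 - 2 * l * f s2 + l ^+ 2 * s2.
  apply: (@derive_ge0_le _ (fun t => G t - 2 * l * f t + l ^+ 2 * t)
     (fun t => (df t - l) ^+ 2)); first exact: ltW.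
    move=> t /andP[ht1 ht2]; have d1 := dF t.
    have d2 : is_derive t 1 G (df t ^+ 2).
      by apply: dG; rewrite (le_trans s10)//= (le_trans ht2).
    by der_by; ring.
  by move=> t _; exact: sqr_ge0.
have -> : (f s2 - f s1) ^+ 2 = (s2 - s1) * (2 * l * (f s2 - f s1) - l ^+ 2 * (s2 - s1)).
  by rewrite /l; field; rewrite gt_eqF.
have h1 : 2 * l * (f s2 - f s1) - l ^+ 2 * (s2 - s1) <= cint (fun t => df t ^+ 2).
  by move: GG hq; move: (cint _) => I; clear; nra.
have I0 : 0 <= cint (fun t => df t ^+ 2) by apply: cint_ge0 => t; exact: sqr_ge0.
apply: (le_trans (ler_wpM2l (ltW s21) h1)); apply: ler_wpM2r => //.
by clear -s10 s2p; lra.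
Qed.

(* The Riccati inequality [y ^+ 2 <= C y'] blows up in finite time once [y > 0]. *)
Lemma riccati_le0 y E C t0 : 0 < C ->
  (forall t, t0 < t -> is_derive t 1 y (E t)) ->
  (forall t, t0 < t -> y t ^+ 2 <= C * E t) ->
  forall t, t0 < t -> y t <= 0.
Proof.
move=> C0 dy yE t t0t; rewrite leNgt; apply/negP => yt.
have E0 s : t0 < s -> 0 <= E s.
  by move=> /yE; have := sqr_ge0 (y s); move: (y s ^+ 2) => z; nra.
have ypos s : t <= s -> 0 < y s.
  move=> ts; apply: (lt_le_trans yt).
  apply: (@derive_ge0_le _ y E) => // z /andP[tz _].
    by apply: dy; exact: lt_le_trans tz.
  by apply: E0; exact: lt_le_trans tz.
(* Past the blow-up time t + C / y(t): as -1/y - t/C is nondecreasing, 1/y(s) would be at most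
   -1. *)
pose s := t + C * (1 / y t + 1).
have ts : t <= s by rewrite lerDl mulr_ge0 ?ltW// addr_gt0// divr_gt0.
have : - (y t)^-1 - t / C <= - (y s)^-1 - s / C.
  apply: (@derive_ge0_le _ (fun t => - (y t)^-1 - t / C)
    (fun t => E t / y t ^+ 2 - C^-1)) => // z /andP[tz zs].
    have d1 := dy z (lt_le_trans t0t tz).
    have yz : y z != 0 by rewrite gt_eqF// ypos.
    by der_by; rewrite mulNr; field; rewrite yz gt_eqF.
  rewrite subr_ge0 ler_pdivlMr ?exprn_gt0 ?ypos// mulrC.
  by rewrite ler_pdivrMr// mulrC; apply: yE; exact: lt_le_trans tz.
have -> : s / C = t / C + (y t)^-1 + 1.
  by rewrite /s; field; rewrite !gt_eqF.
have : 0 < (y s)^-1 by rewrite invr_gt0 ypos.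
by move: (y t)^-1 (y s)^-1 (t / C) => a b c; clear; lra.
Qed.

(** If E stayed above d, then y would grow at least linearly and become positive, against
    [riccati_le0]. *)
Lemma riccati_liminf y E C t0 : 0 < C ->
  (forall t, t0 < t -> is_derive t 1 y (E t)) ->
  (forall t, t0 < t -> y t ^+ 2 <= C * E t) ->
  forall d t1, 0 < d -> exists2 t, t1 < t & E t <= d.
Proof.
move=> C0 dy yE d t1 d0; apply: contrapT => hn.
have hE t : t1 < t -> d < E t.
  by move=> h; rewrite ltNge; apply/negP => h2; apply: hn; exists t.
pose t2 := Num.max t0 t1 + 1.
have t02 : t0 < t2 by rewrite ltr_pwDr// le_max lexx.
have t12 : t1 < t2 by rewrite ltr_pwDr// le_max lexx orbT.
pose s := t2 + (`|y t2| + 1) / d.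
have yd : 0 < (`|y t2| + 1) / d by rewrite divr_gt0// ltr_wpDl.
have ts : t2 <= s by rewrite lerDl ltW.
have : y t2 - d * t2 <= y s - d * s.
  apply: (@derive_ge0_le _ (fun t => y t - d * t) (fun t => E t - d)) => //.
    move=> z /andP[tz _]; have d1 := dy z (lt_le_trans t02 tz).
    by der_by; ring.
  by move=> z /andP[tz _]; rewrite subr_ge0 ltW// hE// (lt_le_trans t12).
have -> : d * s = d * t2 + (`|y t2| + 1) by rewrite /s; field; rewrite gt_eqF.
have := riccati_le0 C0 dy yE (lt_le_trans t02 ts).
have := ler_norm (- y t2); rewrite normrN; lra.
Qed.

Lemma exp_decay y E C t0 : 0 < C ->
  (forall t, t0 < t -> is_derive t 1 y (E t)) ->
  (forall t, t0 < t -> - y t <= C * E t) ->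
  forall t1 t, t0 < t1 -> t1 <= t -> - y t <= - y t1 * expR (t1 / C) * expR (- t / C).
Proof.
move=> C0 dy yE t1 t t01 t1t.
have : - y t * expR (t / C) <= - y t1 * expR (t1 / C).
  apply: (@derive_le0_ge _ (fun t => - y t * expR (t / C))
    (fun t => (- E t + - y t / C) * expR (t / C))) => // z /andP[tz _].
    by have d1 := dy z (lt_le_trans t01 tz); der_by; ring.
  rewrite mulr_le0_ge0 ?expR_ge0// addrC subr_le0 ler_pdivrMr// mulrC.
  by apply: yE; exact: lt_le_trans tz.
move=> h; rewrite -[- y t](mulfK (_ : expR (t / C) != 0)) ?gt_eqF ?expR_gt0//.
have -> : expR (- t / C) = (expR (t / C))^-1 by rewrite mulNr expRN.
by rewrite ler_wpM2r// invr_ge0 expR_ge0.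
Qed.

(** Mean value theorem on [t, t + 1], where y(t + 1) <= 0: a bound on the flux becomes a bound on
    the energy at some time in each unit interval. *)
Lemma good_time y E t0 t : (forall t, t0 < t -> is_derive t 1 y (E t)) ->
  (forall t, t0 < t -> y t <= 0) -> t0 < t ->
  exists2 s, t < s < t + 1 & E s <= - y t.
Proof.
move=> dy y0 t0t; have [|z|s hs] := @MVT_closed _ y E t (t + 1).
- by rewrite ltrDl.
- by move=> /andP[tz _]; apply: dy; exact: lt_le_trans tz.
rewrite addrAC subrr add0r mulr1 => e; exists s => //; rewrite -e.
by have := y0 (t + 1) (ltr_wpDr ler01 t0t); lra.
Qed.

(** As 2 / (1 + x) >= 2 - 2x, the hypothesis gives r |y| <= y' with r = 2 - 2 C0 e^(-bt), a rate
    whose defect from 2 is integrable. A positive y would grow like e^(2t), which the growth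
    hypothesis excludes; a negative one decays like e^(-2t), with no loss in the exponent. *)
Lemma sharp_decay y E b C0 t0 : 0 < b -> 0 <= C0 ->
  (forall t, t0 < t -> is_derive t 1 y (E t)) ->
  (forall t, t0 < t -> 0 <= E t) ->
  (forall t, t0 < t -> `|y t| <= 2^-1 * (1 + C0 * expR (- b * t)) * E t) ->
  (forall k, 0 < k -> exists2 t1, t0 < t1 & forall t, t1 < t -> y t <= k * expR (2 * t)) ->
  (forall t, t0 < t -> y t <= 0) /\
  forall t1, t0 < t1 -> exists A, forall t, t1 <= t -> - y t <= A * expR (- 2 * t).
Proof.
move=> b0 C00 dy E0 yE ysub.
(* [C1] makes [m] a primitive of [r] that differs from 2t by a nonnegative term tending to 0. *)
pose C1 := 2 * C0 / b.
have C10 : 0 <= C1 by rewrite divr_ge0 ?mulr_ge0// ltW.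
pose r t := 2 - 2 * C0 * expR (- b * t).
pose m t := 2 * t + C1 * expR (- b * t).
have dm t : is_derive t 1 m (r t).
  by rewrite /m; der_by; rewrite /C1 /r; field; rewrite gt_eqF.
have yr t : t0 < t -> r t * `|y t| <= E t.
  move=> ht; have := yE t ht; have := E0 t ht; rewrite /r.
  have := expR_gt0 (- b * t); move: (expR _) => e e0.
  have : 0 <= C0 * e by rewrite mulr_ge0// ltW.
  rewrite -!mulrA; move: (C0 * e) => f f0; have := normr_ge0 (y t).
  move: `|y t| (E t) => a c a0 c0 h.
  have [f1|f1] := leP f 1; last by nra.
  have : (2 - 2 * f) * a <= (2 - 2 * f) * (2^-1 * (1 + f) * c) by apply: ler_wpM2l => //; lra.
  by move=> h2; apply: (le_trans h2); nra.
have yle0 t : t0 < t -> y t <= 0.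
  move=> t0t; rewrite leNgt; apply/negP => yt.
  have ypos s : t <= s -> 0 < y s.
    move=> ts; apply: (lt_le_trans yt).
    apply: (@derive_ge0_le _ y E) => // z /andP[tz _].
      by apply: dy; exact: lt_le_trans tz.
    by apply: E0; exact: lt_le_trans tz.
  have grow s : t <= s -> y t * expR (- m t) <= y s * expR (- m s).
    move=> ts; apply: (@derive_ge0_le _ (fun t => y t * expR (- m t))
      (fun t => (E t - r t * y t) * expR (- m t))) => // z /andP[tz _].
      by have d1 := dy z (lt_le_trans t0t tz); have d2 := dm z; der_by; ring.
    rewrite mulr_ge0 ?expR_ge0// subr_ge0.
    by have := yr z (lt_le_trans t0t tz); rewrite gtr0_norm// ypos.
  pose k := y t * expR (- m t) / 2.
  have k0 : 0 < k by rewrite divr_gt0// mulr_gt0// expR_gt0.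
  have [t1 _ hk] := ysub k k0.
  pose s := Num.max t t1 + 1.
  have ts : t <= s by rewrite ler_wpDr// le_max lexx.
  have t1s : t1 < s by rewrite ltr_pwDr// le_max lexx orbT.
  have h1 := grow s ts; have h2 := hk s t1s.
  have h3 : expR (- m s) <= expR (- (2 * s)).
    by rewrite ler_expR lerN2 lerDl mulr_ge0// expR_ge0.
  have h4 : expR (2 * s) * expR (- (2 * s)) = 1.
    by rewrite expRN divff// gt_eqF ?expR_gt0.
  have : y s * expR (- m s) <= k * expR (2 * s) * expR (- (2 * s)).
    by apply: ler_pM => //; [exact/ltW/ypos].
  rewrite -mulrA h4 mulr1 => h5.
  have := le_trans h1 h5; rewrite /k; move: k0; rewrite /k.
  by move: (y t * _) => z; clear; lra.
split=> // t1 t01; exists (- y t1 * expR (m t1)) => t t1t.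
have h : - y t * expR (m t) <= - y t1 * expR (m t1).
  apply: (@derive_le0_ge _ (fun t => - y t * expR (m t))
    (fun t => (- E t + r t * - y t) * expR (m t))) => // z /andP[tz _].
    by have d1 := dy z (lt_le_trans t01 tz); have d2 := dm z; der_by; ring.
  have hz := lt_le_trans t01 tz.
  rewrite mulr_le0_ge0 ?expR_ge0// addrC subr_le0.
  by have := yr z hz; rewrite ler0_norm// yle0.
apply: (@le_trans _ _ (- y t * expR (m t) * expR (- 2 * t))).
  rewrite -mulrA -expRD ler_peMr ?oppr_ge0 ?yle0 ?(lt_le_trans t01)//.
  have -> : m t + -2 * t = C1 * expR (- b * t) by rewrite /m; ring.
  rewrite -[leLHS]expR0 ler_expR.
  by rewrite mulr_ge0// expR_ge0.
by rewrite ler_wpM2r// expR_ge0.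
Qed.

End Growth.

(** * Maximum principles *)

Section MonotonePairs.
Variable R : realType.
Local Notation px := (@pd R false).
Local Notation py := (@pd R true).
Implicit Types (v Zx Zy f : 'rV[R]_2 -> R) (a x : 'rV[R]_2) (A : set 'rV[R]_2)
  (K M t s r d e B : R).

Definition edens v Zx Zy x := Zx x * px v x + Zy x * py v x.

(* [Z] is a divergence-free field playing the role of the flow of [v], as
   W(Du) - W(Du') does for [v = u - u'].  The reverse bound on |Z|^2 is [zbound],
   which is only available where the slopes stay away from 1. *)
Record mpair A v Zx Zy (K : R) : Prop := MPair {
  mp_gt0 : 0 < K ;
  mp_open : open A ;
  mp_v : C1 A v ;
  mp_Z0 : C1 A Zx ;
  mp_Z1 : C1 A Zy ;
  mp_div : forall x, A x -> px Zx x + py Zy x = 0 ;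
  mp_D : forall x, A x ->
    px v x ^+ 2 + py v x ^+ 2 <= K * edens v Zx Zy x }.

Lemma mpair_opp A v Zx Zy K : mpair A v Zx Zy K ->
  mpair A (fun x => - v x) (fun x => - Zx x) (fun x => - Zy x) K.
Proof.
case=> K0 oA cv c0 c1 hd hD; split; [by []|by []|exact: C1_opp|exact: C1_opp|exact: C1_opp|..].
- move=> x Ax; rewrite !pd_opp; [|exact: C1_diff c1 Ax|exact: C1_diff c0 Ax].
  by rewrite -opprD hd// oppr0.
- move=> x Ax; rewrite /edens !pd_opp; try exact: C1_diff cv Ax.
  by rewrite !mulrNN !sqrrN hD.
Qed.

Definition zbound (L : R) v Zx Zy x : Prop :=
  Zx x ^+ 2 + Zy x ^+ 2 <= L * edens v Zx Zy x.

(** The derivative in t = ln r of the integral of Z.Dv over the disc of radius r, whence the factor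
    e^(2t) and not e^t. *)
Definition energy v Zx Zy a t : R :=
  cint (fun s => expR t ^+ 2 * edens v Zx Zy (pol a t s)).

Lemma edens_ge0 A v Zx Zy K x : mpair A v Zx Zy K -> A x -> 0 <= edens v Zx Zy x.
Proof.
move=> h Ax; have := mp_D h Ax; have := mp_gt0 h.
have := sqr_ge0 (px v x); have := sqr_ge0 (py v x).
by move: (edens _ _ _ _) (_ ^+ 2) (_ ^+ 2) => e p q; nra.
Qed.

Lemma circle_cts A f a t : C1 A f -> (forall s, A (pol a t s)) ->
  continuous (fun s => f (pol a t s)).
Proof. by move=> cf hA s; apply: cts_pol_s; exact: C1_cts cf (hA s). Qed.

Lemma circle_pd A f a t b : C1 A f -> (forall s, A (pol a t s)) ->
  continuous (fun s => pd b f (pol a t s)).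
Proof. by move=> cf hA s; apply: cts_pol_s; exact: C1_pd b cf (hA s). Qed.

Lemma edens_cts A v Zx Zy K a t : mpair A v Zx Zy K ->
  (forall s, A (pol a t s)) -> continuous (fun s => edens v Zx Zy (pol a t s)).
Proof.
move=> h hA.
have c0 := circle_cts (mp_Z0 h) hA; have c1 := circle_cts (mp_Z1 h) hA.
have c2 := circle_pd (b := false) (mp_v h) hA.
have c3 := circle_pd (b := true) (mp_v h) hA.
by rewrite /edens => s; cts.
Qed.

Lemma energy_ge0 A v Zx Zy K a t : mpair A v Zx Zy K ->
  (forall s, A (pol a t s)) -> 0 <= energy v Zx Zy a t.
Proof.
move=> h hA; apply: cint_ge0 => s; rewrite mulr_ge0 ?sqr_ge0//.
exact: edens_ge0 h (hA s).
Qed.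

(** As Z is divergence-free, div(F(v) Z) = F'(v) Z.Dv. *)
Lemma der_flux_comp A v Zx Zy K a (F dF : R -> R) t d : mpair A v Zx Zy K ->
  (forall x : R, is_derive x 1 F (dF x)) -> continuous dF -> 0 < d ->
  (forall r s, `|r - t| <= d -> A (pol a r s)) ->
  is_derive t 1 (flux (fun x => F (v x) * Zx x) (fun x => F (v x) * Zy x) a)
    (cint (fun s => expR t ^+ 2 *
       (dF (v (pol a t s)) * edens v Zx Zy (pol a t s)))).
Proof.
move=> h dF' cF d0 hA; have oA := mp_open h.
have cFv : C1 A (fun x => F (v x)).
  by apply: (@C1_comp _ A F dF) => //; exact: mp_v h.
have D := @der_flux R _ _ A a t d oA (C1_mul oA cFv (mp_Z0 h))
  (C1_mul oA cFv (mp_Z1 h)) d0 hA.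
apply: (der_eq D); congr cint; apply/funext => s; congr (_ * _).
have Ap : A (pol a t s) by apply: hA; rewrite subrr normr0 ltW.
rewrite !pd_mul; [|exact: C1_diff cFv Ap|exact: C1_diff (mp_Z1 h) Ap
  |exact: C1_diff cFv Ap|exact: C1_diff (mp_Z0 h) Ap].
rewrite !(pd_comp _ (dF' _)); [|exact: C1_diff (mp_v h) Ap|exact: C1_diff (mp_v h) Ap].
have e := mp_div h Ap; rewrite /edens.
rewrite [LHS](_ : _ = dF (v (pol a t s)) * (Zx (pol a t s) * px v (pol a t s) +
  Zy (pol a t s) * py v (pol a t s)) + F (v (pol a t s)) *
  (px Zx (pol a t s) + py Zy (pol a t s))); first by rewrite e mulr0 addr0.
by ring.
Qed.

Lemma der_flux_id A v Zx Zy K a t d : mpair A v Zx Zy K -> 0 < d ->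
  (forall r s, `|r - t| <= d -> A (pol a r s)) ->
  is_derive t 1 (flux (fun x => v x * Zx x) (fun x => v x * Zy x) a)
    (energy v Zx Zy a t).
Proof.
move=> h d0 hA.
have := @der_flux_comp A v Zx Zy K a id (fun=> 1) t d h _ _ d0 hA.
move=> D; apply: (der_eq (D _ _)).
- by move=> x; exact: cts_cst.
- by congr cint; apply/funext => s; rewrite mul1r.
Qed.

(** Cauchy-Schwarz on the circle. With F the identity, |Z|^2 <= L Z.Dv bounds the square of the flux
    by a multiple of its own derivative: this is the source of the Riccati inequality. *)
Lemma flux_sqr A v Zx Zy K L a t (F : R -> R) B : mpair A v Zx Zy K ->
  (forall s, zbound L v Zx Zy (pol a t s)) ->
  (forall x : R, continuous_at x F) -> (forall s, A (pol a t s)) -> 0 <= B ->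
  (forall s, `|F (v (pol a t s))| <= B) ->
  flux (fun x => F (v x) * Zx x) (fun x => F (v x) * Zy x) a t ^+ 2 <=
    2 * pi * B ^+ 2 * L * energy v Zx Zy a t.
Proof.
move=> h hZ cF hA B0 hB.
have c0 := circle_cts (mp_Z0 h) hA; have c1 := circle_cts (mp_Z1 h) hA.
have cv := circle_cts (mp_v h) hA.
have ce := edens_cts h hA.
have cFv : continuous (fun s => F (v (pol a t s))).
  by move=> s; apply: (@cts_comp _ _ F) => //; exact: cv.
have cf : continuous (fun s => expR t * (F (v (pol a t s)) * Zx (pol a t s) * cos s +
    F (v (pol a t s)) * Zy (pol a t s) * sin s)).
  by move=> s; cts.
apply: (le_trans (cint_sqr cf)).
rewrite -!mulrA ler_pM2l// ler_pM2l ?pi_gt0//.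
rewrite /energy -cintZ; last by move=> s; cts.
rewrite -cintZ; last by move=> s; cts.
rewrite -cintZ; last by move=> s; cts.
apply: cint_le; [by move=> s; cts|by move=> s; cts|].
move=> s _; have := hZ s; rewrite /zbound.
have := hB s; rewrite ler_norml.
have := cos2Dsin2 s; have := sqr_ge0 (expR t).
have -> : (expR t * (F (v (pol a t s)) * Zx (pol a t s) * cos s +
    F (v (pol a t s)) * Zy (pol a t s) * sin s)) ^+ 2 =
  F (v (pol a t s)) ^+ 2 * (expR t ^+ 2 * (Zx (pol a t s) * cos s + Zy (pol a t s) * sin s) ^+ 2).
  by ring.
move: (F _) (Zx _) (Zy _) (expR t ^+ 2) (edens _ _ _ _) (cos s) (sin s).
move=> f p q e E c d e0 cd /andP[f1 f2] hE.
have hF : f ^+ 2 <= B ^+ 2.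
  have f1' : 0 <= B + f by lra.
  have f2' : 0 <= B - f by lra.
  by have := mulr_ge0 f1' f2'; lra.
have hZ2 : (p * c + q * d) ^+ 2 <= L * E.
  rewrite (le_trans _ hE)//.
  have -> : p ^+ 2 + q ^+ 2 = (p ^+ 2 + q ^+ 2) * (c ^+ 2 + d ^+ 2) by rewrite cd mulr1.
  rewrite -subr_ge0 (_ : _ - _ = (p * d - q * c) ^+ 2) ?sqr_ge0//.
  by ring.
have := ler_pM (sqr_ge0 f) (mulr_ge0 e0 (sqr_ge0 (p * c + q * d))) hF (ler_wpM2l e0 hZ2).
by rewrite [e * (L * E)]mulrCA [B ^+ 2]expr2 -!mulrA.
Qed.

Lemma circle_der A f a t s : C1 A f -> (forall s, A (pol a t s)) ->
  is_derive s 1 (fun s => f (pol a t s))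
   (expR t * (- sin s * px f (pol a t s) + cos s * py f (pol a t s))).
Proof. by move=> cf hA; apply: der_pol_s; exact: C1_diff cf (hA s). Qed.

Lemma circle_osc A v Zx Zy K a t (s1 s2 : R) : mpair A v Zx Zy K ->
  (forall s, A (pol a t s)) -> 0 <= s1 <= 2 * pi -> 0 <= s2 <= 2 * pi ->
  (v (pol a t s2) - v (pol a t s1)) ^+ 2 <= 2 * pi * K * energy v Zx Zy a t.
Proof.
move=> h hA hs1 hs2.
have c2 := circle_pd (b := false) (mp_v h) hA.
have c3 := circle_pd (b := true) (mp_v h) hA.
have ce := edens_cts h hA.
pose df s := expR t * (- sin s * px v (pol a t s) + cos s * py v (pol a t s)).
have cdf : continuous df by move=> s; rewrite /df; cts.
apply: (le_trans (@osc_sqr R (fun s => v (pol a t s)) df s1 s2 cdf _ hs1 hs2)).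
  by move=> s; exact: circle_der (mp_v h) hA.
rewrite -!mulrA ler_pM2l// ler_pM2l ?pi_gt0// /energy -cintZ; last by move=> s; cts.
apply: cint_le; [by move=> s; cts|by move=> s; cts|].
move=> s _; have hE := mp_D h (hA s).
rewrite /df exprMn [leRHS]mulrCA; apply: ler_wpM2l; first exact: sqr_ge0.
apply: le_trans hE.
have cd := cos2Dsin2 s.
move: (px _ _) (py _ _) (cos s) (sin s) cd => p q c d cd.
have -> : p ^+ 2 + q ^+ 2 = (p ^+ 2 + q ^+ 2) * (c ^+ 2 + d ^+ 2) by rewrite cd mulr1.
by rewrite -subr_ge0 (_ : _ - _ = (p * c + q * d) ^+ 2) ?sqr_ge0//; ring.
Qed.

(** As Z has zero flux, v may be replaced by v - m with the m of [wirtinger]; then 2|pq| <= p^2 +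
    q^2 with p = v - m and q the radial part of Z, the integral of p^2 being bounded through the
    tangential derivative of v. In the conformal case Z = Dv one may take e = 1. *)
Lemma flux_wirtinger A v Zx Zy K a t e : mpair A v Zx Zy K ->
  (forall s, A (pol a t s)) -> flux Zx Zy a t = 0 ->
  (forall s, (- sin s * px v (pol a t s) + cos s * py v (pol a t s)) ^+ 2 +
     (Zx (pol a t s) * cos s + Zy (pol a t s) * sin s) ^+ 2 <=
     e * edens v Zx Zy (pol a t s)) ->
  `|flux (fun x => v x * Zx x) (fun x => v x * Zy x) a t| <=
    2^-1 * e * energy v Zx Zy a t.
Proof.
move=> h hA f0 he.
have c0 := circle_cts (mp_Z0 h) hA; have c1 := circle_cts (mp_Z1 h) hA.
have cv := circle_cts (mp_v h) hA.
have c2 := circle_pd (b := false) (mp_v h) hA.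
have c3 := circle_pd (b := true) (mp_v h) hA.
have ce := edens_cts h hA.
pose df s := expR t * (- sin s * px v (pol a t s) + cos s * py v (pol a t s)).
have cdf : continuous df by move=> s; rewrite /df; cts.
have dfper s : df (s + 2 * pi) = df s by rewrite /df cosD2 sinD2 pol_per.
have [m hm] := @wirtinger R (fun s => v (pol a t s)) df
  (fun s => circle_der s (mp_v h) hA) cdf
  (fun s => congr1 v (pol_per a t s)) dfper.
rewrite {1}(_ : flux _ _ a t = cint (fun s => (v (pol a t s) - m) *
   (expR t * (Zx (pol a t s) * cos s + Zy (pol a t s) * sin s)))); last first.
  have cz : continuous (fun s => expR t * (Zx (pol a t s) * cos s + Zy (pol a t s) * sin s)).
    by move=> s; cts.
  rewrite -[LHS]subr0 -[X in _ - X](mulr0 m) -f0 /flux -cintZ// -cintB.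
  - by congr cint; apply/funext => s; ring.
  - by move=> s; cts.
  - by move=> s; cts.
pose zr s := expR t * (Zx (pol a t s) * cos s + Zy (pol a t s) * sin s).
have czr : continuous zr by move=> s; rewrite /zr; cts.
have main : cint (fun s => (v (pol a t s) - m) ^+ 2) + cint (fun s => zr s ^+ 2) <=
    e * energy v Zx Zy a t.
  apply: (le_trans (lerD hm (lexx _))); rewrite -cintD; [|by move=> s; cts|by move=> s; cts].
  rewrite /energy -cintZ; last by move=> s; cts.
  apply: cint_le; [by move=> s; cts|by move=> s; cts|].
  move=> s _; rewrite /df /zr !exprMn -mulrDr mulrCA ler_wpM2l ?sqr_ge0//.
rewrite -mulrA; apply: le_trans (ler_wpM2l _ main); last by rewrite invr_ge0.
rewrite -cintD; [|by move=> s; cts|by move=> s; cts].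
rewrite -cintZ; last by move=> s; cts.
rewrite ler_norml -cintN; last by move=> s; cts.
apply/andP; split; apply: cint_le; try (by move=> s; cts).
- move=> s _; rewrite -/(zr s); move: (v _ - m) (zr s) => p q.
  rewrite -subr_ge0 (_ : _ - _ = 2^-1 * (p + q) ^+ 2); last by field.
  by rewrite mulr_ge0 ?sqr_ge0 ?invr_ge0.
- move=> s _; rewrite -/(zr s); move: (v _ - m) (zr s) => p q.
  rewrite -subr_ge0 (_ : _ - _ = 2^-1 * (p - q) ^+ 2); last by field.
  by rewrite mulr_ge0 ?sqr_ge0 ?invr_ge0.
Qed.

Definition ramp M (x : R) : R := sstep (x - M).
Definition dramp M (x : R) : R := dsstep (x - M).

Lemma der_ramp M (x : R) : is_derive x 1 (ramp M) (dramp M x).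
Proof.
have d1 : is_derive (x - M) 1 (@sstep R) (dsstep (x - M)) by exact: der_sstep.
have d2 : is_derive x 1 (fun x : R => x - M) (1 + 0) by der.
rewrite /ramp /dramp.
have := @der_comp R (fun x : R => x - M) (@sstep R) x _ _ d1 d2.
by move/der_eq; apply; rewrite addr0 mulr1.
Qed.

Lemma cts_ramp M (x : R) : continuous_at x (ramp M).
Proof. exact: is_derive1_continuous (der_ramp M x). Qed.

Lemma cts_dramp M (x : R) : continuous_at x (dramp M).
Proof.
apply: (@cts_comp _ _ (@dsstep R) (fun x : R => x - M)); last exact: cts_dsstep.
by cts.
Qed.

Lemma ramp_le0 M (x : R) : x <= M -> ramp M x = 0.
Proof. by move=> xM; rewrite /ramp sstep_le0// subr_le0. Qed.

Lemma dramp_le0 M (x : R) : x <= M -> dramp M x = 0.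
Proof. by move=> xM; rewrite /dramp dsstep_le0// subr_le0. Qed.

Lemma ramp_eq0 M (x : R) : ramp M x = 0 -> x <= M.
Proof. by move/sstep_eq0; rewrite subr_le0. Qed.

Lemma ramp_itv M (x : R) : 0 <= ramp M x <= 1.
Proof. exact: sstep_itv. Qed.

Lemma dramp_itv M (x : R) : 0 <= dramp M x <= 2.
Proof. exact: dsstep_itv. Qed.

Definition tflux v Zx Zy M a t : R :=
  flux (fun x => ramp M (v x) * Zx x) (fun x => ramp M (v x) * Zy x) a t.

Definition tenergy v Zx Zy M a t : R :=
  cint (fun s => expR t ^+ 2 *
    (dramp M (v (pol a t s)) * edens v Zx Zy (pol a t s))).

Lemma der_tflux A v Zx Zy K M a t d : mpair A v Zx Zy K -> 0 < d ->
  (forall r s, `|r - t| <= d -> A (pol a r s)) ->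
  is_derive t 1 (tflux v Zx Zy M a) (tenergy v Zx Zy M a t).
Proof.
by move=> h; exact: (der_flux_comp h (der_ramp M) (@cts_dramp M)).
Qed.

Lemma tenergy_ge0 A v Zx Zy K M a t : mpair A v Zx Zy K ->
  (forall s, A (pol a t s)) -> 0 <= tenergy v Zx Zy M a t.
Proof.
move=> h hA; apply: cint_ge0 => s; apply: mulr_ge0; first exact: sqr_ge0.
apply: mulr_ge0; last exact: edens_ge0 h (hA s).
by have /andP[] := dramp_itv M (v (pol a t s)).
Qed.

Lemma tenergy_eq0 A v Zx Zy K M a t s : mpair A v Zx Zy K ->
  (forall s, A (pol a t s)) -> tenergy v Zx Zy M a t = 0 -> 0 <= s <= 2 * pi ->
  dramp M (v (pol a t s)) = 0 \/
  px v (pol a t s) = 0 /\ py v (pol a t s) = 0.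
Proof.
move=> h At t0 hs.
have ce := edens_cts h At.
have cv := circle_cts (mp_v h) At.
have cdT : continuous (fun s => dramp M (v (pol a t s))).
  by move=> r; apply: (@cts_comp _ _ (dramp M)); [exact: cv|exact: cts_dramp].
have f0 r : 0 <= expR t ^+ 2 * (dramp M (v (pol a t r)) * edens v Zx Zy (pol a t r)).
  apply: mulr_ge0; first exact: sqr_ge0.
  apply: mulr_ge0; last exact: edens_ge0 h (At r).
  by have /andP[] := dramp_itv M (v (pol a t r)).
have cf : continuous (fun s => expR t ^+ 2 *
    (dramp M (v (pol a t s)) * edens v Zx Zy (pol a t s))) by move=> r; cts.
have := cint_eq0 cf f0 t0 hs => /eqP.
rewrite mulf_eq0 expf_eq0/= gt_eqF ?expR_gt0//= mulf_eq0.
case/orP => /eqP e0; [by left|right].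
have := mp_D h (At s); rewrite e0 mulr0 => hD; split.
  by apply/eqP; rewrite -sqrf_eq0 eq_le sqr_ge0 andbT (le_trans _ hD)// lerDl sqr_ge0.
by apply/eqP; rewrite -sqrf_eq0 eq_le sqr_ge0 andbT (le_trans _ hD)// lerDr sqr_ge0.
Qed.

Lemma tflux_le0 v Zx Zy M a t : (forall s, v (pol a t s) <= M) ->
  tflux v Zx Zy M a t = 0.
Proof.
move=> hM; rewrite /tflux /flux (_ : (fun s => _) = fun=> 0) ?cint_cst ?mul0r//.
by apply/funext => s; rewrite ramp_le0//; ring.
Qed.

Lemma tflux_small A v Zx Zy K L M a t d : mpair A v Zx Zy K -> 0 < L ->
  (forall s, zbound L v Zx Zy (pol a t s)) ->
  (forall s, A (pol a t s)) -> energy v Zx Zy a t <= d / (2 * pi * L) ->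
  tflux v Zx Zy M a t ^+ 2 <= d.
Proof.
move=> h L0 hL At e; have p0 := pi_gt0 R.
have hT s : `|ramp M (v (pol a t s))| <= 1.
  by have /andP[T0 T1] := ramp_itv M (v (pol a t s)); rewrite ger0_norm.
have := flux_sqr h hL (@cts_ramp M) At ler01 hT.
rewrite expr1n mulr1 -/(tflux _ _ _ _ _ _) => hf; apply: (le_trans hf).
by rewrite mulrC -ler_pdivlMr// !mulr_gt0.
Qed.

Lemma rigid_derive (phi dphi : R -> R) (t1 t2 : R) :
  (forall t, t1 <= t <= t2 -> is_derive t 1 phi (dphi t)) ->
  (forall t, t1 <= t <= t2 -> 0 <= dphi t) -> phi t1 = phi t2 ->
  forall t, t1 < t < t2 -> dphi t = 0.
Proof.
move=> D D0 e t /andP[t1t tt2].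
have mono : forall x y : R, t1 <= x -> y <= t2 -> x <= y -> phi x <= phi y.
  move=> x y hx hy xy; apply: (@derive_ge0_le _ phi dphi x y xy) => z /andP[xz zy].
    by apply: D; rewrite (le_trans hx xz) (le_trans zy hy).
  by apply: D0; rewrite (le_trans hx xz) (le_trans zy hy).
have phic r : t1 <= r -> r <= t2 -> phi r = phi t1.
  move=> p q; apply: le_anti; apply/andP; split.
    by rewrite e; apply: mono.
  by apply: mono.
have Dt : is_derive t 1 phi (dphi t) by apply: D; rewrite !ltW.
have Dc : is_derive t 1 phi 0.
  apply: (near_eq_is_derive _ (der_cst (phi t1) t)).
  near=> r; rewrite phic//; apply/ltW; near: r.
    exact: lt_nbhsr.
  exact: lt_nbhsl.
by have := @derive_val _ _ _ _ _ _ _ Dt; rewrite (@derive_val _ _ _ _ _ _ _ Dc).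
Unshelve. all: by end_near. Qed.

(* If [phi] is nondecreasing and comes close to [0] arbitrarily far to the right
   (left) of [t], its vanishing at [t1] forces it to vanish at [t]. *)
Lemma squeeze_right (I : set R) (phi : R -> R) (t1 t : R) : phi t1 = 0 -> I t1 -> I t ->
  (forall x y : R, I x -> I y -> x <= y -> phi x <= phi y) -> t1 <= t ->
  (forall d, 0 < d -> exists r, [/\ I r, t <= r & phi r ^+ 2 <= d]) -> phi t = 0.
Proof.
move=> p1 I1 It mono t1t lim.
have p0 : 0 <= phi t by rewrite -p1; exact: mono.
apply/eqP; rewrite -sqrf_eq0 eq_le sqr_ge0 andbT.
apply/ler_addgt0Pl => d d0; rewrite addr0.
have [r [Ir tr er]] := lim d d0; apply: le_trans er.
have pr := mono _ _ It Ir tr.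
by rewrite lerXn2r// nnegrE// (le_trans p0).
Qed.

Lemma squeeze_left (I : set R) (phi : R -> R) (t1 t : R) : phi t1 = 0 -> I t1 -> I t ->
  (forall x y : R, I x -> I y -> x <= y -> phi x <= phi y) -> t <= t1 ->
  (forall d, 0 < d -> exists r, [/\ I r, r <= t & phi r ^+ 2 <= d]) -> phi t = 0.
Proof.
move=> p1 I1 It mono t1t lim.
have p0 : phi t <= 0 by rewrite -p1; exact: mono.
apply/eqP; rewrite -sqrf_eq0 eq_le sqr_ge0 andbT.
apply/ler_addgt0Pl => d d0; rewrite addr0.
have [r [Ir tr er]] := lim d d0; apply: le_trans er.
have pr := mono _ _ Ir It tr.
rewrite -[leLHS]sqrrN -[leRHS]sqrrN lerXn2r// ?nnegrE ?oppr_ge0//.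
  exact: le_trans pr p0.
by rewrite lerN2.
Qed.

(** * Maximum principles from the rigidity of the truncated flux *)

Section Rigidity.
Variables (A : set 'rV[R]_2) (v Zx Zy : 'rV[R]_2 -> R) (K L M : R) (a : 'rV[R]_2).
Hypothesis h : mpair A v Zx Zy K.
Hypothesis L0 : 0 < L.

Variable I : set R.
Hypothesis Iconv : forall t1 t2 t, I t1 -> I t2 -> t1 <= t <= t2 -> I t.
Hypothesis Iopen : forall t, I t -> exists2 d : R, 0 < d & forall r, `|r - t| <= d -> I r.
Hypothesis hA : forall t s, I t -> A (pol a t s).

Lemma tflux_derive t : I t -> is_derive t 1 (tflux v Zx Zy M a) (tenergy v Zx Zy M a t).
Proof.
move=> /Iopen[d d0 hd]; apply: (der_tflux M h d0) => r s /hd.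
exact: hA.
Qed.

Lemma tflux_mono (t1 t2 : R) : I t1 -> I t2 -> t1 <= t2 ->
  tflux v Zx Zy M a t1 <= tflux v Zx Zy M a t2.
Proof.
move=> h1 h2 h12.
apply: (@derive_ge0_le _ (tflux v Zx Zy M a) (tenergy v Zx Zy M a) t1 t2 h12) => t p.
  by apply: tflux_derive; exact: Iconv p.
by apply: (tenergy_ge0 M h) => s; apply: hA; exact: Iconv p.
Qed.

(** Equal fluxes through two circles force the truncated energy between them to vanish: at each
    point T'(v) = 0 or Dv = 0, so T(v) is constant on each radius. *)
Lemma tflux_rigid (t1 t2 : R) : I t1 -> I t2 -> t1 < t2 ->
  tflux v Zx Zy M a t1 = tflux v Zx Zy M a t2 ->
  forall s, 0 <= s <= 2 * pi -> ramp M (v (pol a t1 s)) = ramp M (v (pol a t2 s)).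
Proof.
move=> h1 h2 h12 e s hs.
have It t : t1 <= t <= t2 -> I t by exact: Iconv.
have dphi0 : forall t, t1 < t < t2 -> tenergy v Zx Zy M a t = 0.
  apply: (rigid_derive _ _ e) => t ht.
    exact: tflux_derive (It _ ht).
  by apply: (tenergy_ge0 M h) => r; exact: hA (It _ ht).
clear e.
pose g t := ramp M (v (pol a t s)).
pose dg t := dramp M (v (pol a t s)) * (expR t *
  (cos s * px v (pol a t s) + sin s * py v (pol a t s))).
have D t : t1 <= t <= t2 -> is_derive t 1 g (dg t).
  move=> ht; apply: der_comp; first exact: der_ramp.
  by apply: der_pol_t; apply: C1_diff (mp_v h) _; apply: hA; exact: It.
have [t pq E] := @MVT_closed R g dg t1 t2 h12 D.
have tt : t1 <= t <= t2 by case/andP: pq => p q; rewrite !ltW.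
have At r : A (pol a t r) by apply: hA; exact: It.
apply/esym/eqP; rewrite -subr_eq0; apply/eqP; rewrite -/(g t1) -/(g t2) E.
suff -> : dg t = 0 by rewrite mul0r.
have [e0|[e0 e1]] := tenergy_eq0 h At (dphi0 t pq) hs; rewrite /dg.
  by rewrite e0 mul0r.
by rewrite e0 e1 !mulr0 addr0 !mulr0.
Qed.

Lemma energy_to_tflux d (P : R -> Prop) : 0 < d ->
  (forall d, 0 < d -> exists r, [/\ I r, P r, forall s, zbound L v Zx Zy (pol a r s) &
     energy v Zx Zy a r <= d]) ->
  exists r, [/\ I r, P r & tflux v Zx Zy M a r ^+ 2 <= d].
Proof.
move=> d0 /(_ (d / (2 * pi * L)))[|r [Ir Pr Lr er]].
  by rewrite divr_gt0// !mulr_gt0 ?pi_gt0.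
exists r; split; [exact: Ir|exact: Pr|].
exact: (tflux_small M h L0 Lr (fun s => hA s Ir) er).
Qed.

(** The truncated flux is 0 on the first circle, nondecreasing outwards and arbitrarily small far
    out, hence 0; rigidity carries T(v) = 0 along the radii. *)
Lemma max_principle_out t1 : I t1 -> (forall s, v (pol a t1 s) <= M) ->
  (forall t d, I t -> 0 < d -> exists r, [/\ I r, t <= r,
    forall s, zbound L v Zx Zy (pol a r s) & energy v Zx Zy a r <= d]) ->
  forall t s, I t -> t1 <= t -> 0 <= s <= 2 * pi -> v (pol a t s) <= M.
Proof.
move=> h1 hM lim t s It; rewrite le_eqVlt => /predU1P[<- _|t1t hs]; first exact: hM.
have p1 : tflux v Zx Zy M a t1 = 0 by exact: tflux_le0.
have pt : tflux v Zx Zy M a t = 0.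
  apply: (squeeze_right p1 h1 It tflux_mono (ltW t1t)) => d d0.
  by apply: energy_to_tflux => // e e0; exact: lim.
have := tflux_rigid h1 It t1t (etrans p1 (esym pt)) hs.
by rewrite (ramp_le0 (hM s)) => /esym; exact: ramp_eq0.
Qed.

(** Stated with small fluxes rather than small energies, because in a full disc they come from the
    boundedness of Z near the centre. *)
Lemma tflux_max_in t1 : I t1 -> (forall s, v (pol a t1 s) <= M) ->
  (forall t d, I t -> 0 < d -> exists r, [/\ I r, r <= t & tflux v Zx Zy M a r ^+ 2 <= d]) ->
  forall t s, I t -> t <= t1 -> 0 <= s <= 2 * pi -> v (pol a t s) <= M.
Proof.
move=> h1 hM lim t s It; rewrite le_eqVlt => /predU1P[-> _|t1t hs]; first exact: hM.
have p1 : tflux v Zx Zy M a t1 = 0 by exact: tflux_le0.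
have pt : tflux v Zx Zy M a t = 0.
  by apply: (squeeze_left p1 h1 It tflux_mono (ltW t1t)) => d d0; exact: lim.
have := tflux_rigid It h1 t1t (etrans pt (esym p1)) hs.
by rewrite (ramp_le0 (hM s)); exact: ramp_eq0.
Qed.

Lemma max_principle_in t1 : I t1 -> (forall s, v (pol a t1 s) <= M) ->
  (forall t d, I t -> 0 < d -> exists r, [/\ I r, r <= t,
    forall s, zbound L v Zx Zy (pol a r s) & energy v Zx Zy a r <= d]) ->
  forall t s, I t -> t <= t1 -> 0 <= s <= 2 * pi -> v (pol a t s) <= M.
Proof.
move=> h1 hM lim; apply: tflux_max_in => // t d It d0.
by apply: (@energy_to_tflux d (fun r => r <= t)) => // e e0; exact: lim.
Qed.

End Rigidity.

End MonotonePairs.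

(** * Euclidean norm and polar coordinates *)

Section Euclid.
Variable R : realType.
Implicit Types (x y v w a : 'rV[R]_2) (r t s : R).

Lemma dotE v w : dot v w = v 0 0 * w 0 0 + v 0 1 * w 0 1.
Proof. by rewrite /dot big_ord_recr big_ord1/=; congr (v 0 _ * w 0 _ + v 0 _ * w 0 _); exact: val_inj. Qed.

Lemma dot_ge0 v : 0 <= dot v v.
Proof. by rewrite dotE -!expr2 addr_ge0 ?sqr_ge0. Qed.

Lemma enorm_ge0 v : 0 <= enorm v.
Proof. exact: sqrtr_ge0. Qed.

Lemma enorm_sqr v : enorm v ^+ 2 = v 0 0 ^+ 2 + v 0 1 ^+ 2.
Proof. by rewrite sqr_sqrtr ?dot_ge0// dotE !expr2. Qed.

Lemma enorm_le v (r : R) : 0 <= r -> (enorm v <= r) = (v 0 0 ^+ 2 + v 0 1 ^+ 2 <= r ^+ 2).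
Proof. by move=> r0; rewrite -enorm_sqr ler_sqr ?nnegrE// enorm_ge0. Qed.

Lemma enorm_eq0 v : (enorm v == 0) = (v == 0).
Proof.
apply/idP/idP => [/eqP e|/eqP ->]; last by rewrite /enorm dotE !mxE mulr0 addr0 sqrtr0.
have := enorm_sqr v; rewrite e expr0n/= => /esym/eqP.
rewrite paddr_eq0 ?sqr_ge0// !sqrf_eq0 => /andP[/eqP v0 /eqP v1].
by apply/eqP; apply: rV2P; rewrite ?v0 ?v1 mxE.
Qed.

Lemma enorm0 : enorm (0 : 'rV[R]_2) = 0.
Proof. by apply/eqP; rewrite enorm_eq0. Qed.

Lemma enorm_gt0 v : (0 < enorm v) = (v != 0).
Proof. by rewrite lt_neqAle enorm_ge0 andbT eq_sym enorm_eq0. Qed.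

Lemma dot_le v w : dot v w <= enorm v * enorm w.
Proof.
have h : dot v w ^+ 2 <= (enorm v * enorm w) ^+ 2.
  rewrite exprMn !enorm_sqr dotE -subr_ge0.
  rewrite (_ : _ - _ = (v 0 0 * w 0 1 - v 0 1 * w 0 0) ^+ 2) ?sqr_ge0//.
  by ring.
have n0 : 0 <= enorm v * enorm w by rewrite mulr_ge0 ?enorm_ge0.
have [d0|/ltW d0] := leP (dot v w) 0; first exact: le_trans d0 n0.
by rewrite -ler_sqr ?nnegrE.
Qed.

Lemma enormD v w : enorm (v + w) <= enorm v + enorm w.
Proof.
rewrite enorm_le ?addr_ge0 ?enorm_ge0// !mxE [leRHS]sqrrD !enorm_sqr.
by have := dot_le v w; rewrite dotE; lra.
Qed.

Lemma enormN v : enorm (- v) = enorm v.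
Proof. by rewrite /enorm !dotE !mxE !mulrNN. Qed.

Lemma enormZ (k : R) v : enorm (k *: v) = `|k| * enorm v.
Proof.
apply/eqP; rewrite -(@eqrXn2 _ 2) ?mulr_ge0 ?enorm_ge0// exprMn !enorm_sqr !mxE real_normK ?num_real//.
by apply/eqP; ring.
Qed.

Lemma enorm_dist v w : enorm (v - w) = enorm (w - v).
Proof. by rewrite -enormN opprB. Qed.

Lemma enorm_sub v w y : enorm (v - y) <= enorm (v - w) + enorm (w - y).
Proof. by apply: le_trans (enormD _ _); rewrite subrKA. Qed.

Lemma coord_le_norm v (j : 'I_2) : `|v 0 j| <= `|v|.
Proof.
have -> : `|v| = mx_norm v by [].
rewrite mx_normrE; apply: (@le_bigmax _ _ _ 0 (fun i : 'I_1 * 'I_2 => `|v i.1 i.2|) (0, j)).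
Qed.

Lemma norm_le_enorm v : `|v| <= enorm v.
Proof.
have -> : `|v| = mx_norm v by [].
rewrite mx_normrE; apply: bigmax_le; first exact: enorm_ge0.
move=> [i j] _ /=; rewrite ord1 -ler_sqr ?nnegrE ?enorm_ge0// real_normK ?num_real//.
have h0 := sqr_ge0 (v 0 0); have h1 := sqr_ge0 (v 0 1).
rewrite enorm_sqr; case: j => -[|[|//]] hj.
  by rewrite (_ : Ordinal hj = 0) ?lerDl//; exact: val_inj.
by rewrite (_ : Ordinal hj = 1) ?lerDr//; exact: val_inj.
Qed.

Lemma enorm_le_norm v : enorm v <= 2 * `|v|.
Proof.
rewrite enorm_le ?mulr_ge0//.
have := coord_le_norm v 0; have := coord_le_norm v 1.
move: (v 0 0) (v 0 1) `|v| => p q n; rewrite !ler_norml => /andP[a1 a2] /andP[b1 b2].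
by nra.
Qed.

Lemma enorm_mk (p q : R) : enorm (mk p q) ^+ 2 = p ^+ 2 + q ^+ 2.
Proof. by rewrite enorm_sqr mk0 mk1. Qed.

Lemma polE0 a t s : pol a t s 0 0 = a 0 0 + expR t * cos s.
Proof. by rewrite /pol mk0. Qed.

Lemma polE1 a t s : pol a t s 0 1 = a 0 1 + expR t * sin s.
Proof. by rewrite /pol mk1. Qed.

Lemma enorm_pol a t s : enorm (pol a t s - a) = expR t.
Proof.
apply/eqP; rewrite -(@eqrXn2 _ 2) ?enorm_ge0 ?expR_ge0// enorm_sqr.
rewrite [(_ - a) 0 0]mxE [(_ - a) 0 1]mxE [(- a) 0 0]mxE [(- a) 0 1]mxE polE0 polE1.
have := cos2Dsin2 s; move: (cos s) (sin s) => c d cd.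
by apply/eqP; transitivity (expR t ^+ 2 * (c ^+ 2 + d ^+ 2)); [ring|rewrite cd mulr1].
Qed.

Lemma angle (c d : R) : c ^+ 2 + d ^+ 2 = 1 ->
  exists2 s, 0 <= s <= 2 * pi & cos s = c /\ sin s = d.
Proof.
move=> cd; have c1 : -1 <= c <= 1.
  by have := sqr_ge0 d; move: cd => + +; clear; nra.
have a0 := acos_ge0 c1; have ap := acos_lepi c1.
have cK : cos (acos c) = c by apply: acosK; rewrite in_itv.
have sK : sin (acos c) = `|d|.
  by rewrite sin_acos// -sqrtr_sqr; congr Num.sqrt; rewrite -cd; ring.
have [d0|d0] := leP 0 d.
  exists (acos c); first by rewrite a0 (le_trans ap)// mulr_natl mulr2n lerDl pi_ge0.
  by rewrite cK sK ger0_norm.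
exists (2 * pi - acos c).
  by rewrite gerBl a0 andbT subr_ge0 (le_trans ap)// mulr_natl mulr2n lerDl pi_ge0.
have e1 : cos (2 * pi - acos c) = cos (- acos c) by rewrite -(cosD2 (- acos c)) addrC.
have e2 : sin (2 * pi - acos c) = sin (- acos c) by rewrite -(sinD2 (- acos c)) addrC.
by rewrite e1 e2 cosN sinN cK sK ltr0_norm// opprK.
Qed.

Lemma polP a x : x != a -> exists2 s, 0 <= s <= 2 * pi & x = pol a (ln (enorm (x - a))) s.
Proof.
move=> xa; have n0 : 0 < enorm (x - a) by rewrite enorm_gt0 subr_eq0.
have n1 := enorm_sqr (x - a); rewrite !mxE in n1.
have [|s hs [c d]] := @angle ((x 0 0 - a 0 0) / enorm (x - a)) ((x 0 1 - a 0 1) / enorm (x - a)).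
  by rewrite !expr_div_n -mulrDl -n1 divff// expf_eq0/= gt_eqF.
exists s => //; apply: rV2P; rewrite ?polE0 ?polE1 lnK ?posrE// ?c ?d.
  by rewrite [enorm _ * _]mulrC divfK ?gt_eqF// addrC subrK.
by rewrite [enorm _ * _]mulrC divfK ?gt_eqF// addrC subrK.
Qed.

End Euclid.

(** * Symmetry of second derivatives *)

Section Schwarz.
Variable R : realType.
Local Notation px := (@pd R false).
Local Notation py := (@pd R true).
Implicit Types (f : 'rV[R]_2 -> R) (x v a : 'rV[R]_2) (A : set 'rV[R]_2) (t s h : R).

Lemma der_line f x v t : differentiable f (x + t *: v) ->
  is_derive t 1 (fun t => f (x + t *: v))
    (v 0 0 * px f (x + t *: v) + v 0 1 * py f (x + t *: v)).
Proof.
have E (r : R) : x + r *: v = mk (x 0 0 + r * v 0 0) (x 0 1 + r * v 0 1).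
  by apply: rV2P; rewrite ?mk0 ?mk1 !mxE.
rewrite (_ : (fun t => _) = fun t => f (mk (x 0 0 + t * v 0 0) (x 0 1 + t * v 0 1))); last first.
  by apply/funext => r; rewrite E.
rewrite E => df; apply: der_chain => //.
  by der_by; ring.
by der_by; ring.
Qed.

Definition dir (b : bool) : 'rV[R]_2 := mk (~~ b)%:R b%:R.

Lemma der_dir f x b t : differentiable f (x + t *: dir b) ->
  is_derive t 1 (fun t => f (x + t *: dir b)) (pd b f (x + t *: dir b)).
Proof.
move=> df; apply: (der_eq (der_line df)); rewrite /dir mk0 mk1.
by case: b {df} => /=; ring.
Qed.

(** The second difference over a square is symmetric in the two directions, and two uses of the mean
    value theorem turn it into a mixed derivative in either order. *)
Lemma square_mvt A f x b h : C1 A f -> C1 A (pd b f) -> 0 < h ->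
  (forall s t, 0 <= s <= h -> 0 <= t <= h -> A (x + s *: dir b + t *: dir (~~ b))) ->
  exists s t, [/\ 0 <= s <= h, 0 <= t <= h &
    f (x + h *: dir b + h *: dir (~~ b)) - f (x + h *: dir b)
    - (f (x + h *: dir (~~ b)) - f x) =
    h * h * pd (~~ b) (pd b f) (x + s *: dir b + t *: dir (~~ b))].
Proof.
move=> cf cg h0 hA.
have h00 : 0 <= (0 : R) <= h by rewrite lexx ltW.
have hhh : 0 <= h <= h by rewrite lexx ltW.
pose g s := f (x + h *: dir (~~ b) + s *: dir b) - f (x + s *: dir b).
pose dg s := pd b f (x + h *: dir (~~ b) + s *: dir b) - pd b f (x + s *: dir b).
have Dg s : 0 <= s <= h -> is_derive s 1 g (dg s).
  move=> hs; rewrite /g /dg.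
  have D1 : is_derive s 1 (fun s => f (x + h *: dir (~~ b) + s *: dir b))
      (pd b f (x + h *: dir (~~ b) + s *: dir b)).
    by apply: der_dir; apply: C1_diff cf _; rewrite addrAC; exact: hA.
  have D2 : is_derive s 1 (fun s => f (x + s *: dir b)) (pd b f (x + s *: dir b)).
    by apply: der_dir; apply: C1_diff cf _; have := hA s 0 hs h00; rewrite scale0r addr0.
  exact: der_add D1 (der_opp D2).
have [s /andP[s0 sh] es] := MVT_closed h0 Dg.
have hs : 0 <= s <= h by rewrite !ltW.
pose k t := pd b f (x + s *: dir b + t *: dir (~~ b)).
pose dk t := pd (~~ b) (pd b f) (x + s *: dir b + t *: dir (~~ b)).
have Dk t : 0 <= t <= h -> is_derive t 1 k (dk t).
  by move=> ht; apply: der_dir; apply: C1_diff cg _; exact: hA.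
have [t /andP[t0 th] et] := MVT_closed h0 Dk.
exists s, t; split=> //; first by rewrite !ltW.
move: es et; rewrite /g /dg /k /dk !scale0r !addr0 !subr0 => es et.
rewrite [x + h *: dir (~~ b) + s *: dir b]addrAC et in es.
rewrite [x + h *: dir b + h *: dir (~~ b)]addrAC es.
by ring.
Qed.

Lemma schwarz A f x : open A -> C1 A f -> (forall b, C1 A (pd b f)) -> A x ->
  py (px f) x = px (py f) x.
Proof.
move=> oA cf cg Ax.
have c1 := C1_pd (b := true) (cg false) Ax; have c2 := C1_pd (b := false) (cg true) Ax.
apply/eqP; rewrite -subr_eq0 -normr_le0; apply/ler_addgt0Pl => e e0; rewrite addr0.
have e20 : 0 < e / 2 by rewrite divr_gt0.
have : \forall y \near x, [/\ A y, `|py (px f) x - py (px f) y| <= e / 2 &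
    `|px (py f) x - px (py f) y| <= e / 2].
  near=> y; split; near: y.
  - exact: open_nbhs_nbhs.
  - by move/cvgrPdist_le: c1; apply.
  - by move/cvgrPdist_le: c2; apply.
move=> /nbhs_ballP[d /= d0 hd].
pose N : R := `|dir false| + `|dir true| + 1.
have N0 : 0 < N by rewrite ltr_wpDl// addr_ge0.
pose h := d / (2 * N); have h0 : 0 < h by rewrite divr_gt0// mulr_gt0.
have hb b s t : 0 <= s <= h -> 0 <= t <= h -> ball x d (x + s *: dir b + t *: dir (~~ b)).
  move=> /andP[s0 sh] /andP[t0 th]; rewrite -ball_normE /ball_ /= -addrA opprD addrA subrr add0r normrN.
  apply: (le_lt_trans (ler_normD _ _)); rewrite !normrZ !ger0_norm//.
  have e1 : h * N = d / 2 by rewrite /h; field; rewrite gt_eqF.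
  have e2 : `|dir b| + `|dir (~~ b)| <= N by rewrite /N; case: b => /=; lra.
  apply: (@le_lt_trans _ _ (h * N)); last by rewrite e1; lra.
  apply: (@le_trans _ _ (h * (`|dir b| + `|dir (~~ b)|))); last by rewrite ler_wpM2l// ltW.
  by rewrite mulrDr lerD// ler_wpM2r.
have hA b s t : 0 <= s <= h -> 0 <= t <= h -> A (x + s *: dir b + t *: dir (~~ b)).
  by move=> hs ht; have [] := hd _ (hb b s t hs ht).
have [s [t [hs ht e1]]] := square_mvt cf (cg false) h0 (hA false).
have [s' [t' [hs' ht' e2]]] := square_mvt cf (cg true) h0 (hA true).
have [_ h1 _] := hd _ (hb false s t hs ht).
have [_ _ h2] := hd _ (hb true s' t' hs' ht').
move: e1 e2 h1 h2 => /=; rewrite (addrAC x (h *: dir true)) => e1 e2.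
have : h * h * py (px f) (x + s *: dir false + t *: dir true) =
       h * h * px (py f) (x + s' *: dir true + t' *: dir false).
  by rewrite -e1 -e2; ring.
move/mulfI => -> //; last by rewrite mulf_neq0 ?gt_eqF.
move=> h1 h2; rewrite (splitr e).
apply: le_trans (ler_distD (px (py f) (x + s' *: dir true + t' *: dir false)) _ _) _.
by rewrite lerD// distrC.
Unshelve. all: by end_near. Qed.

End Schwarz.

(** * Maximal graphs *)

Section SmoothMaximal.
Variable R : realType.
Local Notation px := (@pd R false).
Local Notation py := (@pd R true).
Implicit Types (f u : 'rV[R]_2 -> R) (x v w a : 'rV[R]_2) (A : set 'rV[R]_2).

Lemma smooth_on_pd A f b : smooth_on A f -> smooth_on A (pd b f).
Proof.
move=> sf l x Ax.
have := sf (rcons l (delta_mx 0 (if b then 1 else 0))) x Ax.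
suff -> : iter_derive (rcons l (delta_mx 0 (if b then 1 else 0))) f =
  iter_derive l (pd b f) by [].
by rewrite pdE; elim: l => //= e l ->.
Qed.

Lemma smooth_on_C1 A f : smooth_on A f -> C1 A f.
Proof.
move=> sf x Ax; split; first exact: (sf [::] x Ax).
  by apply: differentiable_continuous; exact: (smooth_on_pd false sf [::] Ax).
by apply: differentiable_continuous; exact: (smooth_on_pd true sf [::] Ax).
Qed.

Lemma derive_row_mx (g : 'rV[R]_2 -> 'rV[R]_2) f x v : derivable g x v ->
  derivable f x v ->
  'D_v (fun y => row_mx (g y) (f y)%:M : 'rV[R]_3) x =
    row_mx ('D_v g x) ('D_v f x)%:M.
Proof.
move=> dg df.
have Ef (i : 'I_1) (j : 'I_2) : (fun y => (row_mx (g y) (f y)%:M : 'rV[R]_(2 + 1)) i (lshift 1 j)) =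
    (fun y => g y i j) by apply/funext => y; rewrite row_mxEl.
have Eg (i : 'I_1) (j : 'I_1) : (fun y => (row_mx (g y) (f y)%:M : 'rV[R]_(2 + 1)) i (rshift 2 j)) = f.
  by apply/funext => y; rewrite row_mxEr !ord1 mxE eqxx mulr1n.
have dd : derivable (fun y => row_mx (g y) (f y)%:M : 'rV[R]_(2 + 1)) x v.
  apply/derivable_mxP => i j; case: (split_ordP j) => k ->.
    by rewrite Ef; exact: (proj1 (derivable_mxP g x v) dg i k).
  by rewrite Eg.
apply/matrixP => i j; rewrite [LHS](_ : _ = ('D_v (fun y => row_mx (g y) (f y)%:M : 'rV[R]_(2 + 1)) x) i j)//.
rewrite derive_mx// mxE; case: (split_ordP (j : 'I_(2 + 1))) => k ->.
  by rewrite Ef; apply: etrans (esym (row_mxEl _ _ _ _)); rewrite derive_mx// mxE.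
by rewrite Eg; apply: etrans (esym (row_mxEr _ _ _ _)); rewrite !ord1 mxE eqxx mulr1n.
Qed.

Lemma derive_graph_map u x v : differentiable u x ->
  'D_v (graph_map u) x = row_mx v ('D_v u x)%:M.
Proof.
move=> du; rewrite /graph_map derive_row_mx ?derive_id//.
exact: diff_derivable.
Qed.

Lemma row3_0 (g : 'rV[R]_2) (c : R) : (row_mx g c%:M : 'rV[R]_3) 0 0 = g 0 0.
Proof.
have -> : (0 : 'I_3) = lshift 1 (0 : 'I_2) by exact: val_inj.
exact: row_mxEl.
Qed.

Lemma row3_1 (g : 'rV[R]_2) (c : R) : (row_mx g c%:M : 'rV[R]_3) 0 1 = g 0 1.
Proof.
have -> : (1 : 'I_3) = lshift 1 (1 : 'I_2) by exact: val_inj.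
exact: row_mxEl.
Qed.

Lemma row3_2 (g : 'rV[R]_2) (c : R) : (row_mx g c%:M : 'rV[R]_3) 0 2 = c.
Proof.
have -> : (2 : 'I_3) = rshift 2 (0 : 'I_1) by exact: val_inj.
by apply: etrans (row_mxEr _ _ _ _) _; rewrite mxE eqxx mulr1n.
Qed.

Lemma lorentz_row (g h : 'rV[R]_2) (c d : R) :
  lorentz (row_mx g c%:M : 'rV[R]_3) (row_mx h d%:M) =
  g 0 0 * h 0 0 + g 0 1 * h 0 1 - c * d.
Proof.
rewrite /lorentz; congr (_ * _ + _ * _ - _ * _);
  [exact: row3_0|exact: row3_0|exact: row3_1|exact: row3_1|exact: row3_2|exact: row3_2].
Qed.

Lemma scale_row3 (k c : R) (g : 'rV[R]_2) :
  k *: (row_mx g c%:M : 'rV[R]_3) = (row_mx (k *: g) (k * c)%:M : 'rV[R]_3).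
Proof. by rewrite -scale_scalar_mx; exact: (scale_row_mx k g c%:M). Qed.

Lemma first_formE u x v w : differentiable u x ->
  first_form u x v w = v 0 0 * w 0 0 + v 0 1 * w 0 1 - 'D_v u x * 'D_w u x.
Proof. by move=> du; rewrite /first_form !derive_graph_map// lorentz_row. Qed.

Definition slope2 u x : R := px u x ^+ 2 + py u x ^+ 2.

Lemma spacelike_slope u x : differentiable u x -> spacelike_at u x -> slope2 u x < 1.
Proof.
move=> du hs; have [p0|p0] := eqVneq (mk (px u x) (py u x)) 0.
  have := congr1 (fun m : 'rV[R]_2 => m 0 0) p0; have := congr1 (fun m : 'rV[R]_2 => m 0 1) p0.
  by rewrite /slope2 mk0 mk1 !mxE => -> ->; rewrite expr0n/= addr0 ltr01.
(* The direction Du is tested: its Lorentz square is |Du|^2 (1 - |Du|^2). *)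
have := hs _ p0; rewrite first_formE// derive_partial// mk0 mk1.
rewrite (_ : px u x * px u x + _ = slope2 u x); last by rewrite /slope2 !expr2.
have : 0 <= slope2 u x by rewrite addr_ge0 ?sqr_ge0.
by move: (slope2 u x) => z; nra.
Qed.

(** What the analysis uses of a maximal graph: C^3 regularity, slope below 1, and the maximal
    surface equation in non-divergence form. Third derivatives enter because the derivatives of
    [flow] must themselves form a C^1 field. *)
Record mgraph A u : Prop := MGraph {
  mg_open : open A ;
  mg_C1 : C1 A u ;
  mg_C2 : forall b, C1 A (pd b u) ;
  mg_C3 : forall b c, C1 A (pd b (pd c u)) ;
  mg_slope : forall x, A x -> slope2 u x < 1 ;
  mg_sym : forall x, A x -> py (px u) x = px (py u) x ;
  mg_eq : forall x, A x -> (1 - py u x ^+ 2) * px (px u) x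
    + 2 * (px u x * py u x) * px (py u) x + (1 - px u x ^+ 2) * py (py u) x = 0 }.

Lemma partial_partial_graph A u x (i j : 'I_2) : open A -> smooth_on A u -> A x ->
  partial i (partial j (graph_map u)) x = (row_mx (0 : 'rV[R]_2) (partial i (partial j u) x)%:M : 'rV[R]_3).
Proof.
move=> oA sA Ax; rewrite {1}/partial.
have -> : 'D_(delta_mx 0 i) (partial j (graph_map u)) x =
    'D_(delta_mx 0 i) (fun y => row_mx (delta_mx 0 j) (partial j u y)%:M : 'rV[R]_3) x.
  apply: near_eq_derive; near=> y; rewrite /partial derive_graph_map//.
  by apply: (sA [::]); near: y; exact: open_nbhs_nbhs.
rewrite derive_row_mx ?derive_cst//; apply: diff_derivable.
exact: (sA [:: delta_mx 0 j] x Ax).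
Unshelve. all: by end_near. Qed.

Lemma maximal_mgraph A u : open A -> maximal_on A u -> mgraph A u.
Proof.
move=> oA [sA hA]; have c1 := smooth_on_C1 sA.
have c2 b := smooth_on_C1 (smooth_on_pd b sA).
have c3 b c := smooth_on_C1 (smooth_on_pd b (smooth_on_pd c sA)).
have sl x : A x -> slope2 u x < 1.
  by move=> Ax; apply: spacelike_slope; [exact: C1_diff c1 Ax|exact: (hA x Ax).1].
have sy x : A x -> py (px u) x = px (py u) x by move=> Ax; exact: schwarz oA c1 c2 Ax.
split => // x Ax; have du := C1_diff c1 Ax.
have e0 : partial 0 u = px u by rewrite pdE.
have e1 : partial 1 u = py u by rewrite pdE.
have w0 : 0 < 1 - slope2 u x by rewrite subr_gt0 sl.
set k := (Num.sqrt (1 - px u x ^+ 2 - py u x ^+ 2))^-1.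
have k0 : k != 0.
  rewrite /k invr_eq0 gt_eqF// sqrtr_gt0.
  by move: w0; rewrite /slope2 opprD addrA.
have S2 i j : second_form u x i j = - (k * partial i (partial j u) x).
  rewrite /second_form (partial_partial_graph _ _ oA sA Ax) /unit_normal e0 e1 -/k.
  rewrite scale_row3 mulr1 lorentz_row.
  have z (l : 'I_2) : (0 : 'rV[R]_2) 0 l = 0 by rewrite mxE.
  by rewrite (z 0) (z 1) !mul0r add0r sub0r mulrC.
have := (hA x Ax).2; rewrite /mean_curvature !S2 !first_formE//.
have d0 : 'D_(delta_mx 0 0) u x = px u x by rewrite pdE.
have d1 : 'D_(delta_mx 0 1) u x = py u x by rewrite pdE.
have q0 : partial 0 (partial 0 u) x = px (px u) x by rewrite e0 pdE.
have q1 : partial 0 (partial 1 u) x = px (py u) x by rewrite e1 [in RHS]pdE.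
have q2 : partial 1 (partial 1 u) x = py (py u) x by rewrite e1 pdE.
rewrite d0 d1 q0 q1 q2.
have dd (i j : 'I_2) : (delta_mx 0 i : 'rV[R]_2) 0 j = (j == i)%:R by rewrite mxE eqxx.
rewrite !dd/= => /eqP.
rewrite mulf_eq0 invr_eq0.
(* A vanishing denominator 2 (1 - |Du|^2) contradicts the slope bound; the vanishing numerator is
   the equation up to the factor -k of the unit normal. *)
case/orP => /eqP; last first.
  move=> z; exfalso; move: z w0; rewrite /slope2; clear; move: (px u x) (py u x) => p q z.
  have z' : 2 * (1 - (p ^+ 2 + q ^+ 2)) = 0 by rewrite -z; ring.
  by lra.
move: (px u x) (py u x) (px (px u) x) (px (py u) x) (py (py u) x) => p q a b c e.
apply: (mulfI k0); rewrite mulr0 -[RHS]oppr0 -e.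
by ring.
Qed.

Lemma pd_comm A f x b c : open A -> C1 A f -> (forall b, C1 A (pd b f)) -> A x ->
  pd b (pd c f) x = pd c (pd b f) x.
Proof.
move=> oA cf cg Ax; have e := schwarz oA cf cg Ax.
by case: b; case: c => //; rewrite e.
Qed.

(* [flow false u, flow true u] is the field Du / sqrt (1 - |Du|^2), whose
   divergence is the mean curvature up to a factor. *)
Definition iw u x : R := (Num.sqrt (1 - slope2 u x))^-1.
Definition flow b u x : R := pd b u x * iw u x.

Lemma iw_prop u x : slope2 u x < 1 -> 0 < iw u x /\ iw u x ^+ 2 * (1 - slope2 u x) = 1.
Proof.
move=> s1; have s0 : 0 < 1 - slope2 u x by rewrite subr_gt0.
have r0 : 0 < Num.sqrt (1 - slope2 u x) by rewrite sqrtr_gt0.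
split; first by rewrite invr_gt0.
by rewrite /iw exprVn sqr_sqrtr ?ltW// mulVf// gt_eqF.
Qed.

Lemma slope2_ge0 u x : 0 <= slope2 u x.
Proof. by rewrite addr_ge0 ?sqr_ge0. Qed.

Lemma iw_ge1 u x : slope2 u x < 1 -> 1 <= iw u x.
Proof.
move=> s1; have [g0 g1] := iw_prop s1; have s0 := slope2_ge0 u x.
move: (iw u x) (slope2 u x) g0 g1 s0 s1 => g s g0 g1 s0 s1; nra.
Qed.

(** The right side is (g + g')/2 |p - p'|^2 + (g - g')(s - s')/2 for the two gradients; the last
    term is nonnegative since g increases with s, and g, g' >= 1. The square root enters only
    through g^2 (1 - s) = 1, so the algebra is polynomial. *)
Lemma flow_mono_alg (p q p' q' g g' s s' : R) : s = p ^+ 2 + q ^+ 2 ->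
  s' = p' ^+ 2 + q' ^+ 2 -> 0 < g -> 0 < g' -> g ^+ 2 * (1 - s) = 1 ->
  g' ^+ 2 * (1 - s') = 1 -> 1 <= g -> 1 <= g' ->
  (p - p') ^+ 2 + (q - q') ^+ 2 <=
  (p * g - p' * g') * (p - p') + (q * g - q' * g') * (q - q').
Proof.
move=> es es' g0 g0' eg eg' g1 g1'.
have h : 0 <= (g - g') * (s - s').
  rewrite -(@pmulr_rge0 _ (g ^+ 2 * g' ^+ 2)) ?mulr_gt0 ?exprn_gt0//.
  have -> : g ^+ 2 * g' ^+ 2 * ((g - g') * (s - s')) =
    (g - g') * (g ^+ 2 * (g' ^+ 2 * (1 - s')) - g' ^+ 2 * (g ^+ 2 * (1 - s))) by ring.
  rewrite eg eg' !mulr1 (_ : _ * _ = (g - g') ^+ 2 * (g + g')); last by ring.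
  by rewrite mulr_ge0 ?sqr_ge0 ?addr_ge0// ltW.
rewrite -subr_ge0 (_ : _ - _ = ((g + g') / 2 - 1) * ((p - p') ^+ 2 + (q - q') ^+ 2)
  + 2^-1 * ((g - g') * (s - s'))); last by rewrite es es'; field.
have k1 : 0 <= (g + g') / 2 - 1 by lra.
apply: addr_ge0; apply: mulr_ge0 => //.
by apply: addr_ge0; exact: sqr_ge0.
Qed.

Section Flow.
Variables (A : set 'rV[R]_2) (u : 'rV[R]_2 -> R).
Hypothesis h : mgraph A u.
Let oA : open A := mg_open h.
Let C1p b : C1 A (pd b u) := mg_C2 h b.

Lemma C1_slope2 : C1 A (slope2 u).
Proof.
rewrite /slope2; have := C1_add oA (C1_mul oA (C1p false) (C1p false)) (C1_mul oA (C1p true) (C1p true)).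
by apply: C1_eq => // y _; rewrite !expr2.
Qed.

Lemma pd_slope2 c x : A x -> pd c (slope2 u) x =
  2 * (px u x * pd c (px u) x + py u x * pd c (py u) x).
Proof.
move=> Ax; have d b := C1_diff (C1p b) Ax.
rewrite [LHS](_ : _ = pd c (fun y => px u y * px u y + py u y * py u y) x); last first.
  by congr (pd c _ x); apply/funext => y; rewrite /slope2 !expr2.
rewrite pd_add ?pd_mul//; first by ring.
  exact: C1_diff (C1_mul oA (C1p false) (C1p false)) Ax.
exact: C1_diff (C1_mul oA (C1p true) (C1p true)) Ax.
Qed.

Let ginv (s : R) : R := (Num.sqrt (1 - s))^-1.

Let der_ginv (s : R) : s < 1 -> is_derive s 1 ginv (2^-1 * ginv s ^+ 3).
Proof.
move=> s1; have s0 : 0 < 1 - s by rewrite subr_gt0.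
have r0 : Num.sqrt (1 - s) != 0 by rewrite gt_eqF// sqrtr_gt0.
have D : is_derive s 1 (fun s : R => 1 - s) (- 1) by der_by; ring.
apply: (der_eq (der_inv (der_sqrt D s0) r0)).
by rewrite /ginv; field.
Qed.

Lemma C1_iw : C1 A (iw u).
Proof.
apply: (@C1_comp _ A ginv (fun s => 2^-1 * ginv s ^+ 3)) C1_slope2 _ _ => //.
  by move=> x Ax; apply: der_ginv; exact: mg_slope Ax.
move=> x Ax; have c : continuous_at (slope2 u x) ginv.
  exact: is_derive1_continuous (der_ginv (mg_slope h Ax)).
by cts.
Qed.

Lemma pd_iw c x : A x -> pd c (iw u) x =
  iw u x ^+ 3 * (px u x * pd c (px u) x + py u x * pd c (py u) x).
Proof.
move=> Ax; have := pd_comp c (der_ginv (mg_slope h Ax)) (C1_diff C1_slope2 Ax).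
by rewrite -/(iw u) pd_slope2// /ginv -/(iw u x) => ->; field.
Qed.

Lemma C1_flow b : C1 A (flow b u).
Proof. exact: C1_mul oA (C1p b) C1_iw. Qed.

Lemma pd_flow b c x : A x -> pd c (flow b u) x = pd c (pd b u) x * iw u x +
  pd b u x * (iw u x ^+ 3 * (px u x * pd c (px u) x + py u x * pd c (py u) x)).
Proof.
by move=> Ax; rewrite pd_mul ?pd_iw//; [exact: C1_diff (C1p b) Ax|exact: C1_diff C1_iw Ax].
Qed.

Lemma div_flow x : A x -> px (flow false u) x + py (flow true u) x = 0.
Proof.
move=> Ax; rewrite !pd_flow// (mg_sym h Ax); have [_ e] := iw_prop (mg_slope h Ax).
have := mg_eq h Ax; move: e; rewrite /slope2.
move: (px u x) (py u x) (iw u x) (px (px u) x) (px (py u) x) (py (py u) x).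
move=> p q g a b c e E.
(* The divergence is g^3 times the maximal surface equation plus a multiple of 1 - g^2 (1 - |Du|^2),
   which is 0. *)
have -> : a * g + p * (g ^+ 3 * (p * a + q * b)) + (c * g + q * (g ^+ 3 * (p * b + q * c))) =
  g * (a + c) * (1 - g ^+ 2 * (1 - (p ^+ 2 + q ^+ 2))) + g ^+ 3 *
  ((1 - q ^+ 2) * a + 2 * (p * q) * b + (1 - p ^+ 2) * c) by ring.
by rewrite e E; ring.
Qed.

Lemma C1_pd_flow b c : C1 A (pd c (flow b u)).
Proof.
apply: (C1_eq oA (fun x Ax => esym (pd_flow b c Ax))).
have ci := C1_iw; have c3 b' c' := mg_C3 h b' c'.
have ci3 : C1 A (fun x => iw u x ^+ 3).
  by apply: (C1_eq oA _ (C1_mul oA ci (C1_mul oA ci ci))) => y _; ring.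
by repeat first [exact: c3|exact: ci|exact: ci3|exact: C1p|apply: (C1_add oA)|apply: (C1_mul oA)].
Qed.

(** Differentiating div W(Du) = 0 in a coordinate direction gives the linearised equation, uniformly
    elliptic where |Du|^2 <= 1/2: there g^2 <= 2 and g <= 3/2, and the worst ratio g (g^2 + 1) <=
    9/2 explains the 5. *)
Lemma mpair_gradient B c : open B -> B `<=` A -> (forall x, B x -> slope2 u x <= 2^-1) ->
  mpair B (pd c u) (pd c (flow false u)) (pd c (flow true u)) 5 /\
  forall x, B x -> zbound 5 (pd c u) (pd c (flow false u)) (pd c (flow true u)) x.
Proof.
move=> oB BA hB.
have main x : B x ->
  pd c (flow false u) x ^+ 2 + pd c (flow true u) x ^+ 2 <= 5 *
    (pd c (flow false u) x * px (pd c u) x + pd c (flow true u) x * py (pd c u) x) /\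
  px (pd c u) x ^+ 2 + py (pd c u) x ^+ 2 <= 5 *
    (pd c (flow false u) x * px (pd c u) x + pd c (flow true u) x * py (pd c u) x).
  move=> Bx; have Ax := BA x Bx.
  rewrite !pd_flow// (pd_comm false c oA (mg_C1 h) C1p Ax) (pd_comm true c oA (mg_C1 h) C1p Ax).
  have [g0 e] := iw_prop (mg_slope h Ax); have g1 := iw_ge1 (mg_slope h Ax).
  have := hB x Bx; move: e; rewrite /slope2.
  move: (px u x) (py u x) (iw u x) (pd c (px u) x) (pd c (py u) x) g0 g1.
  move=> p q g a b g0 g1 e s; set m := p * a + q * b.
  have g2 : g ^+ 2 <= 2 by nra.
  have g3 : g <= 3/2 by nra.
  have -> : (a * g + p * (g ^+ 3 * m)) * a + (b * g + q * (g ^+ 3 * m)) * b =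
    g * (a ^+ 2 + b ^+ 2) + g * g ^+ 2 * m ^+ 2 by rewrite /m; ring.
  have -> : (a * g + p * (g ^+ 3 * m)) ^+ 2 + (b * g + q * (g ^+ 3 * m)) ^+ 2 =
    g ^+ 2 * (a ^+ 2 + b ^+ 2) + g ^+ 2 * g ^+ 2 * (2 + (p ^+ 2 + q ^+ 2) * g ^+ 2) * m ^+ 2.
    by rewrite /m; ring.
  have -> : (p ^+ 2 + q ^+ 2) * g ^+ 2 = g ^+ 2 - 1 by rewrite -e; ring.
  have := addr_ge0 (sqr_ge0 a) (sqr_ge0 b); have := sqr_ge0 m.
  move: (a ^+ 2 + b ^+ 2) (m ^+ 2) => d M M0 d0; clear e s hB m.
  have h1 : g ^+ 2 * d <= 5 * (g * d).
    by rewrite expr2 -mulrA [leRHS]mulrC -[leRHS]mulrA [d * 5]mulrC mulrA; nra.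
  have h2 : g ^+ 2 * g ^+ 2 * (2 + (g ^+ 2 - 1)) * M <= 5 * (g * g ^+ 2 * M).
    rewrite mulrA ler_wpM2r//.
    have -> : g ^+ 2 * g ^+ 2 * (2 + (g ^+ 2 - 1)) = g * g ^+ 2 * (g * (g ^+ 2 + 1)) by ring.
    rewrite [leRHS]mulrC ler_wpM2l ?mulr_ge0 ?sqr_ge0 ?ltW//.
    have : g * (g ^+ 2 + 1) <= 3 / 2 * 3 .
      by apply: ler_pM; rewrite ?addr_ge0 ?sqr_ge0//; [exact: ltW|lra].
    by lra.
  have h3 : d <= g * d by rewrite ler_peMl.
  have h4 : 0 <= g * g ^+ 2 * M by rewrite !mulr_ge0 ?sqr_ge0// ltW.
  by split; nra.
split; last by move=> x /main[].
split => //.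
- exact: C1_sub BA (C1p c).
- exact: C1_sub BA (C1_pd_flow false c).
- exact: C1_sub BA (C1_pd_flow true c).
- move=> x Bx; have Ax := BA x Bx.
  rewrite (pd_comm false c oA (C1_flow false) (C1_pd_flow false) Ax).
  rewrite (pd_comm true c oA (C1_flow true) (C1_pd_flow true) Ax).
  rewrite -pd_add; [|exact: C1_diff (C1_pd_flow _ _) Ax|exact: C1_diff (C1_pd_flow _ _) Ax].
  by rewrite (near_pd c oA Ax div_flow) pd_cst.
- by move=> x /main[].
Qed.

End Flow.

Lemma flow_mono A A' u u' x : mgraph A u -> mgraph A' u' -> A x -> A' x ->
  (px u x - px u' x) ^+ 2 + (py u x - py u' x) ^+ 2 <=
  (flow false u x - flow false u' x) * (px u x - px u' x) +
  (flow true u x - flow true u' x) * (py u x - py u' x).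
Proof.
move=> h h' Ax Ax'; have s := mg_slope h Ax; have s' := mg_slope h' Ax'.
have [g e] := iw_prop s; have [g' e'] := iw_prop s'.
by apply: flow_mono_alg (erefl (slope2 u x)) (erefl (slope2 u' x)) _ _ _ _ _ _ => //; exact: iw_ge1.
Qed.

Lemma mgraph_sub A B u : open B -> B `<=` A -> mgraph A u -> mgraph B u.
Proof.
move=> oB BA h; split => //; first exact: C1_sub BA (mg_C1 h).
- by move=> b; exact: C1_sub BA (mg_C2 h b).
- by move=> b c; exact: C1_sub BA (mg_C3 h b c).
- by move=> x /BA/(mg_slope h).
- by move=> x /BA/(mg_sym h).
- by move=> x /BA/(mg_eq h).
Qed.

Lemma mgraph_diff A u (v : 'rV[R]_2 -> R) : mgraph A u -> mgraph A v ->
  mpair A (fun x => u x - v x) (fun x => flow false u x - flow false v x)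
    (fun x => flow true u x - flow true v x) 1.
Proof.
move=> hu hv; have oA := mg_open hu.
have cd f g : C1 A f -> C1 A g -> C1 A (fun x => f x - g x).
  by move=> cf cg; apply: (C1_add oA) => //; exact: C1_opp.
split.
- exact: ltr01.
- exact: oA.
- exact: cd (mg_C1 hu) (mg_C1 hv).
- exact: cd (C1_flow hu _) (C1_flow hv _).
- exact: cd (C1_flow hu _) (C1_flow hv _).
- move=> x Ax.
  have d b := C1_diff (C1_flow hu b) Ax; have d' b := C1_diff (C1_flow hv b) Ax.
  have dN b : differentiable (fun x => - flow b v x) x by apply: differentiableN; exact: d'.
  rewrite pd_add ?pd_opp//; rewrite pd_add ?pd_opp//.
  by rewrite addrACA -opprD (div_flow hu Ax) (div_flow hv Ax) subrr.
- move=> x Ax.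
  have d := C1_diff (mg_C1 hu) Ax; have d' := C1_diff (mg_C1 hv) Ax.
  have dN : differentiable (fun x => - v x) x by apply: differentiableN; exact: d'.
  have E b : pd b (fun x => u x - v x) x = pd b u x - pd b v x by rewrite pd_add// pd_opp.
  rewrite mul1r /edens !E.
  exact: (flow_mono hu hv Ax Ax).
Qed.

End SmoothMaximal.

(** * Lipschitz bounds for entire graphs *)

Section Lipschitz.
Variable R : realType.
Local Notation px := (@pd R false).
Local Notation py := (@pd R true).
Implicit Types (f u : 'rV[R]_2 -> R) (x y z v w a : 'rV[R]_2) (A S : set 'rV[R]_2)
  (s t K : R).

(** Induction on the exceptional points, cutting the interval at each one inside it; the inequality
    stays strict because each piece has positive length. *)
Lemma increment_lt (g dg : R -> R) (l : seq R) K (a b : R) : a < b ->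
  (forall t, a <= t <= b -> continuous_at t g) ->
  (forall t, a < t < b -> t \notin l -> is_derive t 1 g (dg t) /\ `|dg t| < K) ->
  `|g b - g a| < K * (b - a).
Proof.
elim: l a b => [|c l IH] a b ab cg dgK.
  have [||c cab ->] := @MVT R g dg a b ab.
  - by move=> t; rewrite in_itv/= => /dgK[].
  - apply: continuous_in_subspaceT => t; rewrite inE/= in_itv/=; exact: cg.
  have ba : 0 < b - a by rewrite subr_gt0.
  have [|//|_ h] := dgK c; first by move: cab; rewrite in_itv.
  by rewrite normrM [X in _ * X]gtr0_norm// ltr_pM2r.
have cut (a' b' : R) : a <= a' -> b' <= b -> (forall t, a' < t < b' -> t != c) ->
    forall t, a' < t < b' -> t \notin l -> is_derive t 1 g (dg t) /\ `|dg t| < K.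
  move=> ha hb hc t ht tl; apply: dgK.
    by case/andP: ht => h1 h2; rewrite (le_lt_trans ha h1) (lt_le_trans h2 hb).
  by rewrite inE negb_or hc.
have [cab|cab] := boolP (a < c < b); last first.
  apply: IH => //; apply: cut => // t tab; apply: contraNneq cab => <-.
  exact: tab.
case/andP: cab => ac cb.
have h1 : `|g c - g a| < K * (c - a).
  apply: IH => //; last first.
    by apply: cut => //; [exact: ltW|move=> t /andP[_ tc]; rewrite lt_eqF].
  by move=> t /andP[ta tc]; apply: cg; rewrite ta (le_trans tc (ltW cb)).
have h2 : `|g b - g c| < K * (b - c).
  apply: IH => //; last first.
    by apply: cut => //; [exact: ltW|move=> t /andP[tc _]; rewrite gt_eqF].
  by move=> t /andP[tc tb]; apply: cg; rewrite (le_trans (ltW ac) tc) tb.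
have -> : g b - g a = (g b - g c) + (g c - g a) by rewrite subrKA.
have -> : K * (b - a) = K * (b - c) + K * (c - a) by ring.
exact: le_lt_trans (ler_normD _ _) (ltrD h2 h1).
Qed.

Lemma segment_lt f S K x y : finite_set S -> 0 < K -> x != y ->
  (forall t, 0 <= t <= 1 -> continuous_at (x + t *: (y - x)) f) ->
  (forall t, 0 < t < 1 -> ~ S (x + t *: (y - x)) ->
     differentiable f (x + t *: (y - x)) /\ slope2 f (x + t *: (y - x)) < K ^+ 2) ->
  `|f y - f x| < K * enorm (y - x).
Proof.
move=> /finite_seqP[s Ss] K0 xy cf df; set v := y - x.
have v0 : v != 0 by rewrite subr_eq0 eq_sym.
have n0 : 0 < enorm v by rewrite enorm_gt0.
(* Inverse of the parametrisation: an exceptional point on the segment is excluded through its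
   parameter. *)
pose tp p := dot (p - x) v / enorm v ^+ 2.
have tpE (t : R) : tp (x + t *: v) = t.
  rewrite /tp addrC addKr enorm_sqr dotE !mxE.
  have := enorm_sqr v; rewrite !mxE => e; rewrite mulrAC.
  rewrite (_ : _ + _ = t * (enorm v ^+ 2)); last by rewrite e; ring.
  by rewrite -e mulfK// expf_eq0/= gt_eqF.
pose g t := f (x + t *: v).
pose dg t := v 0 0 * px f (x + t *: v) + v 0 1 * py f (x + t *: v).
have E : g 1 - g 0 = f y - f x by rewrite /g scale1r scale0r addr0 /v [x + _]addrC subrK.
rewrite -E.
have -> : K * enorm v = K * enorm v * (1 - 0) by rewrite subr0 mulr1.
apply: (@increment_lt g dg (map tp s)) => //.
  move=> t ht; apply: (@continuous_comp _ _ _ (fun t => x + t *: v)); last exact: cf.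
  by apply: (@cvgD _ _ _ (nbhs t) _ (fun=> x)); [exact: cvg_cst|apply: cvgZr_tmp; exact: cvg_id].
move=> t ht tl; have nS : ~ S (x + t *: v).
  rewrite Ss/= => hs; move/negP: tl; apply; apply/mapP; exists (x + t *: v) => //.
have [dfx sl] := df t ht nS; split; first exact: der_line.
have Kn0 : 0 < K * enorm v by rewrite mulr_gt0.
rewrite -ltr_sqr ?nnegrE ?normr_ge0 ?(ltW Kn0)// real_normK ?num_real// exprMn enorm_sqr mulrC.
have vv : 0 < v 0 0 ^+ 2 + v 0 1 ^+ 2 by rewrite -enorm_sqr exprn_gt0.
apply: (@le_lt_trans _ _ ((v 0 0 ^+ 2 + v 0 1 ^+ 2) * slope2 f (x + t *: v))); last by rewrite ltr_pM2l.
rewrite /dg /slope2; clear; move: (v 0 0) (v 0 1) (px _ _) (py _ _) => p q c d.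
rewrite -subr_ge0 (_ : _ - _ = (p * d - q * c) ^+ 2) ?sqr_ge0//.
by ring.
Qed.

End Lipschitz.

Section EntireGraphs.
Variables (R : realType) (n : nat) (u : 'rV[R]_2 -> R).
Hypothesis hu : in_Gn n u.
Local Notation S := (singular_set u).
Implicit Types (x y a : 'rV[R]_2).

Lemma Gn_cts : continuous u. Proof. by case: hu => -[]. Qed.

Lemma Gn_finite : finite_set S.
Proof. by case: hu => -[_ cS _] _; exists n.+1. Qed.

Lemma finite_closed (F : set 'rV[R]_2) : finite_set F -> closed F.
Proof.
have [h _] := @accessible_finite_set_closed 'rV[R]_2.
by apply: h; apply: hausdorff_accessible; exact: norm_hausdorff.
Qed.

Lemma Gn_mgraph : mgraph (~` S) u.
Proof.
case: hu => -[_ _ hm] _; apply: maximal_mgraph => //.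
by rewrite openC; exact: finite_closed Gn_finite.
Qed.

Lemma Gn_lip x y : x != y -> `|u y - u x| < enorm (y - x).
Proof.
move=> xy; rewrite -[ltRHS]mul1r; apply: (@segment_lt R u S 1) => //.
- exact: Gn_finite.
- by move=> t _; exact: Gn_cts.
- move=> t _ nS; split; first exact: C1_diff (mg_C1 Gn_mgraph) nS.
  by rewrite expr1n; exact: mg_slope Gn_mgraph _ nS.
Qed.

Lemma Gn_lipw x y : `|u y - u x| <= enorm (y - x).
Proof.
have [->|xy] := eqVneq x y; first by rewrite !subrr normr0 enorm0.
exact: ltW (Gn_lip xy).
Qed.

Lemma finite_bounded (F : set 'rV[R]_2) : finite_set F ->
  exists2 M : R, 0 < M & forall x, F x -> enorm x < M.
Proof.
move=> /finite_seqP[s ->]; elim: s => [|p s [M M0 hM]]; first by exists 1.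
exists (M + enorm p); first by rewrite ltr_wpDr// enorm_ge0.
move=> x /=; rewrite inE => /orP[/eqP ->|/hM xM].
  by rewrite ltrDr.
by rewrite (lt_le_trans xM)// lerDl enorm_ge0.
Qed.

Lemma Gn_infinity (e : R) : 0 < e ->
  exists2 M : R, 0 < M & forall x, M < enorm x -> ~ S x /\ slope2 u x < e.
Proof.
move=> e0; case: (hu) => _ [_ hn].
have [M1 M10 hM1] := finite_bounded Gn_finite.
have e30 : 0 < e / 3 by rewrite divr_gt0.
have : nbhs (delta_mx 0 2 : 'rV[R]_3) [set m : 'rV[R]_3 | `|1 - m 0 2| < e / 3].
  have := @coord_continuous R 1 3 0 2 (delta_mx 0 2).
  move/cvgrPdist_lt => /(_ _ e30); rewrite mxE/=.
  by [].
move=> /hn[M2 hM2]; exists (Num.max M1 M2); first by rewrite lt_max M10.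
move=> x; rewrite gt_max => /andP[x1 x2].
have nS : ~ S x by move=> /hM1 h; move: (lt_trans h x1); rewrite ltxx.
split => //; have /= := hM2 x x2.
have [g0 eg] := iw_prop (mg_slope Gn_mgraph nS).
have g1 := iw_ge1 (mg_slope Gn_mgraph nS).
have -> : unit_normal u x 0 2 = iw u x.
  by rewrite /unit_normal scale_row3 row3_2 mulr1 /iw /slope2 !pdE opprD addrA.
have s1 := mg_slope Gn_mgraph nS.
rewrite distrC ltr_norml => /andP[_]; move: g0 eg g1 s1; clear -e0.
move: (iw u x) (slope2 u x) => g s g0 eg g1 s1 ge.
(* If s >= e, then 1 = g^2 (1 - s) <= (1 + e/3)^2 (1 - e) < 1. *)
rewrite ltNge; apply/negP => es.
have h1 : g ^+ 2 <= (1 + e / 3) ^+ 2 by rewrite ler_sqr ?nnegrE; lra.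
have h2 : 1 - s <= 1 - e by lra.
have h3 : 0 <= 1 - s by lra.
have := ler_pM (sqr_ge0 g) h3 h1 h2; rewrite eg.
have e1 : e < 1 by lra.
rewrite (_ : _ * _ = 1 - e / 3 - e * (e / 3) * (5 / 3 + e / 3)); last by field.
have : 0 < e * (e / 3) * (5 / 3 + e / 3) by rewrite !mulr_gt0//; lra.
by lra.
Qed.

End EntireGraphs.

(** * Behaviour at infinity *)

Section EndDecay.
Variable R : realType.
Local Notation px := (@pd R false).
Local Notation py := (@pd R true).
Implicit Types (v Zx Zy f : 'rV[R]_2 -> R) (a x : 'rV[R]_2) (A : set 'rV[R]_2)
  (K L M t s r d g : R).

Lemma pol_angle a t s : exists2 s', 0 <= s' <= 2 * pi & pol a t s = pol a t s'.
Proof. by have [s' hs' [c d]] := angle (cos2Dsin2 s); exists s' => //; rewrite /pol c d. Qed.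

Lemma exp_small g d : 0 < g -> 0 < d -> exists T : R, forall t, T <= t -> expR (- g * t) <= d.
Proof.
move=> g0 d0; exists (- ln d / g) => t ht.
rewrite -[leRHS]lnK ?posrE// ler_expR mulNr lerNl.
by rewrite mulrC -ler_pdivrMr.
Qed.

(** The intervals of radius e(t) about the values f t s meet pairwise, so the supremum of their left
    ends lies in all of them. *)
Lemma nested_limit (f : R -> R -> R) (e : R -> R) (T : R) :
  (forall t t' s s', T <= t -> t <= t' -> `|f t s - f t' s'| <= e t) ->
  exists b, forall t s, T <= t -> `|f t s - b| <= e t.
Proof.
move=> h.
have e0 t : T <= t -> 0 <= e t by move=> Tt; apply: le_trans (h t t 0 0 Tt (lexx _)).
have cr t t' s s' : T <= t -> T <= t' -> f t s - e t <= f t' s' + e t'.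
  move=> Tt Tt'; have [tt|/ltW tt] := leP t t'.
    have := h t t' s s' Tt tt; have := e0 _ Tt'; rewrite ler_norml => ? /andP[]; lra.
  have := h t' t s' s Tt' tt; have := e0 _ Tt; rewrite ler_norml => ? /andP[]; lra.
pose X := [set z : R | exists t s, T <= t /\ z = f t s - e t].
have ubX t s : T <= t -> ubound X (f t s + e t).
  by move=> Tt z [t' [s' [Tt' ->]]]; exact: cr.
have sX : has_sup X.
  by split; [exists (f T 0 - e T), T, 0|exists (f T 0 + e T); exact: ubX].
exists (sup X) => t s Tt; rewrite ler_norml; apply/andP; split.
  have : sup X <= f t s + e t by apply: ge_sup; [case: sX|exact: ubX].
  lra.
have : f t s - e t <= sup X by apply: ub_le_sup; [case: sX|exists t, s].
lra.
Qed.

(** A pair on the exterior of a disc about a, with |Z| and |Dv| controlled from both sides by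
    Z.Dv. *)
Record endpair A v Zx Zy K L a t0 : Prop := EndPair {
  ep_pair : mpair A v Zx Zy K ;
  ep_L : 0 < L ;
  ep_A : forall t s, t0 < t -> A (pol a t s) ;
  ep_Z : forall t s, t0 < t -> zbound L v Zx Zy (pol a t s) }.

Lemma edens_opp A v Zx Zy K x : mpair A v Zx Zy K -> A x ->
  edens (fun x => - v x) (fun x => - Zx x) (fun x => - Zy x) x = edens v Zx Zy x.
Proof.
move=> h Ax; rewrite /edens !pd_opp ?mulrNN//; exact: C1_diff (mp_v h) Ax.
Qed.

Lemma endpair_opp A v Zx Zy K L a t0 : endpair A v Zx Zy K L a t0 ->
  endpair A (fun x => - v x) (fun x => - Zx x) (fun x => - Zy x) K L a t0.
Proof.
case=> h L0 hA hZ; split => //; first exact: mpair_opp.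
by move=> t s ht; rewrite /zbound (edens_opp h (hA _ _ ht)) !sqrrN; exact: hZ.
Qed.

Lemma energy_opp A v Zx Zy K L a t0 t : endpair A v Zx Zy K L a t0 -> t0 < t ->
  energy (fun x => - v x) (fun x => - Zx x) (fun x => - Zy x) a t = energy v Zx Zy a t.
Proof.
case=> h L0 hA hZ ht; rewrite /energy; congr cint; apply/funext => s.
by rewrite (edens_opp h (hA _ _ ht)).
Qed.

Section Pair.
Variables (A : set 'rV[R]_2) (v Zx Zy : 'rV[R]_2 -> R) (K L : R) (a : 'rV[R]_2) (t0 : R).
Hypothesis h : endpair A v Zx Zy K L a t0.

Lemma end_derive t : t0 < t ->
  is_derive t 1 (flux (fun x => v x * Zx x) (fun x => v x * Zy x) a)
    (energy v Zx Zy a t).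
Proof.
move=> tt; have d0 : 0 < (t - t0) / 2 by rewrite divr_gt0// subr_gt0.
apply: (der_flux_id (ep_pair h) d0) => r s; rewrite ler_norml => /andP[hr _].
by apply: ep_A h _ _ _; lra.
Qed.

Lemma end_energy_ge0 t : t0 < t -> 0 <= energy v Zx Zy a t.
Proof. by move=> tt; apply: energy_ge0 (ep_pair h) _ => s; exact: ep_A h _ _ tt. Qed.

Lemma end_max M t1 : t0 < t1 -> (forall s, v (pol a t1 s) <= M) ->
  (forall d t, 0 < d -> exists2 r, t < r & energy v Zx Zy a r <= d) ->
  forall t s, t1 <= t -> v (pol a t s) <= M.
Proof.
move=> h1 hM lim t s t1t; have [s' hs' ->] := pol_angle a t s.
apply: (@max_principle_out R A v Zx Zy K L M a (ep_pair h) (ep_L h) [set t | t0 < t]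
  _ _ _ t1 h1 hM _ t s' _ t1t hs') => //=.
- by move=> x y z h2 _ /andP[xz _]; exact: lt_le_trans xz.
- move=> z hz; exists ((z - t0) / 2); first by rewrite divr_gt0// subr_gt0.
  by move=> r; rewrite ler_norml => /andP[hr _]; lra.
- by move=> r s2 hr; exact: ep_A h _ _ hr.
- move=> r d hr d0; have [r' rr er] := lim d r d0.
  have tr := lt_trans hr rr.
  by exists r'; split => //; [exact: ltW|move=> s2; exact: ep_Z h _ _ tr].
- exact: lt_le_trans t1t.
Qed.

End Pair.

(** The maximum principle for v and -v reduces the oscillation outside the circle r to that on the
    circle, which its energy bounds. *)
Lemma end_osc A v Zx Zy K L a t0 r d : endpair A v Zx Zy K L a t0 -> t0 < r ->
  (forall d t, 0 < d -> exists2 r, t < r & energy v Zx Zy a r <= d) ->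
  energy v Zx Zy a r <= d ->
  forall t s, r <= t -> `|v (pol a t s) - v (pol a r 0)| <= Num.sqrt (2 * pi * K * d).
Proof.
move=> h tr lim er t s rt.
have K0 := mp_gt0 (ep_pair h).
have circ s2 : `|v (pol a r s2) - v (pol a r 0)| <= Num.sqrt (2 * pi * K * d).
  have [s' hs' ->] := pol_angle a r s2.
  rewrite -sqrtr_sqr ler_wsqrtr//.
  have h0 : 0 <= (0 : R) <= 2 * pi by rewrite lexx mulr_ge0// pi_ge0.
  apply: le_trans (circle_osc (ep_pair h) (fun s => ep_A h s tr) h0 hs') _.
  by rewrite ler_wpM2l// !mulr_ge0 ?pi_ge0// ltW.
have up : v (pol a t s) <= v (pol a r 0) + Num.sqrt (2 * pi * K * d).
  apply: (end_max h tr _ lim _ rt) => s2.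
  by have := circ s2; rewrite ler_norml => /andP[_]; lra.
have dn : - v (pol a t s) <= - v (pol a r 0) + Num.sqrt (2 * pi * K * d).
  apply: (end_max (endpair_opp h) tr _ _ _ rt) => [s2|e t2 e0].
    by have := circ s2; rewrite ler_norml => /andP[] ? _; lra.
  have [r' r'1 r'2] := lim e (Num.max t0 t2) e0; move: r'1; rewrite gt_max => /andP[tr' t2r'].
  by exists r' => //; rewrite (energy_opp h tr').
by rewrite ler_norml; apply/andP; split; lra.
Qed.

(** The flux at t - 1 bounds the energy of some circle between t - 1 and t, and the square root of
    this energy bounds the oscillation of v outside; hence half the exponent g. *)
Lemma end_limit A v Zx Zy K L a t0 t1 g B : endpair A v Zx Zy K L a t0 ->
  t0 < t1 -> 0 < g ->
  (forall t, t0 < t -> flux (fun x => v x * Zx x) (fun x => v x * Zy x) a t <= 0) ->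
  (forall t, t1 <= t ->
    - flux (fun x => v x * Zx x) (fun x => v x * Zy x) a t <= B * expR (- g * t)) ->
  (forall d t, 0 < d -> exists2 r, t < r & energy v Zx Zy a r <= d) /\
  exists b C, forall t s, t1 + 1 <= t -> `|v (pol a t s) - b| <= C * expR (- (g / 2) * t).
Proof.
move=> h t01 g0 y0 yB; set y := flux _ _ a in y0 yB.
have K0 := mp_gt0 (ep_pair h).
have B0 : 0 <= B.
  have := yB _ (lexx t1); have := y0 _ t01; have := expR_gt0 (- g * t1).
  by move: (y t1) (expR _) => p q; nra.
have good t : t1 + 1 <= t -> exists2 r, t - 1 < r < t &
    energy v Zx Zy a r <= B * expR g * expR (- g * t).
  move=> ht; have ht1 : t0 < t - 1 by lra.
  have [r hr er] := good_time (end_derive h) y0 ht1.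
  exists r; first by rewrite subrK in hr.
  apply: le_trans er _; have -> : B * expR g * expR (- g * t) = B * expR (- g * (t - 1)).
    by rewrite -mulrA -expRD; congr (_ * expR _); ring.
  by apply: yB; lra.
have lim d t : 0 < d -> exists2 r, t < r & energy v Zx Zy a r <= d.
  move=> d0; have C0 : 0 < B * expR g + 1 by rewrite ltr_wpDl// mulr_ge0 ?expR_ge0.
  have [T hT] := exp_small g0 (divr_gt0 d0 C0).
  pose t2 := Num.max (t + 1) (Num.max T (t1 + 1)).
  have [h1 h2 h3] : [/\ t + 1 <= t2, T <= t2 & t1 + 1 <= t2].
    by rewrite /t2 !le_max !lexx !orbT.
  have [r /andP[r1 r2] er] := good t2 h3; exists r; first by lra.
  apply: le_trans er _; have := hT _ h2; rewrite ler_pdivlMr// => hh.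
  apply: le_trans hh; rewrite mulrC ler_wpM2l ?expR_ge0//; lra.
split; first exact: lim.
pose C1 := Num.sqrt (2 * pi * K * (B * expR g)).
have osc t t' s s' : t1 + 1 <= t -> t <= t' ->
    `|v (pol a t s) - v (pol a t' s')| <= 2 * C1 * expR (- (g / 2) * t).
  move=> ht tt'; have [r /andP[r1 r2] er] := good t ht.
  have tr : t0 < r by lra.
  have rt := ltW r2.
  have e1 := end_osc h tr lim er s rt; have e2 := end_osc h tr lim er s' (le_trans rt tt').
  have E : Num.sqrt (2 * pi * K * (B * expR g * expR (- g * t))) = C1 * expR (- (g / 2) * t).
    rewrite mulrA sqrtrM; last by rewrite !mulr_ge0 ?expR_ge0 ?pi_ge0// ltW.
    congr (_ * _); have -> : - g * t = (- (g / 2) * t) *+ 2 by rewrite -mulr_natr; field.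
    by rewrite mulr2n expRD -expr2 sqrtr_sqr ger0_norm// expR_ge0.
  rewrite E in e1 e2.
  move: e1 e2; rewrite !ler_norml => /andP[a1 a2] /andP[a3 a4]; apply/andP; split; lra.
have [b hb] := @nested_limit (fun t s => v (pol a t s)) _ _ osc.
by exists b, (2 * C1) => t s ht; exact: hb.
Qed.

End EndDecay.

Section FlowAlgebra.
Variable R : realType.
Implicit Types p q g s e c d : R.

(** W(p) - p is of third order at 0, hence Lipschitz with a constant of the order of |p|^2 <= e. *)
Lemma flow_close_alg p q p' q' g g' s s' e : s = p ^+ 2 + q ^+ 2 ->
  s' = p' ^+ 2 + q' ^+ 2 -> g ^+ 2 * (1 - s) = 1 ->
  g' ^+ 2 * (1 - s') = 1 -> 1 <= g -> 1 <= g' -> s <= e -> s' <= e -> e <= 1 / 6 ->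
  (p * g - p' * g' - (p - p')) ^+ 2 + (q * g - q' * g' - (q - q')) ^+ 2 <=
  (6 * e) ^+ 2 * ((p - p') ^+ 2 + (q - q') ^+ 2).
Proof.
move=> es es' eg eg' g1 g1' se se' e6.
have s0 : 0 <= s by rewrite es addr_ge0 ?sqr_ge0.
have s0' : 0 <= s' by rewrite es' addr_ge0 ?sqr_ge0.
have e0 : 0 <= e by lra.
have g2 : g ^+ 2 <= 2 by nra.
have g2' : g' ^+ 2 <= 2 by nra.
set D := (p - p') ^+ 2 + (q - q') ^+ 2.
have D0 : 0 <= D by rewrite addr_ge0 ?sqr_ge0.
have h1 : g - 1 <= e.
  have : (g - 1) * (g + 1) = g ^+ 2 * s.
    have : (g - 1) * (g + 1) - g ^+ 2 * s = g ^+ 2 * (1 - s) - 1 by ring.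
    by rewrite eg subrr => /subr0_eq.
  by nra.
have h1' : (g - 1) ^+ 2 <= e ^+ 2 by rewrite ler_sqr ?nnegrE//; lra.
have sd : (s - s') ^+ 2 <= 4 * e * D.
  have -> : s - s' = (p - p') * (p + p') + (q - q') * (q + q') by rewrite es es'; ring.
  apply: (@le_trans _ _ (D * ((p + p') ^+ 2 + (q + q') ^+ 2))).
    rewrite -subr_ge0 /D (_ : _ - _ = ((p - p') * (q + q') - (q - q') * (p + p')) ^+ 2); last by ring.
    exact: sqr_ge0.
  rewrite mulrC ler_wpM2r//.
  have := sqr_ge0 (p - p'); have := sqr_ge0 (q - q').
  by move: se se'; rewrite es es'; lra.
have gd : (g - g') ^+ 2 <= 4 * (s - s') ^+ 2.
  have gg : (g - g') * (g + g') = g ^+ 2 * g' ^+ 2 * (s - s').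
    rewrite (_ : (g - g') * (g + g') = g ^+ 2 * (g' ^+ 2 * (1 - s')) - g' ^+ 2 * (g ^+ 2 * (1 - s))).
      by ring.
    by rewrite eg eg'; ring.
  have hh : (g - g') ^+ 2 * 4 <= (g - g') ^+ 2 * (g + g') ^+ 2.
    by apply: ler_wpM2l; [exact: sqr_ge0|nra].
  have g4 : (g ^+ 2 * g' ^+ 2) ^+ 2 <= 4 ^+ 2.
    have m0 : 0 <= g ^+ 2 * g' ^+ 2 := mulr_ge0 (sqr_ge0 g) (sqr_ge0 g').
    rewrite ler_sqr ?nnegrE//.
    have -> : (4 : R) = 2 * 2 by ring.
    by apply: ler_pM; rewrite ?sqr_ge0.
  have := ler_wpM2r (sqr_ge0 (s - s')) g4.
  have -> : (g ^+ 2 * g' ^+ 2) ^+ 2 * (s - s') ^+ 2 = (g ^+ 2 * g' ^+ 2 * (s - s')) ^+ 2 by ring.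
  rewrite -gg exprMn.
  by move=> hh2; have := le_trans hh hh2; lra.
have -> : (p * g - p' * g' - (p - p')) ^+ 2 + (q * g - q' * g' - (q - q')) ^+ 2 =
   2 * (g - 1) ^+ 2 * D + 2 * (g - g') ^+ 2 * s'
   - (((p - p') * (g - 1) - (g - g') * p') ^+ 2 + ((q - q') * (g - 1) - (g - g') * q') ^+ 2).
  by rewrite /D es'; ring.
have := addr_ge0 (sqr_ge0 ((p - p') * (g - 1) - (g - g') * p')) (sqr_ge0 ((q - q') * (g - 1) - (g - g') * q')).
move: (_ + _ ^+ 2) => z z0.
have k1 : (g - 1) ^+ 2 * D <= e ^+ 2 * D by rewrite ler_wpM2r.
have k2 : (g - g') ^+ 2 * s' <= 4 * (4 * e * D) * e.
  apply: ler_pM => //; first exact: sqr_ge0.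
  by lra.
by rewrite exprMn; nra.
Qed.

(** For ex = ey = 0 this is Pythagoras with constant 1; an error of relative size e costs 2e + e^2
    <= 3e. *)
Lemma near_conformal (dx dy ex ey c d e : R) : c ^+ 2 + d ^+ 2 = 1 -> 0 < e -> e <= 1 ->
  ex ^+ 2 + ey ^+ 2 <= e ^+ 2 * (dx ^+ 2 + dy ^+ 2) ->
  (- d * dx + c * dy) ^+ 2 + ((dx + ex) * c + (dy + ey) * d) ^+ 2 <=
  (1 + 3 * e) * (dx ^+ 2 + dy ^+ 2).
Proof.
move=> cd e0 e1 he; set D := dx ^+ 2 + dy ^+ 2 in he *.
have D0 : 0 <= D by rewrite addr_ge0 ?sqr_ge0.
pose r := dx * c + dy * d; pose f := ex * c + ey * d.
have hf : f ^+ 2 <= ex ^+ 2 + ey ^+ 2.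
  rewrite -[leRHS]mulr1 -cd -subr_ge0 (_ : _ - _ = (ex * d - ey * c) ^+ 2) ?sqr_ge0//.
  by rewrite /f; ring.
have hr : (- d * dx + c * dy) ^+ 2 + r ^+ 2 = D by rewrite /D -[RHS]mulr1 -cd /r; ring.
have -> : ((dx + ex) * c + (dy + ey) * d) = r + f by rewrite /r /f; ring.
have hr2 : r ^+ 2 <= D by rewrite -hr lerDr sqr_ge0.
have rf : 2 * (r * f) <= 2 * e * D.
  rewrite -(ler_pM2l e0).
  have := sqr_ge0 (e * r - f); have := ler_wpM2l (sqr_ge0 e) hr2.
  by rewrite sqrrB exprMn; nra.
have -> : (- d * dx + c * dy) ^+ 2 + (r + f) ^+ 2 = D + 2 * (r * f) + f ^+ 2.
  by rewrite -hr; ring.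
have : e ^+ 2 * D <= e * D by rewrite ler_wpM2r//; nra.
by lra.
Qed.

End FlowAlgebra.

(** * First decay of the gradient *)

Section EndOfGraph.
Variable R : realType.
Local Notation px := (@pd R false).
Local Notation py := (@pd R true).
Implicit Types (u f : 'rV[R]_2 -> R) (a x : 'rV[R]_2) (A : set 'rV[R]_2)
  (t s c : R).

Lemma enorm_continuous : continuous (@enorm R).
Proof.
move=> x; rewrite (_ : @enorm R = fun v => Num.sqrt (v 0 0 ^+ 2 + v 0 1 ^+ 2)); last first.
  by apply/funext => v; rewrite /enorm dotE !expr2.
have c j : continuous_at x (fun v : 'rV[R]_2 => v 0 j) by exact: coord_continuous.
have c0 := c 0; have c1 := c 1.
apply: (@cts_comp _ _ (@Num.sqrt R) (fun v : 'rV[R]_2 => v 0 0 ^+ 2 + v 0 1 ^+ 2)).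
  by cts.
exact: sqrt_continuous.
Qed.

Lemma open_exterior a M : open [set x | M < enorm (x - a)].
Proof.
rewrite (_ : [set x | _] = (fun x => enorm (x - a)) @^-1` [set z | M < z])//.
apply: open_comp; last exact: open_gt.
move=> x _; apply: (@continuous_comp _ _ _ (fun x => x - a) (@enorm R)).
  by apply: (@cvgD _ _ _ (nbhs x) _ id (fun=> - a)); [exact: cvg_id|exact: cvg_cst].
exact: enorm_continuous.
Qed.

Lemma pol_far a M : 0 < M -> forall t s, ln (M + enorm a) < t -> M < enorm (pol a t s).
Proof.
move=> M0 t s ht; have p0 : 0 < M + enorm a by rewrite ltr_wpDr// enorm_ge0.
have : M + enorm a < expR t by rewrite -[ltLHS]lnK ?posrE// ltr_expR.
by have := enorm_sub (pol a t s) 0 a; rewrite enorm_pol subr0 sub0r enormN; lra.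
Qed.

(** A derivative of a divergence-free plane field is, up to sign, the rotated gradient of one of its
    components, so its normal component is a derivative along the circle. *)
Lemma flux_pd_flow A u (c : bool) a t : mgraph A u -> (forall s, A (pol a t s)) ->
  flux (pd c (flow false u)) (pd c (flow true u)) a t = 0.
Proof.
move=> h hA.
have cf b s := circle_der s (C1_flow h b) hA.
have cc b b' := circle_pd (b := b) (C1_flow h b') hA.
have per f : f (pol a t (2 * pi)) = f (pol a t 0) by rewrite -[2 * pi]add0r pol_per.
pose df b s := expR t * (- sin s * px (flow b u) (pol a t s) + cos s * py (flow b u) (pol a t s)).
have cdf b : continuous (df b).
  by have := cc false b; have := cc true b => c1 c2 s; rewrite /df; cts.
have z b : cint (df b) = 0.
  by rewrite (@cint_deriv _ _ (fun s => flow b u (pol a t s)))// per subrr.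
rewrite /flux; have dv s := div_flow h (hA s).
case: c.
  rewrite -(z false); congr cint; apply/funext => s; rewrite /df.
  by have := dv s; move/(canRL (addKr _)) => ->; ring.
rewrite -[RHS]oppr0 -(z true) -cintN//; congr cint; apply/funext => s; rewrite /df.
by have := dv s; move/(canRL (addrK _)) => ->; ring.
Qed.

Lemma flux_bound (Y0 Y1 : 'rV[R]_2 -> R) a t m : 0 <= m ->
  continuous (fun s => Y0 (pol a t s)) -> continuous (fun s => Y1 (pol a t s)) ->
  (forall s, Y0 (pol a t s) ^+ 2 + Y1 (pol a t s) ^+ 2 <= m ^+ 2) ->
  `|flux Y0 Y1 a t| <= 2 * pi * expR t * m.
Proof.
move=> m0 c0 c1 hm.
have cf : continuous (fun s => expR t * (Y0 (pol a t s) * cos s + Y1 (pol a t s) * sin s)).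
  by move=> s; cts.
have hb s : `|expR t * (Y0 (pol a t s) * cos s + Y1 (pol a t s) * sin s)| <= expR t * m.
  rewrite normrM (ger0_norm (expR_ge0 _)) ler_wpM2l ?expR_ge0//.
  rewrite -ler_sqr ?nnegrE// real_normK ?num_real//; apply: le_trans (hm s).
  have := cos2Dsin2 s; move: (Y0 _) (Y1 _) (cos s) (sin s) => p q c d cd.
  rewrite -[leRHS]mulr1 -cd -subr_ge0 (_ : _ - _ = (p * d - q * c) ^+ 2) ?sqr_ge0//.
  by ring.
have -> : 2 * pi * expR t * m = cint (fun _ : R => expR t * m) by rewrite cint_cst; ring.
rewrite ler_norml -cintN; last by move=> s; cts.
by apply/andP; split; apply: cint_le => //; (try by move=> s; cts) => s _;
  have := hb s; rewrite ler_norml => /andP[].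
Qed.

(** Each derivative of u is bounded near infinity, so the Riccati inequality makes its flux
    nonpositive, and Wirtinger with the constants of [mpair_gradient] gives a decay e^(-t/5) of this
    flux. Hence the derivative has a limit, which is 0 because the slope tends to 0. The exponent is
    crude but makes the pair with a catenoid asymptotically conformal. *)
Lemma grad_decay n u a : in_Gn n u -> exists B T : R, 0 <= B /\
  forall t s, T <= t -> ~ singular_set u (pol a t s) /\
    slope2 u (pol a t s) <= B * expR (- (5^-1) * t).
Proof.
move=> hu; have mg := Gn_mgraph hu.
have [M M0 hM] := Gn_infinity hu (ltac:(lra) : 0 < (2^-1 : R)).
pose t0 := ln (M + enorm a).
have hX t s : t0 < t -> M < enorm (pol a t s) by exact: pol_far.
have hc (c : bool) : exists B T : R, forall t s, T <= t -> pd c u (pol a t s) ^+ 2 <= B ^+ 2 * expR (- (5^-1) * t).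
  have oX : open [set x : 'rV[R]_2 | M < enorm x].
    have := @open_exterior 0 M; by under eq_set do rewrite subr0.
  have [P Zb] := @mpair_gradient R _ u mg _ c oX (fun x hx => (hM x hx).1)
    (fun x hx => ltW (hM x hx).2).
  have ep : endpair [set x : 'rV[R]_2 | M < enorm x] (pd c u) (pd c (flow false u)) (pd c (flow true u)) 5 5 a t0.
    by split => // t s ht; apply: Zb; exact: hX.
  have hA t : t0 < t -> forall s, M < enorm (pol a t s) by move=> ht s; exact: hX.
  have hu1 x : M < enorm x -> `|pd c u x| <= 1.
    move=> /hM[_ hs]; rewrite -ler_sqr ?nnegrE// real_normK ?num_real// expr1n.
    by move: hs; rewrite /slope2; case: (c); have := sqr_ge0 (px u x); have := sqr_ge0 (py u x); lra.
  have y0 := riccati_le0 (_ : 0 < 2 * pi * 1 ^+ 2 * 5) (end_derive ep).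
  have {}y0 : forall t, t0 < t -> flux (fun x => pd c u x * pd c (flow false u) x)
      (fun x => pd c u x * pd c (flow true u) x) a t <= 0.
    apply: y0; first by rewrite !mulr_gt0 ?pi_gt0 ?exprn_gt0.
    move=> t ht; apply: (flux_sqr (F := id) P (fun s => Zb _ (hX t s ht)) _ (hA t ht)) => //.
      by move=> z; exact: cvg_id.
    by move=> s; exact: hu1 (hX t s ht).
  have ye t : t0 < t -> - flux (fun x => pd c u x * pd c (flow false u) x)
      (fun x => pd c u x * pd c (flow true u) x) a t <= 5 *
      energy (pd c u) (pd c (flow false u)) (pd c (flow true u)) a t.
    move=> ht; apply: le_trans (ler_norm _) _; rewrite normrN.
    (* 10 adds the two constants 5, one for the gradient of [pd c u] and one for its field. *)
    have -> : (5 : R) = 2^-1 * 10 by field.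
    apply: (flux_wirtinger P (hA t ht)).
      by apply: (flux_pd_flow _ mg) => s; exact: (hM _ (hX t s ht)).1.
    move=> s; have := mp_D P (hX t s ht); have := Zb _ (hX t s ht); rewrite /zbound.
    have := cos2Dsin2 s; move: (edens _ _ _ _) (px _ _) (py _ _) (pd _ _ _) (pd _ _ _) (cos s) (sin s).
    move=> E p q zy zx k l kl h1 h2.
    have -> : (- l * p + k * q) ^+ 2 = (p ^+ 2 + q ^+ 2) * (k ^+ 2 + l ^+ 2) - (p * k + q * l) ^+ 2 by ring.
    have -> : (zx * k + zy * l) ^+ 2 = (zx ^+ 2 + zy ^+ 2) * (k ^+ 2 + l ^+ 2) - (zx * l - zy * k) ^+ 2 by ring.
    rewrite kl !mulr1; have := sqr_ge0 (p * k + q * l); have := sqr_ge0 (zx * l - zy * k).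
    by lra.
  have t01 : t0 < t0 + 1 by rewrite ltrDl.
  have yd := exp_decay (ltac:(lra) : 0 < (5 : R)) (end_derive ep) ye t01.
  have g0 : 0 < (5^-1 : R) by [].
  have [|_ [b [C hb]]] := end_limit (B := - flux (fun x => pd c u x * pd c (flow false u) x)
      (fun x => pd c u x * pd c (flow true u) x) a (t0 + 1) * expR ((t0 + 1) / 5)) ep t01 g0 y0.
    move=> t ht; have -> : - 5^-1 * t = - t / 5 by ring.
    exact: yd.
  have b0 : b = 0.
    apply/eqP; rewrite -normr_le0; apply/ler_addgt0Pl => e e0; rewrite addr0.
    have e20 : 0 < e / 2 by rewrite divr_gt0.
    have [M' M'0 hM'] := Gn_infinity hu (exprn_gt0 2 e20).
    have C1 : 0 < `|C| + 1 by rewrite ltr_wpDl.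
    have g20 : 0 < (5^-1 / 2 : R) by [].
    have [T hT] := exp_small g20 (divr_gt0 e20 C1).
    pose t := Num.max (Num.max T (t0 + 1 + 1)) (ln (M' + enorm a) + 1).
    have [h1 h2 h3] : [/\ T <= t, t0 + 1 + 1 <= t & ln (M' + enorm a) + 1 <= t].
      by rewrite /t !le_max !lexx !orbT.
    have h4 : ln (M' + enorm a) < t by lra.
    have := hb t 0 h2; have [_ hs] := hM' _ (pol_far M'0 0 h4).
    have hu2 : `|pd c u (pol a t 0)| <= e / 2.
      rewrite -ler_sqr ?nnegrE ?(ltW e20)// real_normK ?num_real//.
      move: hs; rewrite /slope2; case: (c); have := sqr_ge0 (px u (pol a t 0));
      have := sqr_ge0 (py u (pol a t 0)); lra.
    have : C * expR (- (5^-1 / 2) * t) <= e / 2.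
      apply: (@le_trans _ _ ((`|C| + 1) * expR (- (5^-1 / 2) * t))).
        by rewrite ler_wpM2r ?expR_ge0//; have := ler_norm C; lra.
      have := hT _ h1; first by rewrite ler_pdivlMr// mulrC.
    have := ler_distD (pd c u (pol a t 0)) b 0; rewrite !subr0 distrC; lra.
  exists C, (t0 + 1 + 1) => t s ht; have := hb t s ht; rewrite b0 subr0 => h.
  have C0 : 0 <= C * expR (- (5^-1 / 2) * t) by apply: le_trans h.
  move: h; rewrite -ler_sqr ?nnegrE// real_normK ?num_real// exprMn => h.
  apply: le_trans h _; rewrite ler_wpM2l ?sqr_ge0// expr2 -expRD.
  by rewrite (_ : _ + _ = - 5^-1 * t)//; field.
have [B0 [T0 h0]] := hc false; have [B1 [T1 h1]] := hc true.
exists (B0 ^+ 2 + B1 ^+ 2), (Num.max (t0 + 1) (Num.max T0 T1)); split; first by rewrite addr_ge0 ?sqr_ge0.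
move=> t s; rewrite !ge_max => /and3P[ht ht0 ht1]; split.
  by apply: (hM _ (hX t s _)).1; lra.
by rewrite /slope2 mulrDl lerD ?h0 ?h1.
Qed.

End EndOfGraph.

(* The rotationally symmetric comparison graph of flux [2 * pi * c]: its flow is
   the radial field [c * (x - a) / |x - a|^2]. *)
Section Catenoid.
Variables (R : realType) (c : R) (a : 'rV[R]_2).
Local Notation px := (@pd R false).
Local Notation py := (@pd R true).
Implicit Types (x : 'rV[R]_2) (r t s : R) (b : bool).

Definition coordinate b x : R := x 0 (if b then 1 else 0).
Definition offset b x : R := coordinate b x - coordinate b a.
Definition sqdist x : R := offset false x ^+ 2 + offset true x ^+ 2.
(* The profile as a function of the squared distance to the axis. *)
Definition catenoid_fun r : R := c * ln (Num.sqrt r + Num.sqrt (r + c ^+ 2)).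
Definition catenoid x : R := catenoid_fun (sqdist x).
Definition dcatenoid_fun r : R := c / (2 * Num.sqrt r * Num.sqrt (r + c ^+ 2)).
Definition radial b x : R := c * (offset b x * (sqdist x)^-1).

Lemma sqdistE x : sqdist x = enorm (x - a) ^+ 2.
Proof. by rewrite enorm_sqr /sqdist /offset /coordinate !mxE. Qed.

Lemma sqdist_gt0 x : x != a -> 0 < sqdist x.
Proof. by move=> xa; rewrite sqdistE exprn_gt0// enorm_gt0 subr_eq0. Qed.

Lemma sqdist_pol t s : sqdist (pol a t s) = expR t ^+ 2.
Proof. by rewrite sqdistE enorm_pol. Qed.

Let A : set 'rV[R]_2 := [set x | 0 < enorm (x - a)].
Let oA : open A. Proof. exact: open_exterior. Qed.

Let A_rho x : A x -> 0 < sqdist x.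
Proof. by rewrite /A/= enorm_gt0 subr_eq0; exact: sqdist_gt0. Qed.

Lemma C1_offset b : C1 A (offset b).
Proof. by apply: (C1_add oA (C1_coord b oA)); exact: C1_cst. Qed.

Lemma pd_offset b b' x : A x -> pd b (offset b') x = (b == b')%:R.
Proof.
move=> Ax; rewrite [LHS](_ : _ = pd b (fun y => coordinate b' y + (- coordinate b' a)) x)//.
rewrite pd_add; [|exact: C1_diff (C1_coord b' oA) Ax|exact: C1_diff (C1_cst _ oA) Ax].
by rewrite pd_cst addr0; exact: pd_coord.
Qed.

Lemma C1_sqdist : C1 A sqdist.
Proof.
have h b : C1 A (fun x => offset b x ^+ 2).
  apply: (C1_eq oA _ (C1_mul oA (C1_offset b) (C1_offset b))) => y _; exact: expr2.
exact: C1_add oA (h false) (h true).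
Qed.

Lemma pd_sqdist b x : A x -> pd b sqdist x = 2 * offset b x.
Proof.
move=> Ax; have d b' := C1_diff (C1_offset b') Ax.
have -> : sqdist = fun y => offset false y * offset false y + offset true y * offset true y.
  by apply/funext => y; rewrite /sqdist !expr2.
rewrite pd_add ?pd_mul ?pd_offset//; first by case: b => /=; ring.
  exact: C1_diff (C1_mul oA (C1_offset _) (C1_offset _)) Ax.
exact: C1_diff (C1_mul oA (C1_offset _) (C1_offset _)) Ax.
Qed.

Lemma der_catenoid_fun r : 0 < r -> is_derive r 1 catenoid_fun (dcatenoid_fun r).
Proof.
move=> r0; have r1 : 0 < r + c ^+ 2 by rewrite ltr_pwDl// sqr_ge0.
have s0 : 0 < Num.sqrt r by rewrite sqrtr_gt0.
have s1 : 0 < Num.sqrt (r + c ^+ 2) by rewrite sqrtr_gt0.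
have D1 : is_derive r 1 (fun r : R => r + c ^+ 2) 1 by der_by; ring.
have D := der_mul (der_cst c r) (der_ln (der_add (der_sqrt (der_id r) r0) (der_sqrt D1 r1))
  (addr_gt0 s0 s1)).
apply: (der_eq D); rewrite /dcatenoid_fun; field.
by rewrite !gt_eqF//= addr_gt0.
Qed.

Lemma C1_catenoid : C1 A catenoid.
Proof.
apply: (@C1_comp _ A catenoid_fun dcatenoid_fun) C1_sqdist _ _ => //.
  by move=> x /A_rho; exact: der_catenoid_fun.
move=> x Ax; have r0 := A_rho Ax.
have s0 : 0 < Num.sqrt (sqdist x) by rewrite sqrtr_gt0.
have s1 : 0 < Num.sqrt (sqdist x + c ^+ 2) by rewrite sqrtr_gt0 ltr_pwDl// sqr_ge0.
have cs (z : R) : continuous_at z (@Num.sqrt R) by exact: sqrt_continuous.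
have c1 : continuous_at (sqdist x) (fun r : R => Num.sqrt r) by exact: cs.
have c2 : continuous_at (sqdist x) (fun r : R => Num.sqrt (r + c ^+ 2)).
  by apply: (@cts_comp _ _ (@Num.sqrt R) (fun r : R => r + c ^+ 2)); [by cts|exact: cs].
rewrite /dcatenoid_fun; cts.
by rewrite !mulf_neq0 ?gt_eqF.
Qed.

Lemma pd_catenoid b x : A x ->
  pd b catenoid x = c * offset b x / (Num.sqrt (sqdist x) * Num.sqrt (sqdist x + c ^+ 2)).
Proof.
move=> Ax; have r0 := A_rho Ax.
have s0 : 0 < Num.sqrt (sqdist x) by rewrite sqrtr_gt0.
have s1 : 0 < Num.sqrt (sqdist x + c ^+ 2) by rewrite sqrtr_gt0 ltr_pwDl// sqr_ge0.
rewrite (pd_comp b (der_catenoid_fun r0) (C1_diff C1_sqdist Ax)) pd_sqdist// /dcatenoid_fun; field.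
by rewrite !gt_eqF.
Qed.

Lemma slope2_catenoid x : A x -> slope2 catenoid x = c ^+ 2 / (sqdist x + c ^+ 2).
Proof.
move=> Ax; have r0 := A_rho Ax; have r1 : 0 < sqdist x + c ^+ 2 by rewrite ltr_pwDl// sqr_ge0.
rewrite /slope2 !pd_catenoid// !expr_div_n !exprMn !sqr_sqrtr ?(ltW r0) ?(ltW r1)//.
rewrite -mulrDl -mulrDr -/(sqdist x); field.
by rewrite !gt_eqF.
Qed.

(* 1 / sqrt (1 - |D catenoid|^2) *)
Definition catenoid_iw x : R := Num.sqrt (sqdist x + c ^+ 2) / Num.sqrt (sqdist x).

Lemma catenoid_iwP x : A x -> [/\ catenoid_iw x ^+ 2 * (1 - slope2 catenoid x) = 1, 1 <= catenoid_iw x &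
  forall b, pd b catenoid x * catenoid_iw x = radial b x].
Proof.
move=> Ax; have r0 := A_rho Ax; have r1 : 0 < sqdist x + c ^+ 2 by rewrite ltr_pwDl// sqr_ge0.
have s0 : 0 < Num.sqrt (sqdist x) by rewrite sqrtr_gt0.
have s1 : 0 < Num.sqrt (sqdist x + c ^+ 2) by rewrite sqrtr_gt0.
split.
- rewrite slope2_catenoid// /catenoid_iw expr_div_n !sqr_sqrtr ?(ltW r0) ?(ltW r1)//; field.
  by rewrite !gt_eqF.
- by rewrite /catenoid_iw ler_pdivlMr// mul1r; apply: ler_wsqrtr; rewrite lerDl sqr_ge0.
- move=> b; rewrite pd_catenoid// /catenoid_iw /radial -[in RHS](sqr_sqrtr (ltW r0)); field.
  by rewrite !gt_eqF.
Qed.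

Lemma C1_radial b : C1 A (radial b).
Proof.
apply: (C1_mul oA (C1_cst c oA)); apply: (C1_mul oA (C1_offset b)).
have D r : 0 < r -> is_derive r 1 (fun r : R => r^-1) (- (r ^+ 2)^-1).
  move=> r0; apply: (der_eq (der_inv (der_id r) _)); rewrite ?gt_eqF//.
  by rewrite mulN1r.
apply: (@C1_comp _ A (fun r : R => r^-1) (fun r => - (r ^+ 2)^-1)) C1_sqdist _ _ => //.
  by move=> x /A_rho; exact: D.
move=> x /A_rho r0; cts.
by rewrite expf_neq0// gt_eqF.
Qed.

Lemma div_radial x : A x -> px (radial false) x + py (radial true) x = 0.
Proof.
move=> Ax; have r0 := A_rho Ax.
have D : is_derive (sqdist x) 1 (fun r : R => r^-1) (- (sqdist x ^+ 2)^-1).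
  apply: (der_eq (der_inv (der_id (sqdist x)) _)); rewrite ?gt_eqF//.
  by rewrite mulN1r.
have di : differentiable (fun x => (sqdist x)^-1) x.
  by apply: (differentiable_comp1 D); exact: C1_diff C1_sqdist Ax.
have dr b := C1_diff (C1_offset b) Ax.
have dm b : differentiable (fun x => offset b x * (sqdist x)^-1) x by exact: differentiableM.
have dc : differentiable (fun _ : 'rV[R]_2 => c) x by exact: C1_diff (C1_cst c oA) Ax.
have E b : pd b (radial b) x = c * ((sqdist x)^-1 - 2 * offset b x ^+ 2 * (sqdist x ^+ 2)^-1).
  rewrite /radial pd_mul// pd_cst mul0r add0r pd_mul// pd_offset// eqxx (_ : true%:R = 1)//.
  by rewrite (pd_comp b D (C1_diff C1_sqdist Ax)) pd_sqdist//; ring.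
rewrite !E -mulrDr; apply/eqP; rewrite mulf_eq0; apply/orP; right; apply/eqP.
transitivity (2 * (sqdist x)^-1 - 2 * sqdist x * (sqdist x ^+ 2)^-1); first by rewrite /sqdist; ring.
by field; rewrite gt_eqF.
Qed.

Lemma catenoid_pol t s : catenoid (pol a t s) = c * ln (expR t + Num.sqrt (expR t ^+ 2 + c ^+ 2)).
Proof. by rewrite /catenoid /catenoid_fun sqdist_pol sqrtr_sqr ger0_norm// expR_ge0. Qed.

End Catenoid.

(** * Comparison with a catenoid at infinity *)

Section Ends.
Variables (R : realType) (n : nat) (u : 'rV[R]_2 -> R) (a : 'rV[R]_2) (c M : R).
Local Notation px := (@pd R false).
Local Notation py := (@pd R true).
Hypothesis hu : in_Gn n u.
Hypothesis M0 : 0 < M.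
Hypothesis hM : forall x, M < enorm (x - a) -> ~ singular_set u x.
Local Notation X := [set x | M < enorm (x - a)].
Let v x := u x - catenoid c a x.
Let Z b x := flow b u x - radial c a b x.
Let mg := Gn_mgraph hu.

Let X0 : X `<=` [set x | 0 < enorm (x - a)].
Proof. by move=> x /=; exact: lt_trans. Qed.

(** The catenoid enters through its gradient and the radial form of its flow alone, so its second
    derivatives are never computed. *)
Lemma catenoid_mpair : mpair X v (Z false) (Z true) 1.
Proof.
have oX := @open_exterior R a M.
have c1 : C1 X u by apply: C1_sub (mg_C1 mg).
have cf b : C1 X (flow b u) by apply: C1_sub (C1_flow mg b).
have ck : C1 X (catenoid c a) by apply: C1_sub (@C1_catenoid R c a).
have cr b : C1 X (radial c a b) by apply: C1_sub (@C1_radial R c a b).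
have cN f : C1 X f -> C1 X (fun x => - f x) by exact: C1_opp.
split => //.
- by apply: C1_add => //; exact: cN.
- by apply: C1_add => //; exact: cN.
- by apply: C1_add => //; exact: cN.
- move=> x Xx; have dr b := C1_diff (cr b) Xx; have df b := C1_diff (cf b) Xx.
  have dN b := C1_diff (cN _ (cr b)) Xx.
  rewrite /Z !pd_add// !pd_opp// addrACA -opprD (div_flow mg (hM Xx)) (div_radial c (X0 Xx)).
  by rewrite subrr.
- move=> x Xx; rewrite mul1r /edens /Z /v.
  rewrite !pd_add; [|exact: C1_diff c1 Xx|exact: C1_diff (cN _ ck) Xx
    |exact: C1_diff c1 Xx|exact: C1_diff (cN _ ck) Xx].
  rewrite !pd_opp; [|exact: C1_diff ck Xx|exact: C1_diff ck Xx].
  have [w1 w2 w3] := catenoid_iwP c (X0 Xx); have s1 := mg_slope mg (hM Xx).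
  have [g0 g1] := iw_prop s1.
  rewrite -!w3; apply: (flow_mono_alg (erefl (slope2 u x)) (erefl (slope2 (catenoid c a) x)) g0 _ g1 w1 (iw_ge1 s1) w2).
  exact: lt_le_trans w2.
Qed.

Lemma catenoid_flow_close x e : M < enorm (x - a) -> slope2 u x <= e -> slope2 (catenoid c a) x <= e ->
  e <= 1 / 6 ->
  (Z false x - px v x) ^+ 2 + (Z true x - py v x) ^+ 2 <=
  (6 * e) ^+ 2 * (px v x ^+ 2 + py v x ^+ 2).
Proof.
move=> Xx se se' e6; have [w1 w2 w3] := catenoid_iwP c (X0 Xx); have s1 := mg_slope mg (hM Xx).
have [g0 g1] := iw_prop s1.
have du := C1_diff (mg_C1 mg) (hM Xx); have dk := C1_diff (@C1_catenoid R c a) (X0 Xx).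
have E b : pd b v x = pd b u x - pd b (catenoid c a) x.
  rewrite /v pd_add ?pd_opp//; apply: differentiableN; exact: dk.
rewrite !E /Z -!w3.
exact: (flow_close_alg (erefl (slope2 u x)) (erefl (slope2 (catenoid c a) x)) g1 w1 (iw_ge1 s1) w2 se se' e6).
Qed.

(** |Z - Dv| <= 6e |Dv| <= |Dv| gives |Z| <= 2 |Dv|. *)
Lemma catenoid_zbound x e : M < enorm (x - a) -> slope2 u x <= e -> slope2 (catenoid c a) x <= e ->
  e <= 1 / 6 -> zbound 4 v (Z false) (Z true) x.
Proof.
move=> Xx se se' e6; have h := catenoid_flow_close Xx se se' e6.
have := mp_D catenoid_mpair Xx; rewrite /zbound mul1r => hD.
apply: (@le_trans _ _ (4 * (px v x ^+ 2 + py v x ^+ 2))); last by rewrite ler_pM2l.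
have e0 : 0 <= e by apply: le_trans se; exact: slope2_ge0.
move: h; move: (Z false x) (Z true x) (px v x) (py v x) => zx zy p q h.
have D0 : 0 <= p ^+ 2 + q ^+ 2 by rewrite addr_ge0 ?sqr_ge0.
have : (6 * e) ^+ 2 * (p ^+ 2 + q ^+ 2) <= 1 * (p ^+ 2 + q ^+ 2).
  by rewrite ler_wpM2r// -(expr1n _ 2) ler_sqr ?nnegrE//; lra.
have := sqr_ge0 (zx - 2 * p); have := sqr_ge0 (zy - 2 * q); lra.
Qed.

End Ends.

(** * Asymptotics with the sharp rate *)

Section LogGrowth.
Variable R : realType.
Local Notation px := (@pd R false).
Local Notation py := (@pd R true).
Implicit Types (u f : 'rV[R]_2 -> R) (a x : 'rV[R]_2) (t s c r d : R).

Lemma flux_radial c a t : flux (radial c a false) (radial c a true) a t = 2 * pi * c.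
Proof.
rewrite /flux (_ : (fun s => _) = fun=> c); first by rewrite cint_cst; ring.
apply/funext => s; rewrite /radial sqdist_pol /offset /coordinate polE0 polE1.
have := cos2Dsin2 s; move: (cos s) (sin s) => k l kl.
transitivity (c * (k ^+ 2 + l ^+ 2)); last by rewrite kl mulr1.
by field; rewrite gt_eqF// expR_gt0.
Qed.

Lemma flux_sub A (Y0 Y1 Z0 Z1 : 'rV[R]_2 -> R) a t : C1 A Y0 -> C1 A Y1 -> C1 A Z0 -> C1 A Z1 ->
  (forall s, A (pol a t s)) ->
  flux (fun x => Y0 x - Z0 x) (fun x => Y1 x - Z1 x) a t = flux Y0 Y1 a t - flux Z0 Z1 a t.
Proof.
move=> c0 c1 c2 c3 hA; have d0 := circle_cts c0 hA; have d1 := circle_cts c1 hA.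
have d2 := circle_cts c2 hA; have d3 := circle_cts c3 hA.
rewrite /flux -cintB; [|by move=> s; cts|by move=> s; cts].
by congr cint; apply/funext => s; ring.
Qed.

Lemma flux_flow_cst A u a (T : R) : mgraph A u -> (forall t s, T < t -> A (pol a t s)) ->
  forall t t', T < t -> T < t' ->
  flux (flow false u) (flow true u) a t = flux (flow false u) (flow true u) a t'.
Proof.
move=> h hA; have D t : T < t -> is_derive t 1 (flux (flow false u) (flow true u) a) 0.
  move=> Tt; have d0 : 0 < (t - T) / 2 by rewrite divr_gt0// subr_gt0.
  have hA' r s : `|r - t| <= (t - T) / 2 -> A (pol a r s).
    by rewrite ler_norml => /andP[hr _]; apply: hA; lra.
  apply: (der_eq (der_flux (mg_open h) (C1_flow h false) (C1_flow h true) d0 hA')).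
  rewrite (_ : (fun s => _) = fun=> 0) ?cint_cst ?mul0r//.
  by apply/funext => s; rewrite (div_flow h (hA _ _ Tt)) mulr0.
have main t t' : T < t -> t <= t' -> flux (flow false u) (flow true u) a t =
    flux (flow false u) (flow true u) a t'.
  move=> Tt tt; apply: derive0_const => // x /andP[tx _]; apply: D.
  exact: lt_le_trans tx.
move=> t t' Tt Tt'; have [h1|/ltW h1] := leP t t'; first exact: main.
by apply/esym/main.
Qed.

(** The true rate is e^(-2t); the rate e^(-t/5) is that of [grad_decay], so that one function bounds
    both slopes. *)
Lemma slope2_catenoid_le c a t s : 0 <= t ->
  slope2 (catenoid c a) (pol a t s) <= c ^+ 2 * expR (- 5^-1 * t).
Proof.
move=> t0; have e0 := expR_gt0 t.
rewrite slope2_catenoid/= ?enorm_pol// sqdist_pol.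
have e2 : 0 < expR t ^+ 2 by rewrite exprn_gt0.
rewrite ler_wpM2l ?sqr_ge0//.
have -> : expR (- 5^-1 * t) = (expR (5^-1 * t))^-1 by rewrite mulNr expRN.
rewrite lef_pV2 ?posrE ?expR_gt0//; last by rewrite ltr_pwDl// sqr_ge0.
apply: (@le_trans _ _ (expR t ^+ 2)); last by rewrite lerDl sqr_ge0.
by rewrite expr2 -expRD ler_expR; lra.
Qed.

Definition graph_gap u c a x : R := u x - catenoid c a x.
Definition flow_gap u c a b x : R := flow b u x - radial c a b x.

Lemma graph_gap_growth n u a c t s : in_Gn n u -> 0 <= t ->
  `|graph_gap u c a (pol a t s)| <= (`|u a| + 1 + `|c| * (2 + `|c|)) * expR t.
Proof.
move=> hu tt; have e1 : 1 <= expR t by rewrite -[leLHS]expR0 ler_expR.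
have u1 : `|u (pol a t s)| <= `|u a| + expR t.
  have := Gn_lipw hu a (pol a t s); rewrite enorm_pol => l1.
  by have := ler_normD (u (pol a t s) - u a) (u a); rewrite subrK; lra.
have k0 : `|catenoid c a (pol a t s)| <= `|c| * (2 + `|c|) * expR t.
  rewrite catenoid_pol normrM -mulrA ler_wpM2l//.
  have r0 : expR t <= Num.sqrt (expR t ^+ 2 + c ^+ 2).
    by rewrite -[leLHS]ger0_norm ?expR_ge0// -sqrtr_sqr ler_wsqrtr// lerDl sqr_ge0.
  have r1 : Num.sqrt (expR t ^+ 2 + c ^+ 2) <= expR t + `|c|.
    rewrite -[leRHS]ger0_norm ?addr_ge0 ?expR_ge0// -sqrtr_sqr ler_wsqrtr//.
    rewrite sqrrD real_normK ?num_real//.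
    by have := mulr_ge0 (expR_ge0 t) (normr_ge0 c); lra.
  rewrite ger0_norm; last by apply: ln_ge0; lra.
  have p0 : 0 < expR t + Num.sqrt (expR t ^+ 2 + c ^+ 2) by lra.
  have := ler_wpM2l (normr_ge0 c) e1; have := ln_sublinear p0.
  by move: (ln _) => l; lra.
have := ler_normB (u (pol a t s)) (catenoid c a (pol a t s)); rewrite -/(graph_gap u c a (pol a t s)).
by have := ler_wpM2l (normr_ge0 (u a)) e1; lra.
Qed.

Lemma flow_small_alg (p q p' q' w z e : R) : 0 < e -> e <= 1 / 6 ->
  (w - (p - p')) ^+ 2 + (z - (q - q')) ^+ 2 <=
    (6 * e) ^+ 2 * ((p - p') ^+ 2 + (q - q') ^+ 2) ->
  p ^+ 2 + q ^+ 2 <= e -> p' ^+ 2 + q' ^+ 2 <= e -> w ^+ 2 + z ^+ 2 <= 16 * e.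
Proof.
move=> e0 e6; set D := (p - p') ^+ 2 + (q - q') ^+ 2 => cl s1 s2.
have D4 : D <= 4 * e.
  by rewrite /D; have := sqr_ge0 (p + p'); have := sqr_ge0 (q + q'); lra.
have D0 : 0 <= D by rewrite addr_ge0 ?sqr_ge0.
have cl2 : (6 * e) ^+ 2 * D <= 1 * D.
  by rewrite ler_wpM2r// -(expr1n _ 2) ler_sqr ?nnegrE//; lra.
have : w ^+ 2 + z ^+ 2 <= 4 * D.
  have := sqr_ge0 (w - 2 * (p - p')); have := sqr_ge0 (z - 2 * (q - q')).
  by move: cl cl2; rewrite /D; lra.
by lra.
Qed.

(* [c] is the flux of [u]; the energy estimate comes from the sharp Wirtinger
   inequality, which makes the deviation from the catenoid decay like 1/|x|. *)
Lemma Gn_end n u a : in_Gn n u -> exists c b C T : R, [/\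
  forall t, T < t -> flux (flow false u) (flow true u) a t = 2 * pi * c,
  forall t d, 0 < d -> exists2 r, t < r & energy (graph_gap u c a) (flow_gap u c a false) (flow_gap u c a true) a r <= d
     /\ forall s, zbound 4 (graph_gap u c a) (flow_gap u c a false) (flow_gap u c a true) (pol a r s) &
  forall t s, T < t -> `|graph_gap u c a (pol a t s) - b| <= C * expR (- t)].
Proof.
move=> hu; have mg := Gn_mgraph hu.
have [B [T0 [B0 hT0]]] := grad_decay a hu.
have [c fc] : exists c, forall t, T0 < t -> flux (flow false u) (flow true u) a t = 2 * pi * c.
  have hA r s : T0 < r -> (~` singular_set u) (pol a r s) by move=> /ltW hr; exact: (hT0 r s hr).1.
  have T01 : T0 < T0 + 1 by rewrite ltrDl ltr01.
  exists (flux (flow false u) (flow true u) a (T0 + 1) / (2 * pi)) => t tt.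
  have pp : 2 * pi != 0 :> R by rewrite mulf_neq0 ?gt_eqF ?pi_gt0.
  rewrite mulrC divfK; last exact: pp.
  exact (flux_flow_cst mg hA tt T01).
(* One coefficient for the squared slopes of u and of the catenoid; [eta] bounds both and stays
   below 1/6 past [t0], which makes 6 eta <= 1. *)
pose B' := B + c ^+ 2 + 1.
have B'0 : 0 < B' by rewrite /B'; have := sqr_ge0 c; lra.
have g0 : 0 < (5^-1 : R) by [].
have d60 : 0 < 1 / 6 / B' by rewrite !divr_gt0.
have [T2 hT2] := exp_small g0 d60.
pose t0 := Num.max T0 (Num.max T2 0).
have [k1 k2 k3] : [/\ T0 <= t0, T2 <= t0 & 0 <= t0] by rewrite /t0 !le_max !lexx !orbT.
pose eta t : R := B' * expR (- 5^-1 * t).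
have eta6 t : t0 < t -> 0 < eta t <= 1 / 6.
  move=> tt; rewrite mulr_gt0 ?expR_gt0//= /eta mulrC -ler_pdivlMr//.
  by apply: hT2; lra.
have sl t s : t0 < t -> slope2 u (pol a t s) <= eta t /\ slope2 (catenoid c a) (pol a t s) <= eta t.
  move=> tt; have h1 : T0 <= t by lra.
  have h2 : 0 <= t by lra.
  split.
    apply: le_trans (hT0 t s h1).2 _; rewrite ler_wpM2r ?expR_ge0// /B'.
    by have := sqr_ge0 c; lra.
  apply: le_trans (slope2_catenoid_le c a s h2) _; rewrite ler_wpM2r ?expR_ge0// /B'; lra.
have M0 : 0 < expR t0 by exact: expR_gt0.
have hM x : expR t0 < enorm (x - a) -> ~ singular_set u x.
  move=> hx; have xa : x != a by rewrite -subr_eq0 -enorm_eq0 gt_eqF// (lt_trans M0).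
  have [s _ ->] := polP xa; apply: (hT0 _ _ _).1.
  apply: (le_trans k1); rewrite -[leLHS]expRK ler_ln ?posrE ?expR_gt0 ?(lt_trans M0)//.
  exact: ltW.
set X := [set x | expR t0 < enorm (x - a)].
have hX t s : t0 < t -> X (pol a t s) by rewrite /X/= enorm_pol ltr_expR.
have P := catenoid_mpair c hu M0 hM.
have ep : endpair X (graph_gap u c a) (flow_gap u c a false) (flow_gap u c a true) 1 4 a t0.
  split; [exact: P|by []|exact: hX|].
  move=> t s tt; have [s1 s2] := sl t s tt; have /andP[_ e6] := eta6 t tt.
  exact: (catenoid_zbound hu M0 hM (hX t s tt) s1 s2 e6).
(* Zero flux of the gap is what the choice of [c] achieves, and what Wirtinger asks for. *)
have fz t : t0 < t -> flux (flow_gap u c a false) (flow_gap u c a true) a t = 0.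
  move=> tt; rewrite (@flux_sub X).
  - by rewrite fc ?flux_radial ?subrr//; lra.
  - by apply: C1_sub (C1_flow mg _) => x /hM.
  - by apply: C1_sub (C1_flow mg _) => x /hM.
  - by apply: C1_sub (@C1_radial R c a false) => x; exact: lt_trans.
  - by apply: C1_sub (@C1_radial R c a true) => x; exact: lt_trans.
  - by move=> s; exact: hX.
pose y := flux (fun x => graph_gap u c a x * flow_gap u c a false x) (fun x => graph_gap u c a x * flow_gap u c a true x) a.
pose E := energy (graph_gap u c a) (flow_gap u c a false) (flow_gap u c a true) a.
(* The relative error of the pair is 6 eta, whence 3 * 6 = 18 in the Wirtinger constant. *)
have yE t : t0 < t -> `|y t| <= 2^-1 * (1 + 18 * B' * expR (- 5^-1 * t)) * E t.
  move=> tt; apply: (flux_wirtinger P (fun s => hX t s tt) (fz t tt)) => s.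
  have [s1 s2] := sl t s tt; have /andP[e0 e6] := eta6 t tt.
  have cl := catenoid_flow_close hu M0 hM (hX t s tt) s1 s2 e6.
  have e60 : 0 < 6 * eta t by rewrite mulr_gt0.
  have e61 : 6 * eta t <= 1 by lra.
  have pq : forall p q : R, p + (q - p) = q by move=> p q; rewrite addrC subrK.
  have := near_conformal (cos2Dsin2 s) e60 e61 cl; rewrite !pq => nc.
  apply: le_trans nc _; rewrite -mulrA -/(eta t).
  have hD := mp_D P (hX t s tt); rewrite mul1r in hD.
  apply: (@le_trans _ _ ((1 + 18 * eta t) * (px (graph_gap u c a) (pol a t s) ^+ 2 + py (graph_gap u c a) (pol a t s) ^+ 2))).
    by rewrite le_eqVlt; apply/orP; left; apply/eqP; ring.
  by rewrite ler_wpM2l//; lra.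
have E0 t : t0 < t -> 0 <= E t by move=> tt; exact (end_energy_ge0 ep tt).
have C00 : 0 <= 18 * B' by lra.
pose N : R := `|u a| + 1 + `|c| * (2 + `|c|).
have N0 : 0 < N.
  by rewrite /N ltr_wpDr ?mulr_ge0 ?addr_ge0// ltr_wpDl.
have hN t s : t0 < t -> `|graph_gap u c a (pol a t s)| <= N * expR t.
  by move=> tt; apply: graph_gap_growth hu _; exact: le_trans k3 (ltW tt).
(* On the circle the gap is at most N e^t and its field at most 4 sqrt(eta), which tends to 0; as
   the length is 2 pi e^t, the flux is o(e^(2t)). *)
have ysub k : 0 < k -> exists2 t1, t0 < t1 & forall t, t1 < t -> y t <= k * expR (2 * t).
  move=> kk; have N2 : 0 < 2 * pi * N by rewrite !mulr_gt0 ?pi_gt0.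
  have [k' ek' kk'] : exists2 k', k' = k / (2 * pi * N) & 0 < k'.
    by exists (k / (2 * pi * N)) => //; rewrite divr_gt0.
  pose d := k' ^+ 2 / 16 / B'.
  have dd : 0 < d by rewrite !divr_gt0// exprn_gt0.
  have [T3 hT3] := exp_small g0 dd.
  exists (Num.max (t0 + 1) T3); first by rewrite lt_max ltrDl ltr01.
  move=> t; rewrite gt_max => /andP[t1 t2]; have tt : t0 < t by lra.
  apply: le_trans (ler_norm _) _.
  have -> : k * expR (2 * t) = 2 * pi * expR t * (N * expR t * k').
    rewrite ek'.
    have gen (Q m e : R) : Q != 0 -> m != 0 -> k * (e * e) = 2 * Q * e * (m * e * (k / (2 * Q * m))).
      by move=> Q0 m0; field; rewrite Q0 m0.
    by rewrite mulrDl mul1r expRD; apply: gen; rewrite gt_eqF// pi_gt0.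
  have cv := circle_cts (mp_v P) (fun s => hX t s tt).
  have c0 := circle_cts (mp_Z0 P) (fun s => hX t s tt).
  have c1 := circle_cts (mp_Z1 P) (fun s => hX t s tt).
  apply: flux_bound.
  - by rewrite !mulr_ge0 ?expR_ge0 ?invr_ge0 ?ltW// mulr_gt0.
  - by move=> s; cts.
  - by move=> s; cts.
  - move=> s; rewrite !exprMn -mulrDr.
    apply: ler_pM; rewrite ?sqr_ge0 ?addr_ge0 ?sqr_ge0//.
      have Ne : 0 <= N * expR t by rewrite mulr_ge0 ?expR_ge0// ltW.
      by rewrite -exprMn -[leLHS]real_normK ?num_real// ler_sqr ?nnegrE//; exact: hN.
    have [s1 s2] := sl t s tt; have /andP[e0 e6] := eta6 t tt.
    have cl := catenoid_flow_close hu M0 hM (hX t s tt) s1 s2 e6.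
    have e16 : 16 * eta t <= k' ^+ 2.
      rewrite mulrC -ler_pdivlMr// /eta mulrC -ler_pdivlMr//.
      by apply: hT3; exact: ltW.
    apply: le_trans e16.
    have du := C1_diff (mg_C1 mg) (hM _ (hX t s tt)).
    have dk : differentiable (catenoid c a) (pol a t s).
      by apply: C1_diff (@C1_catenoid R c a) _; rewrite /= enorm_pol expR_gt0.
    have Eb b : pd b (graph_gap u c a) (pol a t s) = pd b u (pol a t s) - pd b (catenoid c a) (pol a t s).
      by rewrite /graph_gap pd_add ?pd_opp//; apply: differentiableN; exact: dk.
    rewrite -/(graph_gap u c a) -/(flow_gap u c a false) -/(flow_gap u c a true) !Eb in cl.
    exact: flow_small_alg e0 e6 cl s1 s2.
have [y0 yd] := sharp_decay g0 C00 (end_derive ep) E0 yE ysub.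
have t01 : t0 < t0 + 1 by rewrite ltrDl.
have [A hA] := yd _ t01.
have [lim [b [C hC]]] := end_limit ep t01 (ltac:(lra) : 0 < (2 : R)) y0 hA.
exists c, b, C, (t0 + 1 + 1); split.
- by move=> t tt; apply: fc; lra.
- move=> t d d0; have [r] := lim d (Num.max t t0) d0; rewrite gt_max => /andP[tr t0r] er.
  by exists r => //; split => // s; exact: ep_Z ep _ _ t0r.
- move=> t s tt; have := hC t s (ltW tt).
  by rewrite divff// mulN1r.
Qed.

End LogGrowth.

(** * Identification of the logarithmic growth *)

Section LogGrowthValue.
Variable R : realType.
Implicit Types (u f v Zx Zy : 'rV[R]_2 -> R) (a x : 'rV[R]_2) (A : set 'rV[R]_2)
  (t s c r d m : R).

(** Both inequalities come from ln z <= z - 1, for z = N / (2m) and for its inverse. *)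
Lemma ln_close c m r (al : R) : 0 < m -> `|r - m| <= al -> 2 * al < m ->
  `|ln (r + Num.sqrt (r ^+ 2 + c ^+ 2)) - ln m - ln 2| <= (2 * al + `|c|) / m.
Proof.
move=> m0; rewrite ler_norml => /andP[r1 r2] am; have rm : m / 2 < r by lra.
have r0 : 0 < r by lra.
have n1 : r <= Num.sqrt (r ^+ 2 + c ^+ 2).
  by rewrite -[leLHS]gtr0_norm// -sqrtr_sqr ler_wsqrtr// lerDl sqr_ge0.
have n2 : Num.sqrt (r ^+ 2 + c ^+ 2) <= r + `|c|.
  rewrite -[leRHS]ger0_norm ?addr_ge0 ?(ltW r0)// -sqrtr_sqr ler_wsqrtr//.
  rewrite sqrrD real_normK ?num_real//.
  by have := mulr_ge0 (ltW r0) (normr_ge0 c); lra.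
set N := r + _; have N0 : 0 < N by rewrite /N; lra.
have m2 : 0 < 2 * m by lra.
have -> : ln N - ln m - ln 2 = ln (N / (2 * m)).
  by rewrite ln_div ?posrE// lnM ?posrE//; lra.
have q0 : 0 < N / (2 * m) by rewrite divr_gt0.
have nc := normr_ge0 c.
rewrite ler_norml; apply/andP; split.
  have : ln ((2 * m) / N) <= (2 * m) / N - 1.
    have := @le_ln1Dx R ((2 * m) / N - 1); rewrite subrKC; apply.
    by rewrite ltrBDr addNr divr_gt0.
  rewrite -[(2 * m) / N]invf_div lnV ?posrE// => h.
  rewrite lerNl; apply: le_trans h _; rewrite invf_div lerBlDr ler_pdivrMr//.
  have q1 : 2 * al + `|c| <= (2 * al + `|c|) / m * N.
    by rewrite mulrAC ler_pdivlMr// ler_wpM2l// /N; lra.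
  by rewrite mulrDl mul1r; move: q1; rewrite /N; lra.
have := @le_ln1Dx R (N / (2 * m) - 1); rewrite subrKC => h.
apply: le_trans (h _) _; first by rewrite ltrBDr addNr.
rewrite lerBlDr ler_pdivrMr// (_ : (_ / m + 1) * (2 * m) = 2 * (2 * al + `|c|) + 2 * m).
  by rewrite /N; lra.
by field; rewrite gt_eqF.
Qed.

Lemma has_log_growth_unique u c c' : has_log_growth u c -> has_log_growth u c' -> c = c'.
Proof.
move=> [b [C [M hM]]] [b' [C' [M' hM']]].
pose T := Num.max 0 (Num.max (ln (`|M| + 1)) (ln (`|M'| + 1))).
pose B := `|b - b'| + `|C| + `|C'|.
have key t : T < t -> `|c - c'| * t <= B.
  rewrite /T !gt_max => /and3P[t0 t1 t2].
  have e1 : 1 <= expR t by rewrite -[leLHS]expR0 ler_expR ltW.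
  have n : enorm (pol 0 t 0 : 'rV[R]_2) = expR t by have := enorm_pol (0 : 'rV[R]_2) t 0; rewrite subr0.
  have h N : ln (`|N| + 1) < t -> N < enorm (pol 0 t 0 : 'rV[R]_2).
    move=> hh; rewrite n; have p1 : 0 < `|N| + 1 by rewrite ltr_wpDl.
    have : `|N| + 1 < expR t by rewrite -[ltLHS]lnK ?posrE// ltr_expR.
    by have := ler_norm N; lra.
  have := hM _ (h _ t1); have := hM' _ (h _ t2); rewrite /= n expRK.
  have i1 : (expR t)^-1 <= 1 by rewrite invf_le1// (lt_le_trans ltr01).
  have i0 : 0 <= (expR t)^-1 by rewrite invr_ge0 expR_ge0.
  have c1 : C * (expR t)^-1 <= `|C|.
    apply: (@le_trans _ _ (`|C| * 1)); last by rewrite mulr1.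
    by apply: (le_trans (ler_wpM2r i0 (ler_norm C))); rewrite ler_wpM2l.
  have c2 : C' * (expR t)^-1 <= `|C'|.
    apply: (@le_trans _ _ (`|C'| * 1)); last by rewrite mulr1.
    by apply: (le_trans (ler_wpM2r i0 (ler_norm C'))); rewrite ler_wpM2l.
  move=> h2 h1; rewrite -[t in leLHS](gtr0_norm t0) -normrM /B.
  have -> : (c - c') * t = (u (pol 0 t 0) - (c' * t + b')) - (u (pol 0 t 0) - (c * t + b)) - (b - b') by ring.
  apply: (le_trans (ler_normB _ _)); have := ler_normB (u (pol 0 t 0) - (c' * t + b')) (u (pol 0 t 0) - (c * t + b)).
  by lra.
apply/eqP; rewrite -subr_eq0 -normr_eq0 eq_le normr_ge0 andbT leNgt; apply/negP => n0.
have B0 : 0 <= B by rewrite /B !addr_ge0.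
pose t := Num.max (T + 1) (B / `|c - c'| + 1).
have t1 : T < t by rewrite lt_max ltrDl ltr01.
have := key t t1; rewrite leNgt => /negP; apply.
rewrite mulrC -ltr_pdivrMr//; apply: (@lt_le_trans _ _ (B / `|c - c'| + 1)).
  by rewrite ltrDl.
by rewrite le_max lexx orbT.
Qed.

(** Identifies the constant of [Gn_end] with [log_growth u]: the catenoid is c ln|x| + c ln 2 +
    O(1/|x|), and the growth is unique. *)
Lemma Gn_asym n u a : in_Gn n u -> exists b C T : R, [/\
  forall t, T < t -> flux (flow false u) (flow true u) a t = 2 * pi * log_growth u,
  forall t d, 0 < d -> exists2 r, t < r &
     energy (graph_gap u (log_growth u) a) (flow_gap u (log_growth u) a false) (flow_gap u (log_growth u) a true) a r <= d
     /\ forall s, zbound 4 (graph_gap u (log_growth u) a) (flow_gap u (log_growth u) a false) (flow_gap u (log_growth u) a true) (pol a r s) &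
  forall t s, T < t -> `|graph_gap u (log_growth u) a (pol a t s) - b| <= C * expR (- t)].
Proof.
move=> hu; have [c [b [C [T [h1 h2 h3]]]]] := Gn_end a hu.
have hc : has_log_growth u c.
  exists (b + c * ln 2), (2 * `|C| + `|c| * (2 * enorm a + `|c|)), (2 * enorm a + enorm a + expR T) => x hx.
  have e0 := expR_gt0 T; have a0 := enorm_ge0 a.
  have m0 : 0 < enorm x by lra.
  have am : 2 * enorm a < enorm x by lra.
  have rm : `|enorm (x - a) - enorm x| <= enorm a.
    have := enorm_sub x a 0; have := enorm_sub x 0 a.
    by rewrite !subr0 sub0r enormN ler_norml => ? ?; apply/andP; split; lra.
  have re : expR T < enorm (x - a) by move: rm; rewrite ler_norml => /andP[]; lra.
  have r2 : enorm x / 2 <= enorm (x - a) by move: rm; rewrite ler_norml => /andP[]; lra.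
  have r0 : 0 < enorm (x - a) by lra.
  have xa : x != a by rewrite -subr_eq0 -enorm_eq0 gt_eqF.
  have [s _ ex] := polP xa.
  have tT : T < ln (enorm (x - a)) by rewrite -[ltLHS]expRK ltr_ln ?posrE.
  have := h3 _ s tT; rewrite -ex /graph_gap.
  have -> : catenoid c a x = c * ln (enorm (x - a) + Num.sqrt (enorm (x - a) ^+ 2 + c ^+ 2)).
    by rewrite {1}ex catenoid_pol lnK.
  rewrite expRN lnK ?posrE// => k1; have k2 := ln_close c m0 rm am.
  rewrite /=; move: k1 k2; move: (ln (_ + _)) => l k1 k2.
  have k3 : C * (enorm (x - a))^-1 <= 2 * `|C| * (enorm x)^-1.
    apply: (@le_trans _ _ (`|C| * (enorm (x - a))^-1)).
      by rewrite ler_wpM2r ?invr_ge0 ?enorm_ge0 ?ler_norm.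
    rewrite [2 * _]mulrC -mulrA ler_wpM2l//.
    rewrite -[leRHS]invrK lef_pV2 ?posrE ?invr_gt0 ?mulr_gt0 ?invr_gt0// invfM invrK mulrC//.
  have k4 : `|c * (l - ln (enorm x) - ln 2)| <= `|c| * (2 * enorm a + `|c|) * (enorm x)^-1.
    by rewrite normrM -mulrA ler_wpM2l.
  have -> : u x - (c * ln (enorm x) + (b + c * ln 2)) = (u x - c * l - b) + c * (l - ln (enorm x) - ln 2) by ring.
  by apply: (le_trans (ler_normD _ _)); rewrite mulrDl lerD// (le_trans k1).
have -> : log_growth u = c.
  rewrite /log_growth; case: xgetP => [c' _ hc'|hn]; first exact: has_log_growth_unique hc' hc.
  by case: (hn c).
by exists b, C, T.
Qed.

(** Unlike in [end_osc], the reverse bound on Z is asked on a sequence of circles only, so the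
    starting circle may be one where the slopes are near 1. *)
Lemma mpair_osc A v Zx Zy K L a t0 r B : mpair A v Zx Zy K -> 0 < L -> t0 < r ->
  (forall t s, t0 < t -> A (pol a t s)) ->
  (forall t d, 0 < d -> exists2 r, t < r & energy v Zx Zy a r <= d /\
     forall s, zbound L v Zx Zy (pol a r s)) ->
  (forall s, `|v (pol a r s) - v (pol a r 0)| <= B) ->
  forall t s, r <= t -> `|v (pol a t s) - v (pol a r 0)| <= B.
Proof.
move=> h L0 tr hA lim circ t s rt.
have up v' Zx' Zy' : mpair A v' Zx' Zy' K ->
    (forall t d, 0 < d -> exists2 r, t < r & energy v' Zx' Zy' a r <= d /\
     forall s, zbound L v' Zx' Zy' (pol a r s)) ->
    (forall s, v' (pol a r s) <= v' (pol a r 0) + B) -> v' (pol a t s) <= v' (pol a r 0) + B.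
  move=> h' lim' circ'; have [s' hs' ->] := pol_angle a t s.
  apply: (@max_principle_out R A v' Zx' Zy' K L _ a h' L0 [set t | t0 < t]
    _ _ _ r tr circ' _ t s' _ rt hs') => /=.
  - by move=> x y z h2 _ /andP[xz _]; exact: lt_le_trans xz.
  - move=> z hz; exists ((z - t0) / 2); first by rewrite divr_gt0// subr_gt0.
    by move=> r'; rewrite ler_norml => /andP[hr _]; lra.
  - by move=> r' s2 hr; exact: hA.
  - move=> r' d hr d0; have [r2 rr [er zr]] := lim' r' d d0.
    exists r2; split; [exact: lt_trans rr|exact: ltW|exact: zr|exact: er].
  - exact: lt_le_trans rt.
have h1 := up _ _ _ h lim _; have h2 := up _ _ _ (mpair_opp h) _ _.
rewrite ler_norml; apply/andP; split.
  suff : - v (pol a t s) <= - v (pol a r 0) + B by lra.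
  apply: h2 => [t' d d0|s']; last by have := circ s'; rewrite ler_norml => /andP[]; lra.
  have [r' + [er zr]] := lim (Num.max t' t0) d d0; rewrite gt_max => /andP[tr' t0r'].
  have E s2 := edens_opp h (hA _ s2 t0r').
  exists r' => //; split.
    by rewrite /energy; under eq_fun do rewrite E; exact: er.
  by move=> s2; rewrite /zbound E !sqrrN; exact: zr.
suff : v (pol a t s) <= v (pol a r 0) + B by lra.
by apply: h1 => s'; have := circ s'; rewrite ler_norml => /andP[]; lra.
Qed.

(** The bound does not depend on u: on the circle r the catenoid is constant and u is 1-Lipschitz,
    and the maximum principle extends the bound outwards. The constants of [Gn_asym] have no such
    uniformity. *)
Lemma Gn_osc n u a (M : R) r : in_Gn n u -> 0 < M ->
  (forall x, M < enorm (x - a) -> ~ singular_set u x) -> M < expR r ->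
  forall t s, r <= t -> `|graph_gap u (log_growth u) a (pol a t s)
     - graph_gap u (log_growth u) a (pol a r 0)| <= 2 * expR r.
Proof.
move=> hu M0 hM Mr t s rt; have [b [C [T [_ lim _]]]] := Gn_asym a hu.
have P := catenoid_mpair (log_growth u) hu M0 hM.
have lr : ln M < r by rewrite -[ltRHS]expRK ltr_ln ?posrE ?expR_gt0.
apply: (mpair_osc P (ltac:(lra) : 0 < (4 : R)) lr _ lim _ _ rt).
  by move=> t' s' ht /=; rewrite enorm_pol -[ltLHS]lnK ?posrE// ltr_expR.
move=> s'; rewrite !catenoid_pol; set k := log_growth u * _.
have -> : u (pol a r s') - k - (u (pol a r 0) - k) = u (pol a r s') - u (pol a r 0) by ring.
apply: (le_trans (Gn_lipw hu _ _)); apply: (le_trans (enorm_sub _ a _)).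
by rewrite enorm_pol enorm_dist enorm_pol; lra.
Qed.

End LogGrowthValue.

(** * Comparison of two graphs *)

Section Comparison.
Variable R : realType.
Local Notation px := (@pd R false).
Local Notation py := (@pd R true).
Implicit Types (u v w f g : 'rV[R]_2 -> R) (a x p : 'rV[R]_2) (A B : set 'rV[R]_2)
  (t s r d e mu sg : R).

Lemma der_circle_mean f A a t0 d : open A -> C1 A f -> 0 < d ->
  (forall t s, `|t - t0| <= d -> A (pol a t s)) ->
  is_derive t0 1 (fun t => cint (fun s => f (pol a t s)))
    (cint (fun s => expR t0 * (cos s * px f (pol a t0 s) + sin s * py f (pol a t0 s)))).
Proof.
move=> oA cf d0 hA.
pose df t s := expR t * (cos s * px f (pol a t s) + sin s * py f (pol a t s)).
have [G hG] : exists G, forall t s, `|t - t0| <= d -> 0 <= s <= 2 * pi -> `|df t s| <= G.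
  apply: bounded_pol; first exact: ltW.
  move=> t s ht; have Ap := hA t s ht.
  have e1 : continuous_at (t, s) (fun p : R * R => p.1) by exact: cvg_fst.
  have e2 : continuous_at (t, s) (fun p : R * R => p.2) by exact: cvg_snd.
  have f0 : continuous_at (t, s) (fun p : R * R => px f (pol a p.1 p.2)).
    by apply: cts_pol; exact: C1_pd cf Ap.
  have f1 : continuous_at (t, s) (fun p : R * R => py f (pol a p.1 p.2)).
    by apply: cts_pol; exact: C1_pd cf Ap.
  by rewrite /df; cts.
apply: (@cint_diff R (fun t s => f (pol a t s)) df t0 d G d0).
- move=> t s /ltW ht; apply: der_pol_t; exact: C1_diff cf (hA _ _ ht).
- by move=> t /ltW ht; apply: circle_cts cf _ => s; exact: hA.
- by move=> t s /ltW ht; exact: hG.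
Qed.

Lemma cint_ge_sub (f : R -> R) (al be m : R) : continuous f -> (forall t, 0 <= f t) ->
  0 <= al -> al <= be -> be <= 2 * pi -> (forall t, al <= t <= be -> m <= f t) ->
  m * (be - al) <= cint f.
Proof.
move=> cf f0 a0 ab bp hm.
have [F hF] := @antiderivative R f (-1) (2 * pi + 1) cf.
have p0 := pi_gt0 R.
have D t : 0 <= t <= 2 * pi -> is_derive t 1 F (f t).
  by move=> /andP[t0 tp]; apply: hF; apply/andP; split; lra.
rewrite (cint_deriv cf D).
have h1 : F 0 <= F al.
  apply: (derive_ge0_le a0) => t /andP[t0 ta]; [apply: D|exact: f0].
  by rewrite t0 (le_trans ta)// (le_trans ab).
have h2 : F be <= F (2 * pi).
  apply: (derive_ge0_le bp) => t /andP[tb tp]; [apply: D|exact: f0].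
  by rewrite tp andbT (le_trans a0)// (le_trans ab).
have h3 : F al - m * al <= F be - m * be.
  apply: (@derive_ge0_le _ (fun t => F t - m * t) (fun t => f t - m) al be ab) => t ht.
    have Dt : is_derive t 1 F (f t).
      by apply: D; case/andP: ht => h4 h5; rewrite (le_trans a0 h4) (le_trans h5 bp).
    by der_by; ring.
  by rewrite subr_ge0 hm.
rewrite mulrBr; lra.
Qed.

Lemma C1_glue A B g : open B -> C1 A g -> (forall x, B x -> g x = 0) ->
  (forall x, A x \/ B x) -> C1 setT g.
Proof.
move=> oB cA g0 AB x _; have [Ax|Bx] := AB x; first exact: cA.
have cB : C1 B g by apply: (C1_eq oB _ (C1_cst 0 oB)) => y /g0.
exact: cB.
Qed.

Lemma ramp_lip M (x y : R) : `|ramp M x - ramp M y| <= 2 * `|x - y|.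
Proof.
wlog xy : x y / y < x => [hw|].
  have [xy|yx] := leP x y; last exact: hw.
  move: xy; rewrite le_eqVlt => /predU1P[->|xy]; first by rewrite !subrr normr0 mulr0.
  by rewrite distrC [`|x - y|]distrC; exact: hw.
have [z _ ->] := MVT_closed xy (fun t _ => der_ramp M t).
have /andP[d0 d2] := dramp_itv M z.
by rewrite normrM (ger0_norm d0) ler_wpM2r.
Qed.

Lemma subr_shuffle (p q r s p' q' : R) :
  p - (r + p') <= q - (s + q') -> p - q <= r - s + (p' - q').
Proof. lra. Qed.

Local Opaque ramp dramp.

Section TruncatedFlow.
Variables (A B : set 'rV[R]_2) (w Zx Zy : 'rV[R]_2 -> R) (sg : R) (a : 'rV[R]_2).
Hypotheses (P : mpair A w Zx Zy 1) (w_cts : continuous w) (oB : open B).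
Hypotheses (AB : forall x, A x \/ B x) (wB : forall x, B x -> w x <= sg).

Let oA : open A := mp_open P.
Let cw : C1 A w := mp_v P.
Let cZx : C1 A Zx := mp_Z0 P.
Let cZy : C1 A Zy := mp_Z1 P.

Lemma C1_ramp : C1 A (fun x => ramp sg (w x)).
Proof.
apply: (@C1_comp R A (ramp sg) (dramp sg) w oA cw).
  by move=> x _; exact: der_ramp.
by move=> x _; exact: cts_dramp.
Qed.
Let cT := C1_ramp.

Let B0 x : B x -> ramp sg (w x) = 0 /\ dramp sg (w x) = 0.
Proof.
by move=> /wB Bx; rewrite ramp_le0// dramp_le0.
Qed.

Lemma truncated_edens_ge0 x : 0 <= dramp sg (w x) * edens w Zx Zy x.
Proof.
have [Ax|/B0[_ ->]] := AB x; last by rewrite mul0r.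
apply: mulr_ge0; last exact: edens_ge0 P Ax.
by have /andP[] := dramp_itv sg (w x).
Qed.

Lemma truncated_edens_cts : continuous (fun x => dramp sg (w x) * edens w Zx Zy x).
Proof.
move=> x; have [Ax|Bx] := AB x.
  have c0 := C1_pd (b := false) cw Ax; have c1 := C1_pd (b := true) cw Ax.
  have c2 := C1_cts cZx Ax; have c3 := C1_cts cZy Ax.
  have c4 : continuous_at x (fun x => dramp sg (w x)).
    by apply: (@cts_comp _ _ (dramp sg) w); [exact: w_cts|exact: cts_dramp].
  by rewrite /edens; cts.
apply: (@cts_open R (fun=> 0) _ B) => //; last exact: cts_cst.
by move=> y /B0[_ ->]; rewrite mul0r.
Qed.

(** Holds for every t, circles through singular points included: near such points T(w) vanishes, and
    the field is continued by 0. *)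
Lemma der_truncated_flux t : is_derive t 1 (tflux w Zx Zy sg a)
  (tenergy w Zx Zy sg a t).
Proof.
have cY Z : C1 A Z -> C1 setT (fun x => ramp sg (w x) * Z x).
  move=> cZ; apply: (C1_glue oB (C1_mul oA cT cZ) _ AB) => x /B0[-> _]; exact: mul0r.
have D := @der_flux R _ _ setT a t 1 openT (cY _ cZx) (cY _ cZy) ltr01 (fun _ _ _ => I).
apply: (der_eq D); congr cint; apply/funext => s; congr (_ * _).
move: (pol a t s) => x; have [Ax|Bx] := AB x.
  have dw := C1_diff cw Ax; have dT := C1_diff cT Ax.
  have dZx := C1_diff cZx Ax; have dZy := C1_diff cZy Ax.
  rewrite !pd_mul//; have E b := pd_comp b (der_ramp sg (w x)) dw.
  rewrite !E; have e := mp_div P Ax.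
  rewrite [LHS](_ : _ = dramp sg (w x) * edens w Zx Zy x + ramp sg (w x) *
    (px Zx x + py Zy x)); first by rewrite e mulr0 addr0.
  by rewrite /edens; ring.
have z b Z : pd b (fun x => ramp sg (w x) * Z x) x = 0.
  have E : forall y, B y -> ramp sg (w y) * Z y = 0 by move=> y /B0[-> _]; rewrite mul0r.
  by rewrite (near_pd b oB Bx E) pd_cst.
by rewrite !z (B0 Bx).2 mul0r addr0.
Qed.

Let psi t := cint (fun s => ramp sg (w (pol a t s))).

(** The t-derivative of T(w) is at most T'(w) (mu + e^(2t) Z.Dw / mu), by z mu <= mu^2 + z^2, and T'
    <= 2. The truncated energy integrates over [al, be] to the increase of the flux; the free
    parameter mu balances the two terms. *)
Lemma truncated_mean_le (al be mu : R) : al <= be -> 0 < mu ->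
  psi be - psi al <= 4 * pi * mu * (be - al) +
   (tflux w Zx Zy sg a be - tflux w Zx Zy sg a al) / mu.
Proof.
move=> ab mu0.
have cg : C1 setT (fun x => ramp sg (w x)).
  by apply: (C1_glue oB cT _ AB) => x /B0[].
pose dpsi t := cint (fun s => expR t * (cos s * px (fun x => ramp sg (w x)) (pol a t s) +
  sin s * py (fun x => ramp sg (w x)) (pol a t s))).
have Dpsi t : is_derive t 1 psi (dpsi t).
  exact: (@der_circle_mean _ setT a t 1 openT cg ltr01 (fun _ _ _ => I)).
have D t := der_truncated_flux t.
have c0 t : continuous (fun s => px (fun x => ramp sg (w x)) (pol a t s)).
  by apply: circle_pd cg _.
have c1 t : continuous (fun s => py (fun x => ramp sg (w x)) (pol a t s)).
  by apply: circle_pd cg _.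
have c2 t : continuous (fun s => dramp sg (w (pol a t s)) * edens w Zx Zy (pol a t s)).
  move=> s; apply: (@cts_pol_s R (fun x => dramp sg (w x) * edens w Zx Zy x)).
  exact: truncated_edens_cts.
have c3 t : continuous (fun s => expR t ^+ 2 *
    (dramp sg (w (pol a t s)) * edens w Zx Zy (pol a t s))).
  by move=> s; apply: cts_mul; [exact: cts_cst|exact: c2].
have c4 (m : R) t : continuous (fun s => m * (expR t ^+ 2 *
    (dramp sg (w (pol a t s)) * edens w Zx Zy (pol a t s)))).
  by move=> s; apply: cts_mul; [exact: cts_cst|exact: c3].
have bound t : dpsi t <= 4 * pi * mu + tenergy w Zx Zy sg a t / mu.
  have -> : 4 * pi * mu = cint (fun=> 2 * mu) by rewrite cint_cst; ring.
  rewrite [X in _ + X]mulrC /tenergy -cintZ; last exact: c3.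
  rewrite -cintD; [|by move=> s; exact: cts_cst|exact: c4].
  apply: cint_le.
  - move=> s; apply: cts_mul; first exact: cts_cst.
    have ks : continuous_at s (fun s : R => cos s) by cts.
    have kc : continuous_at s (fun s : R => sin s) by cts.
    by apply: cts_add; [exact: (cts_mul ks (c0 t s))|exact: (cts_mul kc (c1 t s))].
  - by move=> s; apply: cts_add; [exact: cts_cst|exact: c4].
  move=> s _; have cd := cos2Dsin2 s; have e0 := expR_gt0 t; move: (pol a t s) (cos s) (sin s) (expR t) cd e0 => x k l e kl e0.
  have [Ax|Bx] := AB x.
    have dw := C1_diff cw Ax.
    rewrite !(pd_comp _ (der_ramp sg (w x)) dw).
    have hD := mp_D P Ax; rewrite mul1r in hD.
    have /andP[d0 d2] := dramp_itv sg (w x).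
    move: (dramp _ _) (px w x) (py w x) (edens _ _ _ _) d0 d2 hD => T p q E d0 d2 hD.
    have -> : e * (k * (T * p) + l * (T * q)) = T * (e * (k * p + l * q)) by ring.
    have -> : 2 * mu + mu^-1 * (e ^+ 2 * (T * E)) = 2 * mu + T * (e ^+ 2 * E / mu) by ring.
    apply: (@le_trans _ _ (T * (mu + e ^+ 2 * E / mu))); last first.
      by rewrite mulrDr lerD2r ler_wpM2r// ltW.
    rewrite ler_wpM2l//.
    have hr : (k * p + l * q) ^+ 2 <= E.
      apply: le_trans hD; rewrite -[leRHS]mulr1 -kl -subr_ge0 (_ : _ - _ = (k * q - l * p) ^+ 2); last by ring.
      exact: sqr_ge0.
    rewrite -(ler_pM2r mu0) mulrDl divfK ?gt_eqF//.
    have : (e * (k * p + l * q)) ^+ 2 <= e ^+ 2 * E by rewrite exprMn ler_wpM2l// sqr_ge0.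
    move: (e * _) => z hz; have := sqr_ge0 (z - mu); have := sqr_ge0 z; have := sqr_ge0 mu.
    by rewrite sqrrB; nra.
  have z b : pd b (fun x => ramp sg (w x)) x = 0.
    have E : forall y, B y -> ramp sg (w y) = 0 by move=> y /B0[].
    by rewrite (near_pd b oB Bx E) pd_cst.
  by rewrite !z (B0 Bx).2 !mulr0 addr0 mulr0 mul0r !mulr0 addr0 mulr_ge0// ltW.
have := @derive_le0_ge R (fun t => psi t - (4 * pi * mu * t + tflux w Zx Zy sg a t / mu))
  (fun t => dpsi t - (4 * pi * mu + tenergy w Zx Zy sg a t / mu)) al be ab.
have hh : forall t, al <= t <= be -> is_derive t 1 (fun t => psi t - (4 * pi * mu * t + tflux w Zx Zy sg a t / mu)) (dpsi t - (4 * pi * mu + tenergy w Zx Zy sg a t / mu)).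
  by move=> t _; have d1 := Dpsi t; have d2 := D t; der_by; ring.
move=> /(_ hh) h; have : forall t, al <= t <= be -> dpsi t - (4 * pi * mu + tenergy w Zx Zy sg a t / mu) <= 0.
  by move=> t _; rewrite subr_le0.
move=> /h; rewrite mulrBl mulrBr; clear.
exact: subr_shuffle.
Qed.

End TruncatedFlow.

(** * The truncated difference of two graphs *)

Section Pair.
Variables (n : nat) (u v : 'rV[R]_2 -> R) (sg : R) (a : 'rV[R]_2).
Hypotheses (hu : in_Gn n u) (hv : in_Gn n v).
Let w x := u x - v x.
Let Z b x := flow b u x - flow b v x.
Hypothesis hs : forall p, singular_set u p \/ singular_set v p -> w p < sg.
Let A := ~` singular_set u `&` ~` singular_set v.
Let B := [set x | w x < sg].

Lemma diff_cts : continuous w.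
Proof.
move=> x; apply: cts_add; first exact: (Gn_cts hu).
apply: cts_opp; exact: (Gn_cts hv).
Qed.

Lemma diff_open : open B.
Proof.
rewrite (_ : B = w @^-1` [set z | z < sg])//.
by apply: open_comp; [move=> x _; exact: diff_cts|exact: open_lt].
Qed.

Lemma diff_cover x : A x \/ B x.
Proof.
have [su|su] := pselect (singular_set u x); first by right; apply: hs; left.
have [sv|sv] := pselect (singular_set v x); first by right; apply: hs; right.
by left; exact: (conj su sv).
Qed.

Lemma diff_mpair : mpair A w (Z false) (Z true) 1.
Proof.
have mu' := Gn_mgraph hu; have mv' := Gn_mgraph hv.
have oA : open A by exact: openI (mg_open mu') (mg_open mv').
by apply: mgraph_diff; [apply: mgraph_sub mu' => // x []|apply: mgraph_sub mv' => // x []].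
Qed.

(** The truncated flux is nondecreasing, so it is bounded by its values far out. There w is nearly
    constant on circles, T(w) is nearly a number T0 in [0, 1], and the flux of Z is 2 pi times the
    difference of the growths. *)
Lemma close_flux_le t : tflux w (Z false) (Z true) sg a t <=
  2 * pi * `|log_growth u - log_growth v|.
Proof.
have mu' := Gn_mgraph hu; have mv' := Gn_mgraph hv.
have wB x : B x -> w x <= sg by exact: ltW.
have dtf := der_truncated_flux a diff_mpair diff_open diff_cover wB.
have cT := C1_ramp sg diff_mpair.
have mono t1 t2 : t1 <= t2 -> tflux w (Z false) (Z true) sg a t1 <= tflux w (Z false) (Z true) sg a t2.
  move=> h; apply: (derive_ge0_le h (fun t _ => dtf t)) => r _.
  apply: cint_ge0 => s; apply: mulr_ge0; first exact: sqr_ge0.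
  exact: (truncated_edens_ge0 diff_mpair diff_cover wB).
have [b [C [T [f1 _ a1]]]] := Gn_asym a hu.
have [b' [C' [T' [f1' _ a1']]]] := Gn_asym a hv.
apply/ler_addgt0Pl => e e0; rewrite addrC.
(* [ramp] is 2-Lipschitz and each expansion is used at two points, so T(w) varies by at most D
   e^(-t) on the circle; with |Z| <= m, the error 2 pi e^t (D e^(-t)) m is e. *)
pose D := 4 * (`|C| + `|C'|) + 1.
have D0 : 0 < D by rewrite /D ltr_wpDl// mulr_ge0// addr_ge0.
have p2 : 0 < 2 * pi :> R by rewrite mulr_gt0// pi_gt0.
have [m em m0] : exists2 m, m = e / (2 * pi * D) & 0 < m.
  by exists (e / (2 * pi * D)) => //; rewrite divr_gt0// mulr_gt0.
(* Squared slopes below q <= 1/6 give |W(Du)|^2 <= 2q for each graph, hence |Z|^2 <= 8q <= m^2. *)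
pose q := Num.min (1 / 6) (m ^+ 2 / 8).
have q0 : 0 < q by rewrite lt_min divr_gt0//= divr_gt0// exprn_gt0.
have [M M0 hM] := Gn_infinity hu q0; have [M' M'0 hM'] := Gn_infinity hv q0.
pose t2 := Num.max t (Num.max (Num.max T T') (Num.max (ln (M + enorm a)) (ln (M' + enorm a)))) + 1.
have [k1 k2 k3 k4 k5] : [/\ t <= t2, T < t2, T' < t2, ln (M + enorm a) < t2 & ln (M' + enorm a) < t2].
  rewrite /t2; split; [apply: ltW|..]; by rewrite ltr_pwDr// !le_max lexx ?orbT.
have hx s := pol_far M0 s k4; have hx' s := pol_far M'0 s k5.
have At s : A (pol a t2 s) by split; [exact: (hM _ (hx s)).1|exact: (hM' _ (hx' s)).1].
apply: (le_trans (mono _ _ k1)).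
have cT2 := circle_cts cT At; have cz0 := circle_cts (mp_Z0 diff_mpair) At; have cz1 := circle_cts (mp_Z1 diff_mpair) At.
set T0 := ramp sg (w (pol a t2 0)).
have fZ : flux (Z false) (Z true) a t2 = 2 * pi * (log_growth u - log_growth v).
  rewrite (@flux_sub R A) ?f1 ?f1' ?mulrBr//.
  - by apply: C1_sub (C1_flow mu' _) => x [].
  - by apply: C1_sub (C1_flow mu' _) => x [].
  - by apply: C1_sub (C1_flow mv' _) => x [].
  - by apply: C1_sub (C1_flow mv' _) => x [].
have split2 : tflux w (Z false) (Z true) sg a t2 = T0 * flux (Z false) (Z true) a t2 +
    flux (fun x => (ramp sg (w x) - T0) * Z false x) (fun x => (ramp sg (w x) - T0) * Z true x) a t2.
  rewrite /tflux /flux -cintZ; last by move=> s; cts.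
  rewrite -cintD; [|by move=> s; cts|by move=> s; cts].
  by congr cint; apply/funext => s; ring.
rewrite split2 fZ; apply: lerD.
  rewrite mulrCA ler_pM2l//; apply: le_trans (ler_norm _) _; rewrite normrM.
  have /andP[i0 i1] := ramp_itv sg (w (pol a t2 0)).
  by rewrite -/T0 in i0 i1; rewrite (ger0_norm i0) ler_piMl.
apply: le_trans (ler_norm _) _.
have ee : e = 2 * pi * expR t2 * (D * expR (- t2) * m).
  have := expRxMexpNx_1 t2; rewrite em => ex.
  transitivity (expR t2 * expR (- t2) * (2 * pi * D) * (e / (2 * pi * D))).
    by rewrite ex mul1r mulrC divfK// gt_eqF// mulr_gt0.
  by move: (e / _) (expR t2) (expR (- t2)); move: (@pi R) => p i j k; ring.
rewrite [leRHS]ee; apply: flux_bound.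
- apply: mulr_ge0; last exact: ltW.
  by apply: mulr_ge0; [exact: ltW|exact: expR_ge0].
- by move=> s; cts.
- by move=> s; cts.
move=> s; rewrite !exprMn -mulrDr.
apply: ler_pM; rewrite ?sqr_ge0 ?addr_ge0 ?sqr_ge0//.
  rewrite -exprMn -[leLHS]real_normK ?num_real// ler_sqr ?nnegrE ?mulr_ge0 ?expR_ge0 ?(ltW D0)//.
  apply: (le_trans (ramp_lip _ _ _)).
  have := a1 t2 s k2; have := a1 t2 0 k2; have := a1' t2 s k3; have := a1' t2 0 k3.
  rewrite /graph_gap !catenoid_pol /w; set c1 := log_growth u * _; set c2 := log_growth v * _.
  have Ce : C * expR (- t2) <= `|C| * expR (- t2) by rewrite ler_wpM2r ?expR_ge0 ?ler_norm.
  have Ce' : C' * expR (- t2) <= `|C'| * expR (- t2) by rewrite ler_wpM2r ?expR_ge0 ?ler_norm.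
  have E0 := expR_ge0 (- t2).
  rewrite /D mulrDl mulrDr mul1r.
  move: (u _) (u _) (v _) (v _) => u1 u2 v1 v2.
  rewrite !ler_norml => /andP[? ?] /andP[? ?] /andP[? ?] /andP[? ?].
  suff : `|u1 - v1 - (u2 - v2)| <= 2 * (`|C| * expR (- t2) + `|C'| * expR (- t2)) by lra.
  by rewrite ler_norml; apply/andP; split; lra.
have [_ su] := hM _ (hx s); have [_ sv] := hM' _ (hx' s).
have q6 : q <= 1 / 6 by rewrite /q ge_min lexx.
have q8 : q <= m ^+ 2 / 8 by rewrite /q ge_min lexx orbT.
have fl f : slope2 f (pol a t2 s) < q -> flow false f (pol a t2 s) ^+ 2 + flow true f (pol a t2 s) ^+ 2 <= 2 * q.
  move=> sf; have s1 : slope2 f (pol a t2 s) < 1 by lra.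
  have [g0 g1] := iw_prop s1; have sl0 := slope2_ge0 f (pol a t2 s).
  rewrite /flow !exprMn -mulrDl -/(slope2 f (pol a t2 s)) mulrC.
  move: (slope2 _ _) (iw _ _ ^+ 2) sf s1 g1 sl0 => z g sf s1 g1 sl0.
  have g2 : g <= 2 by nra.
  have g0' : 0 <= g by nra.
  by apply: ler_pM => //; exact: ltW.
have := fl u su; have := fl v sv; rewrite /Z.
move: (flow false u _) (flow true u _) (flow false v _) (flow true v _) => p1 p2' p3 p4 h1 h2.
have := sqr_ge0 (p1 + p3); have := sqr_ge0 (p2' + p4); lra.
Qed.

End Pair.

End Comparison.

(** * Uniform estimates for pairs of graphs *)

Section Estimates.
Variable R : realType.
Implicit Types (u v w : 'rV[R]_2 -> R) (a x p : 'rV[R]_2)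
  (t s r c e sg rh M : R).

Lemma sincos_lip s s' : `|cos s - cos s'| <= `|s - s'| /\ `|sin s - sin s'| <= `|s - s'|.
Proof.
wlog ss : s s' / s' < s => [hw|].
  have [h|h] := leP s s'; last exact: hw.
  move: h; rewrite le_eqVlt => /predU1P[->|h]; first by rewrite !subrr normr0.
  by have [h1 h2] := hw _ _ h; rewrite distrC [`|s - s'|]distrC [`|sin s - _|]distrC.
have Dc t : s' <= t <= s -> is_derive t 1 (fun t : R => cos t) (- sin t).
  by move=> _; der_by; ring.
have Ds t : s' <= t <= s -> is_derive t 1 (fun t : R => sin t) (cos t).
  by move=> _; der_by; ring.
have [z _ ->] := MVT_closed ss Dc; have [z' _ ->] := MVT_closed ss Ds.
split; rewrite normrM ler_piMl//; first by rewrite normrN ler_norml sin_geN1 sin_le1.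
by rewrite ler_norml cos_geN1 cos_le1.
Qed.

Lemma chord_le a t s s' : enorm (pol a t s - pol a t s') <= 2 * expR t * `|s - s'|.
Proof.
have [h1 h2] := sincos_lip s s'.
rewrite enorm_le ?mulr_ge0 ?expR_ge0//.
have E b : (pol a t s - pol a t s') 0 b = pol a t s 0 b - pol a t s' 0 b by rewrite !mxE.
rewrite !E !polE0 !polE1.
have -> : a 0 0 + expR t * cos s - (a 0 0 + expR t * cos s') = expR t * (cos s - cos s') by ring.
have -> : a 0 1 + expR t * sin s - (a 0 1 + expR t * sin s') = expR t * (sin s - sin s') by ring.
have k (z : R) : `|z| <= `|s - s'| -> z ^+ 2 <= (s - s') ^+ 2.
  by move=> hz; rewrite -[leLHS]real_normK ?num_real// -[leRHS]real_normK ?num_real// ler_sqr ?nnegrE.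
have := k _ h1; have := k _ h2; rewrite !exprMn real_normK ?num_real//.
have := sqr_ge0 (expR t); have := sqr_ge0 (s - s').
move: (expR t ^+ 2) ((s - s') ^+ 2) ((cos s - cos s') ^+ 2) ((sin s - sin s') ^+ 2).
move=> e d p q d0 e0 hp hq; rewrite -mulrDr.
have := ler_wpM2l e0 (lerD hp hq); have := mulr_ge0 e0 d0; lra.
Qed.

(* The truncated difference has small energy when the logarithmic growths are
   close, and a large value would force a large circle mean. *)
Lemma close_bound sg rh : 0 < sg -> 0 < rh -> exists2 d : R, 0 < d &
  forall n u v a, in_Gn n u -> in_Gn n v ->
  (forall p, singular_set u p \/ singular_set v p -> u p - v p < sg) ->
  u a - v a <= sg / 2 -> `|log_growth u - log_growth v| <= d ->
  forall x, enorm (x - a) <= rh -> u x - v x <= 2 * sg.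
Proof.
move=> sg0 rh0; have p0 : 0 < pi :> R by exact: pi_gt0.
(* If w > 2 sg at a point, then w >= 3/2 sg on an arc of angle h ending there, as w is 2-Lipschitz;
   there T(w) >= tau, so the circle integral of T(w) is at least ka = tau h. *)
have [tau tauE tau0] : exists2 tau, tau = ramp sg (3 / 2 * sg) & 0 < tau.
  exists (ramp sg (3 / 2 * sg)) => //; rewrite lt_neqAle.
  have /andP[-> _] := ramp_itv sg (3 / 2 * sg); rewrite andbT.
  by apply/eqP => /esym/ramp_eq0; lra.
have [h [h0 h1 h2]] : exists h, [/\ 0 < h, h <= sg / (8 * rh) & h <= pi].
  exists (Num.min (sg / (8 * rh)) pi); split; rewrite ?ge_min ?lexx ?orbT//.
  by rewrite lt_min p0 andbT divr_gt0// mulr_gt0.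
have [ka kaE ka0] : exists2 ka, ka = tau * h & 0 < ka by exists (tau * h); rewrite ?mulr_gt0.
have [D D1 D2] : exists2 D, 0 < D & ln rh - ln (sg / 4) <= D.
  exists (`|ln rh - ln (sg / 4)| + 1); first by rewrite ltr_wpDl.
  by apply: le_trans (ler_norm _) _; rewrite lerDl.
(* [D] bounds the range of the logarithm of the radius; [m] and the bound on the growths make each
   of the two terms of [truncated_mean_le] at most ka / 4. *)
have [m mE m0] : exists2 m, m = ka / (16 * pi * D) & 0 < m.
  by exists (ka / (16 * pi * D)); rewrite ?divr_gt0// !mulr_gt0.
exists (ka * m / (8 * pi)); first by rewrite !divr_gt0// ?mulr_gt0.
move=> n u v a hu hv hs wa hd x xr; rewrite leNgt; apply/negP => wx.
have wl y z : u y - v y <= u z - v z + 2 * enorm (y - z).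
  have := Gn_lipw hu z y; have := Gn_lipw hv z y; rewrite !ler_norml => /andP[? ?] /andP[? ?].
  by lra.
have r1 := wl x a; have r2 : sg / 4 < enorm (x - a) by lra.
have sg4 : 0 < sg / 4 by rewrite divr_gt0.
have r0 : 0 < enorm (x - a) by exact: lt_trans r2.
have xa : x != a by rewrite -subr_eq0 -enorm_gt0.
have [s0 /andP[s00 s01] ex] := polP xa; set t0 := ln _ in ex.
have et0 : expR t0 = enorm (x - a) by rewrite lnK ?posrE.
have tt : ln (sg / 4) <= t0 by rewrite ler_ln ?posrE// ltW.
have hB : forall y, [set y | u y - v y < sg] y -> u y - v y <= sg by move=> y /ltW.
(* On the circle of radius sg / 4 the truncation vanishes: w <= sg / 2 at the centre and w is
   2-Lipschitz. *)
have ini s : u (pol a (ln (sg / 4)) s) - v (pol a (ln (sg / 4)) s) <= sg.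
  have := wl (pol a (ln (sg / 4)) s) a; rewrite enorm_pol lnK ?posrE//; lra.
have := truncated_mean_le a (diff_mpair hu hv) (diff_cts hu hv) (@diff_open R n u v sg hu hv) (diff_cover hs) hB tt m0.
rewrite (tflux_le0 (v := fun y => u y - v y) _ _ ini) subr0.
rewrite (_ : cint (fun s => ramp sg (u (pol a (ln (sg / 4)) s) - v (pol a (ln (sg / 4)) s))) = 0); last first.
  rewrite (_ : (fun s => _) = fun=> 0) ?cint_cst ?mul0r//.
  by apply/funext => s; rewrite ramp_le0.
rewrite subr0 leNgt => /negP; apply.
have low : ka <= cint (fun s => ramp sg (u (pol a t0 s) - v (pol a t0 s))).
  have cf : continuous (fun s => ramp sg (u (pol a t0 s) - v (pol a t0 s))).
    move=> s; apply: (@cts_comp _ _ (ramp sg)); last exact: cts_ramp.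
    apply: (@cts_pol_s R (fun y => u y - v y)); exact: diff_cts hu hv _.
  have f0 s : 0 <= ramp sg (u (pol a t0 s) - v (pol a t0 s)) by have /andP[] := ramp_itv sg (u (pol a t0 s) - v (pol a t0 s)).
  have near s : `|s - s0| <= h -> tau <= ramp sg (u (pol a t0 s) - v (pol a t0 s)).
    move=> hss; rewrite tauE /ramp; apply: sstep_mono; rewrite lerD2r.
    have w1 := wl x (pol a t0 s).
    have := chord_le a t0 s0 s; rewrite -ex distrC et0 => w2.
    have w3 : 2 * enorm (x - a) * `|s - s0| <= sg / 4.
      apply: (@le_trans _ _ (2 * rh * (sg / (8 * rh)))); last first.
        by rewrite le_eqVlt; apply/orP; left; apply/eqP; field; rewrite gt_eqF.
      by apply: ler_pM; rewrite ?mulr_ge0 ?enorm_ge0// ?ler_pM2l//; apply: le_trans h1.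
    by lra.
  (* The arc is taken on the side of s0 that stays in [0, 2 pi]. *)
  have [sp|/ltW sp] := leP s0 pi.
    have := @cint_ge_sub R _ s0 (s0 + h) tau cf f0 s00 _ _ _.
    rewrite addrAC subrr add0r kaE; apply.
    - by rewrite lerDl ltW.
    - by lra.
    - by move=> t /andP[ta tb]; apply: near; rewrite ler_norml; apply/andP; split; lra.
  have := @cint_ge_sub R _ (s0 - h) s0 tau cf f0 _ _ s01 _.
  rewrite opprB addrCA subrr addr0 kaE; apply.
  - by lra.
  - by rewrite gerBl ltW.
  - by move=> t /andP[ta tb]; apply: near; rewrite ler_norml; apply/andP; split; lra.
apply: lt_le_trans low.
have b1 : 4 * pi * m * (t0 - ln (sg / 4)) <= ka / 4.
  apply: (@le_trans _ _ (4 * pi * m * D)).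
    rewrite ler_wpM2l ?mulr_ge0 ?(ltW m0) ?(ltW p0)//; apply: le_trans D2.
    by rewrite lerD2r ler_ln ?posrE.
  have gen (q : R) : 0 < q -> 4 * q * (ka / (16 * q * D)) * D = ka / 4.
    by move=> q0; field; rewrite !gt_eqF.
  by rewrite mE gen.
have b2 : tflux (fun y => u y - v y) (fun y => flow false u y - flow false v y)
    (fun y => flow true u y - flow true v y) sg a t0 / m <= ka / 4.
  rewrite ler_pdivrMr//; apply: le_trans (close_flux_le a hu hv hs t0) _.
  apply: (@le_trans _ _ (2 * pi * (ka * m / (8 * pi)))).
    by rewrite ler_wpM2l// mulr_ge0// ltW.
  have gen (q : R) : 0 < q -> 2 * q * (ka * m / (8 * q)) = ka / 4 * m.
    by move=> q0; field; rewrite !gt_eqF.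
  by rewrite gen.
apply: (le_lt_trans (lerD b1 b2)); lra.
Qed.

Definition catenoid_log c t : R := c * ln (expR t + Num.sqrt (expR t ^+ 2 + c ^+ 2)).

Lemma catenoid_log_close c t : 0 <= t -> `|catenoid_log c t - c * t| <= `|c| * (1 + `|c|).
Proof.
move=> t0; have e0 := expR_gt0 t; have e1 : 1 <= expR t by rewrite -[leLHS]expR0 ler_expR.
rewrite /catenoid_log -mulrBr normrM ler_wpM2l//.
have n1 : expR t <= Num.sqrt (expR t ^+ 2 + c ^+ 2).
  by rewrite -[leLHS]gtr0_norm// -sqrtr_sqr ler_wsqrtr// lerDl sqr_ge0.
have n2 : Num.sqrt (expR t ^+ 2 + c ^+ 2) <= expR t + `|c|.
  rewrite -[leRHS]ger0_norm ?addr_ge0 ?(ltW e0)// -sqrtr_sqr ler_wsqrtr//.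
  rewrite sqrrD real_normK ?num_real//.
  by have := mulr_ge0 (ltW e0) (normr_ge0 c); lra.
set N := expR t + _; have N0 : 0 < N by rewrite /N; lra.
have nc := normr_ge0 c.
have -> : ln N - t = ln (N / expR t) by rewrite ln_div ?posrE// expRK.
have q1 : 1 <= N / expR t by rewrite ler_pdivlMr// mul1r /N; lra.
rewrite ger0_norm; last exact: ln_ge0.
have := @le_ln1Dx R (N / expR t - 1); rewrite subrKC => hl.
apply: le_trans (hl _) _; first by lra.
rewrite lerBlDr ler_pdivrMr// /N.
have := ler_wpM2l nc e1; lra.
Qed.

(** The derivative c e^t / sqrt(e^(2t) + c^2) is nondecreasing in c. *)
Lemma catenoid_log_mono c c' r t : c <= c' -> r <= t -> catenoid_log c t - catenoid_log c r <= catenoid_log c' t - catenoid_log c' r.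
Proof.
move=> cc rt.
have D (k x0 : R) : is_derive x0 1 (catenoid_log k) (k * expR x0 / Num.sqrt (expR x0 ^+ 2 + k ^+ 2)).
  have e0 := expR_gt0 x0; have p0 : 0 < expR x0 ^+ 2 + k ^+ 2 by rewrite ltr_pwDl ?sqr_ge0 ?exprn_gt0.
  have s0 : 0 < Num.sqrt (expR x0 ^+ 2 + k ^+ 2) by rewrite sqrtr_gt0.
  have D1 : is_derive x0 1 (fun z : R => expR z ^+ 2 + k ^+ 2) (2 * expR x0 ^+ 2) by der_by; ring.
  have D0 : is_derive x0 1 (fun z : R => expR z) (expR x0) by der_by; ring.
  have D2 := der_mul (der_cst k x0) (der_ln (der_add D0 (der_sqrt D1 p0)) (addr_gt0 e0 s0)).
  apply: (der_eq D2); rewrite mul0r add0r.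
  move: (Num.sqrt _) s0 => q s0; field.
  by rewrite !gt_eqF//= addr_gt0.
have inc A : 0 < A -> c / Num.sqrt (A + c ^+ 2) <= c' / Num.sqrt (A + c' ^+ 2).
  move=> A0; have p k : 0 < Num.sqrt (A + k ^+ 2) by rewrite sqrtr_gt0 ltr_pwDl// sqr_ge0.
  have sq k : Num.sqrt (A + k ^+ 2) ^+ 2 = A + k ^+ 2 by rewrite sqr_sqrtr// addr_ge0 ?sqr_ge0// ltW.
  rewrite ler_pdivrMr// mulrAC ler_pdivlMr//.
  have pc := p c; have pc' := p c'; have sc := sq c; have sc' := sq c'.
  move: (Num.sqrt _) (Num.sqrt _) pc pc' sc sc' => q' q q0 q0' hq hq'.
  have k0 : (c * q') ^+ 2 - (c' * q) ^+ 2 = A * (c - c') * (c + c').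
    by rewrite !exprMn hq hq'; ring.
  have [c0|c0] := leP 0 c.
    have c0' : 0 <= c' by exact: le_trans cc.
    rewrite -ler_sqr ?nnegrE ?mulr_ge0 ?(ltW q0) ?(ltW q0')// -subr_le0 k0.
    by rewrite mulr_le0_ge0 ?addr_ge0// mulr_ge0_le0 ?(ltW A0)// subr_le0.
  have [c1|c1] := leP 0 c'.
    by apply: (@le_trans _ _ 0); [rewrite mulr_le0_ge0// ltW|rewrite mulr_ge0// ltW].
  rewrite -lerN2 -!mulNr -ler_sqr ?nnegrE ?mulr_ge0 ?oppr_ge0 ?(ltW q0) ?(ltW q0') ?(ltW c0) ?(ltW c1)//.
  rewrite !mulNr !sqrrN -subr_ge0 k0 -mulrA mulr_ge0 ?(ltW A0)//.
  by rewrite mulr_le0 ?subr_le0//; lra.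
have := @derive_ge0_le R (fun z => catenoid_log c' z - catenoid_log c z) (fun z =>
  c' * expR z / Num.sqrt (expR z ^+ 2 + c' ^+ 2) - c * expR z / Num.sqrt (expR z ^+ 2 + c ^+ 2)) r t rt.
have DD z : r <= z <= t -> is_derive z 1 (fun z => catenoid_log c' z - catenoid_log c z)
    (c' * expR z / Num.sqrt (expR z ^+ 2 + c' ^+ 2) - c * expR z / Num.sqrt (expR z ^+ 2 + c ^+ 2)).
  by move=> _; have h1 := D c' z; have h2 := D c z; exact: (der_add h1 (der_opp h2)).
move=> /(_ DD) h; suff : catenoid_log c' r - catenoid_log c r <= catenoid_log c' t - catenoid_log c t by lra.
apply: h => z _; rewrite subr_ge0 mulrAC [leRHS]mulrAC ler_wpM2r ?expR_ge0//.
by apply: inc; rewrite exprn_gt0// expR_gt0.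
Qed.

(** Capitals are values at time t, small letters at time r: U of u, V of u0, and P, P0, Q of the
    catenoids with growths [log_growth u], c0 and c0 - e. E is e^r, while ct and et stand for c0 t
    and e t. In the companion lemma Q belongs to c0 + e. *)
Lemma growth_alg_lo (P p P0 p0 Q q U u V v E ct et n0 n1 m : R) : P - p <= Q - q ->
  4 * E + 2 + m + n0 + n1 < et -> -1 <= U - V -> u - v <= 1 ->
  U - u - (P - p) <= 2 * E -> - (2 * E) <= V - v - (P0 - p0) ->
  Q - (ct - et) <= n1 -> - n0 <= P0 - ct -> p0 - q <= m -> False.
Proof. lra. Qed.

Lemma growth_alg_hi (P p P0 p0 Q q U u V v E ct et n0 n1 m : R) : Q - q <= P - p ->
  4 * E + 2 + m + n0 + n1 < et -> U - V <= 1 -> -1 <= u - v ->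
  - (2 * E) <= U - u - (P - p) -> V - v - (P0 - p0) <= 2 * E ->
  - n1 <= Q - (ct + et) -> P0 - ct <= n0 -> q - p0 <= m -> False.
Proof. lra. Qed.

(** Outside a disc both graphs follow their catenoids up to 2 e^r, by [Gn_osc], uniformly in u. If
    the growths differed by more than e, the catenoids would separate by about e t between r and t,
    which for t > B / e exceeds the errors collected in [B]. *)
Lemma growth_close c0 M e : 0 < M -> 0 < e -> exists T : R, forall n u u0,
  in_Gn n u -> in_Gn n u0 -> log_growth u0 = c0 ->
  (forall x, M < enorm x -> ~ singular_set u x /\ ~ singular_set u0 x) ->
  (forall x, enorm x <= T -> `|u x - u0 x| <= 1) -> `|log_growth u - c0| <= e.
Proof.
move=> M0 e0; pose r := Num.max (ln M + 1) 0.
have Mr : M < expR r.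
  by rewrite -[ltLHS]lnK ?posrE// ltr_expR /r lt_max ltrDl ltr01.
have r0 : 0 <= r by rewrite /r le_max lexx orbT.
pose N c := `|c| * (1 + `|c|).
pose B := 4 * expR r + 2 + `|catenoid_log (c0 + e) r - catenoid_log c0 r| + `|catenoid_log c0 r - catenoid_log (c0 - e) r| +
  N c0 + N (c0 + e) + N (c0 - e).
have N0 c : 0 <= N c by rewrite mulr_ge0// addr_ge0.
pose t := Num.max r (B / e + 1).
have rt : r <= t by rewrite le_max lexx.
have t0 : 0 <= t by exact: le_trans rt.
have te : B < e * t.
  rewrite mulrC -ltr_pdivrMr//; apply: (@lt_le_trans _ _ (B / e + 1)); first by rewrite ltrDl.
  by rewrite le_max lexx orbT.
exists (expR t) => n u u0 hu hu0 hc hM hT.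
have osc f (hf : in_Gn n f) : (forall x, M < enorm x -> ~ singular_set f x) ->
    `|f (pol 0 t 0) - f (pol 0 r 0) - (catenoid_log (log_growth f) t - catenoid_log (log_growth f) r)| <= 2 * expR r.
  move=> hMf; have hM' x : M < enorm (x - 0) -> ~ singular_set f x by rewrite subr0; exact: hMf.
  have := Gn_osc hf M0 hM' Mr 0 rt; rewrite /graph_gap !catenoid_pol -!/(catenoid_log _ _) => hh.
  by rewrite (_ : _ - _ = f (pol 0 t 0) - catenoid_log (log_growth f) t - (f (pol 0 r 0) - catenoid_log (log_growth f) r)); last by ring.
have o1 := osc u hu (fun x h => (hM x h).1); have o2 := osc u0 hu0 (fun x h => (hM x h).2).
have n1 z : enorm (pol 0 z 0 : 'rV[R]_2) = expR z by have := enorm_pol (0 : 'rV[R]_2) z 0; rewrite subr0.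
have d1 := hT (pol 0 t 0); have d2 := hT (pol 0 r 0); rewrite !n1 in d1 d2.
move: {d1 d2} (d1 (lexx _)) (d2 (ltac:(by rewrite ler_expR))) o1 o2; rewrite hc.
set c := log_growth u; rewrite !ler_norml.
move=> /andP[d1 d2] /andP[d3 d4] /andP[w1 w2] /andP[w3 w4].
have := catenoid_log_close c0 t0; have := catenoid_log_close (c0 + e) t0; have := catenoid_log_close (c0 - e) t0.
rewrite -!/(N _) !ler_norml => /andP[k1 k2] /andP[k3 k4] /andP[k5 k6].
have l1 := ler_norm (catenoid_log (c0 + e) r - catenoid_log c0 r).
have l2 := ler_norm (catenoid_log c0 r - catenoid_log (c0 - e) r).
have := N0 c0; have := N0 (c0 + e); have := N0 (c0 - e) => j1 j2 j3.
rewrite mulrDl in k3 k4; rewrite mulrBl in k1 k2.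
rewrite /B in te; apply/andP; split; rewrite leNgt; apply/negP => hh.
  have hc' : c <= c0 - e by clear -hh; lra.
  apply: (growth_alg_lo (catenoid_log_mono hc' rt) _ d1 d4 w2 w3 k2 k5 l2).
  by apply: le_lt_trans te; have nn := normr_ge0 (catenoid_log (c0 + e) r - catenoid_log c0 r); clear -nn j1 j2 j3; lra.
have hc' : c0 + e <= c by clear -hh; lra.
apply: (growth_alg_hi (catenoid_log_mono hc' rt) _ d2 d3 w1 w4 k3 k6 l1).
by apply: le_lt_trans te; have nn := normr_ge0 (catenoid_log c0 r - catenoid_log (c0 - e) r); clear -nn j1 j2 j3; lra.
Qed.

End Estimates.

(** * Singular points are not removable *)

Section RemovableLipschitz.
Variable R : realType.
Local Notation px := (@pd R false).
Local Notation py := (@pd R true).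
Implicit Types (u v w f g : 'rV[R]_2 -> R) (a x p h : 'rV[R]_2) (A B : set 'rV[R]_2)
  (t s r d e K M th : R).

Lemma open_eball a r : open [set x | enorm (x - a) < r].
Proof.
rewrite (_ : [set x | _] = (fun x => enorm (x - a)) @^-1` [set z | z < r])//.
apply: open_comp; last exact: open_lt.
move=> x _; apply: (@continuous_comp _ _ _ (fun x => x - a) (@enorm R)).
  by apply: (@cvgD _ _ _ (nbhs x) _ id (fun=> - a)); [exact: cvg_id|exact: cvg_cst].
exact: enorm_continuous.
Qed.

Lemma near_eball a r : 0 < r -> \forall x \near a, enorm (x - a) < r.
Proof.
move=> r0; apply: open_nbhs_nbhs; split; first exact: open_eball.
by rewrite /= subrr enorm0.
Qed.

Lemma nbhs_eball a (P : set 'rV[R]_2) : nbhs a P ->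
  exists2 r : R, 0 < r & forall x, enorm (x - a) < r -> P x.
Proof.
move=> /nbhs_ballP[r /= r0 hr]; exists r => // x xr; apply: hr.
rewrite -ball_normE /ball_/=; apply: le_lt_trans (norm_le_enorm _) _.
by rewrite enorm_dist.
Qed.

(** Z is bounded near the centre, so the truncated flux through small circles tends to 0 with their
    length; the centre itself is reached by continuity. *)
Lemma max_disc A v Zx Zy K a r (r' : R) M : mpair A v Zx Zy K -> 0 < r -> r < r' ->
  (forall x, enorm (x - a) < r' -> A x) ->
  (forall x, enorm (x - a) = r -> v x <= M) ->
  forall x, enorm (x - a) <= r -> v x <= M.
Proof.
move=> P r0 rr hA hM.
have r'0 : 0 < r' by exact: lt_trans rr.
have Aa : A a by apply: hA; rewrite subrr enorm0.
pose I := [set t : R | t < ln r'].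
have hI t s : I t -> A (pol a t s).
  by move=> It; apply: hA; rewrite enorm_pol -[ltRHS]lnK ?posrE// ltr_expR.
have cZ := C1_cts (mp_Z0 P) Aa; have cZ' := C1_cts (mp_Z1 P) Aa.
have [d d0 hd] : exists2 d : R, 0 < d & forall x, enorm (x - a) < d ->
    `|Zx x - Zx a| <= 1 /\ `|Zy x - Zy a| <= 1.
  apply: nbhs_eball; near=> x; split; rewrite distrC; near: x.
    by move/cvgrPdist_le: cZ; apply.
  by move/cvgrPdist_le: cZ'; apply.
pose m := `|Zx a| + 1 + (`|Zy a| + 1).
have m0 : 0 < m by rewrite addr_gt0// ltr_wpDl.
have punct t s : I t -> t <= ln r -> 0 <= s <= 2 * pi -> v (pol a t s) <= M.
  apply: (@tflux_max_in R A v Zx Zy K M a P I _ _ hI (ln r)).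
  - by move=> t1 t2 t3 _ h2 /andP[_ h]; exact: le_lt_trans h h2.
  - move=> t1 h1; exists ((ln r' - t1) / 2); first by rewrite divr_gt0// subr_gt0.
    move: h1; rewrite /I/= => h1.
    by move=> t2; rewrite ler_norml => /andP[_ h2]; rewrite /I/=; lra.
  - by rewrite /I/= ltr_ln ?posrE.
  - by move=> s'; apply: hM; rewrite enorm_pol lnK.
  move=> t1 e It e0.
  have [e' e'0 he'] : exists2 e', 0 < e' & e' ^+ 2 <= e.
    exists (Num.sqrt e); first by rewrite sqrtr_gt0.
    by rewrite sqr_sqrtr// ltW.
  have q0 : 0 < e' / (2 * pi * m) by rewrite divr_gt0// !mulr_gt0// pi_gt0.
  have [t2 [h1 h2 h3]] : exists t2, [/\ t2 <= t1, expR t2 < d & expR t2 <= e' / (2 * pi * m)].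
    exists (Num.min t1 (Num.min (ln (d / 2)) (ln (e' / (2 * pi * m))))); split.
    - by rewrite ge_min lexx.
    - apply: (@le_lt_trans _ _ (d / 2)); last by rewrite ltr_pdivrMr// ltr_pMr// ltr1n.
      by rewrite -[leRHS]lnK ?posrE ?divr_gt0// ler_expR !ge_min lexx !orbT.
    - by rewrite -[leRHS]lnK ?posrE// ler_expR !ge_min lexx !orbT.
  have It2 : I t2 by exact: le_lt_trans It.
  exists t2; split => //; apply: le_trans he'.
  rewrite -[leLHS]real_normK ?num_real// ler_sqr ?nnegrE ?(ltW e'0)//.
  have At s' := hI t2 s' It2.
  have cv := circle_cts (mp_v P) At; have c0 := circle_cts (mp_Z0 P) At; have c1 := circle_cts (mp_Z1 P) At.
  have cT : continuous (fun s => ramp M (v (pol a t2 s))).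
    by move=> s'; apply: (@cts_comp _ _ (ramp M)); [exact: cv|exact: cts_ramp].
  apply: (@le_trans _ _ (2 * pi * expR t2 * m)).
    apply: flux_bound; first exact: ltW.
    - by move=> s'; apply: cts_mul; [exact: cT|exact: c0].
    - by move=> s'; apply: cts_mul; [exact: cT|exact: c1].
    move=> s'; have /andP[T0 T1] := ramp_itv M (v (pol a t2 s')).
    have [|z0 z1] := hd (pol a t2 s'); first by rewrite enorm_pol.
    have n0 := ler_normD (Zx (pol a t2 s') - Zx a) (Zx a); rewrite subrK in n0.
    have n1 := ler_normD (Zy (pol a t2 s') - Zy a) (Zy a); rewrite subrK in n1.
    have b0 : `|ramp M (v (pol a t2 s')) * Zx (pol a t2 s')| <= `|Zx a| + 1.
      rewrite normrM (ger0_norm T0); apply: (@le_trans _ _ (1 * `|Zx (pol a t2 s')|)).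
        by rewrite ler_wpM2r.
      by rewrite mul1r; lra.
    have b1 : `|ramp M (v (pol a t2 s')) * Zy (pol a t2 s')| <= `|Zy a| + 1.
      rewrite normrM (ger0_norm T0); apply: (@le_trans _ _ (1 * `|Zy (pol a t2 s')|)).
        by rewrite ler_wpM2r.
      by rewrite mul1r; lra.
    rewrite -[X in X + _]real_normK ?num_real// -[X in _ + X]real_normK ?num_real//.
    move: b0 b1; rewrite /m; move: `|_ * _| `|_ * _| `|Zx a| `|Zy a| (normr_ge0 (ramp M (v (pol a t2 s')) * Zx (pol a t2 s'))) (normr_ge0 (ramp M (v (pol a t2 s')) * Zy (pol a t2 s'))) (normr_ge0 (Zx a)) (normr_ge0 (Zy a)).
    by clear; move=> i j k l i0 j0 k0 l0 ik jl; nra.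
  have -> : 2 * pi * expR t2 * m = expR t2 * (2 * pi * m) by ring.
  by rewrite -ler_pdivlMr// !mulr_gt0// pi_gt0.
move=> x xr; have [->|xa] := eqVneq x a; last first.
  have n0 : 0 < enorm (x - a) by rewrite enorm_gt0 subr_eq0.
  have [s hs ->] := polP xa; apply: punct => //.
    by rewrite /I/= ltr_ln ?posrE// (le_lt_trans xr rr).
  by rewrite ler_ln ?posrE.
(* A value above M at the centre would persist on a small circle. *)
rewrite leNgt; apply/negP => Ma.
have [d' d'0 hd'] : exists2 d : R, 0 < d & forall x, enorm (x - a) < d -> M < v x.
  apply: nbhs_eball; near=> y.
  have : `|v a - v y| < v a - M.
    by near: y; move/cvgrPdist_lt: (C1_cts (mp_v P) Aa); apply; rewrite subr_gt0.
  by rewrite ltr_norml => /andP[_]; lra.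
pose t := Num.min (ln r) (ln (d' / 2)).
have t1 : t <= ln r by rewrite ge_min lexx.
have It : I t by apply: le_lt_trans t1 _; rewrite ltr_ln ?posrE.
have s0 : 0 <= (0 : R) <= 2 * pi by rewrite lexx mulr_ge0// pi_ge0.
have := punct t 0 It t1 s0; rewrite leNgt => /negP; apply; apply: hd'.
rewrite enorm_pol; apply: (@le_lt_trans _ _ (d' / 2)); last by rewrite ltr_pdivrMr// ltr_pMr// ltr1n.
by rewrite -[leRHS]lnK ?posrE ?divr_gt0// ler_expR ge_min lexx orbT.
Unshelve. all: by end_near. Qed.

Definition translated h f x : R := f (x + h).

Lemma pd_translated b h f x : pd b (translated h f) x = pd b f (x + h).
Proof.
rewrite !pdE /partial /derive.
suff -> : (fun t => t^-1 *: ((translated h f \o shift x) (t *: delta_mx 0 (if b then 1 else 0)) - translated h f x)) = (fun t => t^-1 *: ((f \o shift (x + h)) (t *: delta_mx 0 (if b then 1 else 0)) - f (x + h))) by [].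
by apply/funext => t; rewrite /translated /= addrA.
Qed.

Lemma C1_translated A h f : C1 A f -> C1 [set x | A (x + h)] (translated h f).
Proof.
move=> cf x /= Ax.
have ch : continuous_at x (fun y => y + h).
  by apply: (@cvgD _ _ _ (nbhs x) _ id (fun=> h)); [exact: cvg_id|exact: cvg_cst].
have cb b : continuous_at x (pd b (translated h f)).
  have := @C1_pd R A f _ b cf Ax; move: (pd_translated b h f); move: (pd b f) (pd b (translated h f)) => F F' FF' cF.
  rewrite (_ : F' = fun y => F (y + h)); last by apply/funext.
  exact: (@continuous_comp _ _ _ (fun y : 'rV[R]_2 => y + h) F x ch cF).
split; [|exact: cb|exact: cb].
apply: (@differentiable_comp _ _ _ _ (fun y => y + h) f); last exact: C1_diff cf Ax.
by apply: differentiableD.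
Qed.

Lemma mgraph_translated h A u : mgraph A u -> mgraph [set x | A (x + h)] (translated h u).
Proof.
move=> H; have E b : pd b (translated h u) = translated h (pd b u) by apply/funext => y; exact: pd_translated.
have E2 b c : pd b (translated h (pd c u)) = translated h (pd b (pd c u)) by apply/funext => y; exact: pd_translated.
split.
- rewrite (_ : [set x | _] = (fun x => x + h) @^-1` A)//; apply: open_comp; last exact: mg_open H.
  move=> x _; by apply: (@cvgD _ _ _ (nbhs x) _ id (fun=> h)); [exact: cvg_id|exact: cvg_cst].
- exact: C1_translated (mg_C1 H).
- by move=> b; rewrite E; exact: C1_translated (mg_C2 H b).
- by move=> b c; rewrite E E2; exact: C1_translated (mg_C3 H b c).
- by move=> x /(mg_slope H); rewrite /slope2 !E.
- by move=> x /(mg_sym H); rewrite !E !E2.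
- by move=> x /(mg_eq H); rewrite !E !E2.
Qed.

Lemma slope_bound A u (Kc : set 'rV[R]_2) : mgraph A u -> compact Kc -> Kc `<=` A ->
  exists th : R, [/\ 0 < th, th < 1 & forall x, Kc x -> slope2 u x < th ^+ 2].
Proof.
move=> H cK KA; have [[x0 Kx0]|K0] := pselect (Kc !=set0); last first.
  exists (1 / 2); split; [lra|lra|move=> x Kx; case: K0; by exists x].
have [|||c Kc' hc] := @compact_EVT_max _ _ (slope2 u) Kc; [by exists x0|exact: cK| |].
  apply: continuous_in_subspaceT => x; rewrite inE => Kx.
  exact: C1_cts (C1_slope2 H) (KA _ Kx).
rewrite inE in Kc'.
have s1 := mg_slope H (KA _ Kc'); have s0 := slope2_ge0 u c.
(* The midpoint of the maximum and 1 keeps both inequalities strict. *)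
exists (Num.sqrt ((1 + slope2 u c) / 2)); split.
- by rewrite sqrtr_gt0; lra.
- by rewrite -[ltRHS]sqrtr1 ltr_sqrt//; lra.
- move=> x Kx; rewrite sqr_sqrtr; last by lra.
  have := hc x; rewrite inE => /(_ Kx); lra.
Qed.

Lemma compact_annulus a r d : compact [set x | r <= enorm (x - a) <= d].
Proof.
have ce : continuous (fun x => enorm (x - a)).
  move=> x; apply: (@continuous_comp _ _ _ (fun x => x - a) (@enorm R)).
    by apply: (@cvgD _ _ _ (nbhs x) _ id (fun=> - a)); [exact: cvg_id|exact: cvg_cst].
  exact: enorm_continuous.
apply: bounded_closed_compact.
  exists (d + enorm a); split; first exact: num_real.
  move=> M hM x /= /andP[_ hx]; apply: le_trans (norm_le_enorm _) _.
  have := enorm_sub x a 0; rewrite !subr0 => h2; apply: le_trans h2 _.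
  by rewrite ltW// (le_lt_trans _ hM)// lerD2r.
rewrite (_ : [set x | _] = (fun x => enorm (x - a)) @^-1` [set z | r <= z] `&`
   (fun x => enorm (x - a)) @^-1` [set z | z <= d]); last first.
  by apply/seteqP; split => x /=; [move=> /andP[]|case=> -> ->].
apply: closedI; apply: closed_comp; try (by move=> x _; exact: ce).
  exact: closed_ge.
exact: closed_le.
Qed.

(* Differences of translates of a regular graph obey the maximum principle, so a
   regular approximation of [u0] carries the Lipschitz constant of [u0] on a
   circle around [p] into the disc. *)
Lemma lipschitz_inside n u0 p r : in_Gn n u0 -> 0 < r ->
  (forall x, 0 < enorm (x - p) -> enorm (x - p) < 2 * r -> ~ singular_set u0 x) ->
  exists th : R, [/\ 0 < th, th < 1 & forall m v e, in_Gn m v ->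
    (forall x, enorm (x - p) < 2 * r -> ~ singular_set v x /\ `|v x - u0 x| <= e) ->
    forall x h, enorm (x - p) <= r -> enorm h <= r / 2 ->
    `|u0 (x + h) - u0 x| <= th * enorm h + 4 * e].
Proof.
move=> hu r0 hS.
(* Contains every segment [y, y + h] with |y - p| = r and |h| <= r / 2. *)
pose Kc := [set x | r / 2 <= enorm (x - p) <= 3 / 2 * r].
have KS : Kc `<=` ~` singular_set u0.
  by move=> x /= /andP[x1 x2]; apply: hS; lra.
have [th [th0 th1 hth]] := slope_bound (Gn_mgraph hu) (@compact_annulus p (r / 2) (3 / 2 * r)) KS.
exists th; split => // m v e hv hve x h xr hr.
have e0 : 0 <= e by have [_] := hve p (ltac:(by rewrite subrr enorm0 mulr_gt0)); apply: le_trans.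
have circ y : enorm (y - p) = r -> `|u0 (y + h) - u0 y| <= th * enorm h.
  move=> yr; have [->|h0] := eqVneq h 0; first by rewrite addr0 subrr normr0 enorm0 mulr0.
  have yh : y != y + h by rewrite -subr_eq0 opprD addrA subrr sub0r oppr_eq0.
  have yK t : 0 < t < 1 -> Kc (y + t *: h).
    move=> /andP[t0 t1]; rewrite /Kc/=.
    have th' : enorm (t *: h) <= r / 2.
      rewrite enormZ gtr0_norm//; apply: le_trans hr; rewrite ler_piMl ?enorm_ge0// ltW//.
    have := enorm_sub (y + t *: h) y p; have := enorm_sub y (y + t *: h) p.
    rewrite yr opprD addrA subrr sub0r enormN (_ : y + t *: h - y = t *: h); last by rewrite addrAC subrr add0r.
    by move=> ? ?; apply/andP; split; lra.
  have := @segment_lt R u0 set0 th y (y + h) (@finite_set0 _) th0 yh.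
  have E : y + h - y = h by rewrite addrAC subrr add0r.
  rewrite E => hh; apply: ltW; apply: hh.
    by move=> t _; apply: (Gn_cts hu).
  move=> t ht _; split; first exact: C1_diff (mg_C1 (Gn_mgraph hu)) (KS _ (yK t ht)).
  exact: hth (yK t ht).
pose A := [set x | enorm (x - p) < 3 / 2 * r].
have oA : open A by exact: open_eball.
have Av : A `<=` ~` singular_set v by move=> y; rewrite /A/= => hy; apply: (hve y _).1; lra.
have Ah y : A y -> enorm (y + h - p) < 2 * r.
  rewrite /A/= => hy; have := enorm_sub (y + h) y p; rewrite (_ : y + h - y = h); last by rewrite addrAC subrr add0r.
  lra.
have Avh : A `<=` [set y | (~` singular_set v) (y + h)] by move=> y /Ah hy; exact: (hve _ hy).1.
have mv := mgraph_sub oA Av (Gn_mgraph hv).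
have mvh := mgraph_sub oA Avh (mgraph_translated h (Gn_mgraph hv)).
have rr : r < 3 / 2 * r by lra.
have inA y : enorm (y - p) < 3 / 2 * r -> A y by [].
(* Passing from [u0] to v costs e at each end of h; the same cost on the way back makes 4e. *)
have near y : enorm (y - p) = r -> `|v (y + h) - v y| <= th * enorm h + 2 * e.
  move=> yr; have Ay : A y by rewrite /A/= yr.
  have [_ e1] := hve _ (Ah y Ay); have [|_ e2] := hve y; first by rewrite yr; lra.
  have := circ y yr; move: e1 e2; rewrite !ler_norml => /andP[? ?] /andP[? ?] /andP[? ?].
  by apply/andP; split; lra.
have up := max_disc (M := th * enorm h + 2 * e) (mgraph_diff mvh mv) r0 rr inA _ xr.
have dn := max_disc (M := th * enorm h + 2 * e) (mgraph_diff mv mvh) r0 rr inA _ xr.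
have {}up : v (x + h) - v x <= th * enorm h + 2 * e.
  by apply: up => y /near; rewrite /translated ler_norml => /andP[].
have {}dn : v x - v (x + h) <= th * enorm h + 2 * e.
  by apply: dn => y /near; rewrite /translated ler_norml => /andP[]; lra.
have Ax : A x by rewrite /A/=; lra.
have [_ e1] := hve _ (Ah x Ax); have [|_ e2] := hve x; first by lra.
by move: e1 e2; rewrite !ler_norml => /andP[? ?] /andP[? ?]; apply/andP; split; lra.
Qed.

End RemovableLipschitz.

(** * Conformal coordinates at a puncture *)

Section Puncture.
Variable R : realType.
Local Notation px := (@pd R false).
Local Notation py := (@pd R true).
Implicit Types (u v w f g : 'rV[R]_2 -> R) (a x p h : 'rV[R]_2) (A : set 'rV[R]_2)
  (t s r d e K M th : R).

(** In reversed time the flux of the bounded v satisfies the Riccati inequality, so there are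
    circles of small energy arbitrarily close to p, where the truncated flux is small too. *)
Lemma mpair_puncture A v Zx Zy K (L B : R) p (dl : R) : mpair A v Zx Zy K -> 0 < L -> 0 <= B ->
  0 < dl ->
  (forall x, 0 < enorm (x - p) -> enorm (x - p) < dl ->
     [/\ A x, zbound L v Zx Zy x & `|v x| <= B]) ->
  forall r M, 0 < r -> r < dl -> (forall x, enorm (x - p) = r -> v x <= M) ->
  forall x, 0 < enorm (x - p) -> enorm (x - p) <= r -> v x <= M.
Proof.
move=> P L0 B0 dl0 hp r M r0 rd hM x x0 xr.
pose I := [set t : R | t < ln dl].
have hI t s : I t -> [/\ A (pol p t s), zbound L v Zx Zy (pol p t s) & `|v (pol p t s)| <= B].
  move=> It; apply: hp; rewrite enorm_pol ?expR_gt0//.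
  by rewrite -[ltRHS]lnK ?posrE// ltr_expR.
have xp : x != p by rewrite -subr_eq0 -enorm_gt0.
have [s hs ->] := polP xp.
have IA t s' : I t -> A (pol p t s') by move=> It; have [] := hI t s' It.
have Iopen t : I t -> exists2 d : R, 0 < d & forall t', `|t' - t| <= d -> I t'.
  move=> It; exists ((ln dl - t) / 2); first by rewrite divr_gt0// subr_gt0.
  move: It; rewrite /I/= => It t2; rewrite ler_norml => /andP[_ h2]; clear -It h2; lra.
have Iconv t1 t2 t : I t1 -> I t2 -> t1 <= t <= t2 -> I t.
  by move=> _ h2 /andP[_ h]; exact: le_lt_trans h h2.
have lr : I (ln r) by rewrite /I/= ltr_ln ?posrE.
have lx : ln (enorm (x - p)) <= ln r by rewrite ler_ln ?posrE.
apply: (@max_principle_in R A v Zx Zy K L M p P L0 I Iconv Iopen IA (ln r)) => //.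
- by move=> s'; apply: hM; rewrite enorm_pol lnK.
- move=> t d It d0.
  (* Both signs are reversed, so that again y' = E, now for circles shrinking to p. *)
  pose y (t : R) := - flux (fun x => v x * Zx x) (fun x => v x * Zy x) p (- t).
  pose E (t : R) := energy v Zx Zy p (- t).
  have INt t' : - ln dl < t' -> I (- t') by rewrite /I/= ltrNl.
  have C0 : 0 < 2 * pi * (B + 1) ^+ 2 * L by rewrite !mulr_gt0 ?pi_gt0// ?exprn_gt0// ltr_wpDl.
  have dy t' : - ln dl < t' -> is_derive t' 1 y (E t').
    move=> /INt It'; have [d' d'0 hd'] := Iopen _ It'.
    have c1 : continuous (fun _ : R => 1 : R) by move=> z; exact: cvg_cst.
    have D := @der_flux_comp R A v Zx Zy K p id (fun=> 1) (- t') d' P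
      (fun x : R => is_derive_id x 1) c1 d'0 (fun r s q => IA r s (hd' r q)).
    have hN : is_derive t' 1 (fun t : R => - t) (- 1) by der_by.
    apply: (der_eq (der_opp (der_comp D hN))).
    rewrite mulrN1 opprK /E /energy; congr cint; apply/funext => s'; by rewrite mul1r.
  have yE t' : - ln dl < t' -> y t' ^+ 2 <= 2 * pi * (B + 1) ^+ 2 * L * E t'.
    move=> /INt It'; rewrite /y sqrrN.
    apply: (@flux_sqr R A v Zx Zy K L p (- t') id (B + 1) P) => //.
    - by move=> s'; have [] := hI _ s' It'.
    - by move=> z; exact: cvg_id.
    - by move=> s'; exact: IA.
    - by rewrite addr_ge0.
    - by move=> s'; have [_ _ /le_trans] := hI _ s' It'; apply; rewrite lerDl.
  have [t2 h1 h2] := riccati_liminf C0 dy yE (- t) d0.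
  have h3 : - t2 <= t by rewrite lerNl ltW.
  have It2 : I (- t2) by exact: le_lt_trans It.
  exists (- t2); split; [exact: It2|exact: h3| |exact: h2].
  by move=> s'; have [] := hI _ s' It2.
- exact: le_lt_trans lr.
Qed.

Lemma max_circle (f : 'rV[R]_2 -> R) A p r : 0 < r -> (forall x, A x -> continuous_at x f) ->
  (forall x, enorm (x - p) = r -> A x) ->
  exists2 x, enorm (x - p) = r & forall y, enorm (y - p) = r -> f y <= f x.
Proof.
move=> r0 cf hA; pose Kc := [set x | r <= enorm (x - p) <= r].
have KE x : Kc x <-> enorm (x - p) = r.
  split; last by move=> e; rewrite /Kc/= e lexx.
  by rewrite /Kc/= => h; apply/eqP; rewrite eq_le andbC.
have K0 : Kc (pol p (ln r) 0) by apply/KE; rewrite enorm_pol lnK.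
have [|||c Kc' hc] := @compact_EVT_max _ _ f Kc.
- by exists (pol p (ln r) 0).
- exact: compact_annulus.
- apply: continuous_in_subspaceT => x; rewrite inE => /KE Kx.
  by apply: cf; exact: hA.
exists c; first by apply/KE; rewrite inE in Kc'.
by move=> y yr; apply: hc; rewrite inE; apply/KE.
Qed.

Lemma differentiable_row (psi : 'rV[R]_2 -> 'rV[R]_2) x (i : 'I_2) :
  differentiable psi x -> differentiable (fun y => psi y 0 i) x.
Proof.
move=> d; apply: (@differentiable_comp _ _ _ _ psi (fun m : 'rV[R]_2 => m 0 i)) => //.
exact: differentiable_coord.
Qed.

Lemma derive_row (psi : 'rV[R]_2 -> 'rV[R]_2) x h (i : 'I_2) :
  differentiable psi x -> ('D_h psi x) 0 i = 'D_h (fun y => psi y 0 i) x.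
Proof. by move=> d; rewrite derive_mx ?mxE//; exact: diff_derivable. Qed.

Lemma smooth_on_row A (psi : 'rV[R]_2 -> 'rV[R]_2) (i : 'I_2) : open A ->
  smooth_on A psi -> smooth_on A (fun y => psi y 0 i).
Proof.
move=> oA sm.
have E l : forall x, A x -> iter_derive l (fun y => psi y 0 i) x = iter_derive l psi x 0 i.
  elim: l => // h l IH x Ax /=; rewrite derive_row; last exact: sm.
  by apply: near_eq_derive; near=> y; apply: IH; near: y; exact: open_nbhs_nbhs.
move=> l x Ax; apply: (@near_eq_differentiable R _ _ (fun y => iter_derive l psi y 0 i)).
  by near=> y; apply/esym/E; near: y; exact: open_nbhs_nbhs.
by apply: differentiable_row; exact: sm.
Unshelve. all: by end_near. Qed.


Section ConformalPair.
Variables (A : set 'rV[R]_2) (P Q : 'rV[R]_2 -> R) (ka : R).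
Hypotheses (oA : open A) (cP : C1 A P) (cPb : forall b, C1 A (pd b P))
  (cQ : C1 A Q) (cQb : forall b, C1 A (pd b Q)) (ka0 : 0 < ka).

Definition modulus2 x : R := P x ^+ 2 + Q x ^+ 2.
Definition jac x : R := px P x * py Q x - py P x * px Q x.
(** The partial derivatives of the argument of (P, Q). The argument itself is multivalued; only this
    closed form is used. *)
Definition arg_pd b x : R := (modulus2 x)^-1 * (P x * pd b Q x - Q x * pd b P x).

Hypothesis mod0 : forall x, A x -> 0 < modulus2 x.
Hypothesis jac0 : forall x, A x -> jac x != 0.
Hypothesis quasi : forall x, A x ->
  ka * (px P x ^+ 2 + py P x ^+ 2 + px Q x ^+ 2 + py Q x ^+ 2) <= 2 * `|jac x|.

Let dP x : A x -> differentiable P x. Proof. exact: C1_diff. Qed.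
Let dQ x : A x -> differentiable Q x. Proof. exact: C1_diff. Qed.

Lemma C1_modulus2 : C1 A modulus2.
Proof.
by apply: (C1_eq oA _ (C1_add oA (C1_mul oA cP cP) (C1_mul oA cQ cQ))) => y _; rewrite /modulus2 !expr2.
Qed.

Lemma pd_modulus2 b x : A x -> pd b modulus2 x = 2 * (P x * pd b P x + Q x * pd b Q x).
Proof.
move=> Ax; rewrite [LHS](_ : _ = pd b (fun y => P y * P y + Q y * Q y) x); last first.
  by congr (pd b _ x); apply/funext => y; rewrite /modulus2 !expr2.
rewrite pd_add ?pd_mul; [by ring|exact: dQ|exact: dQ|exact: dP|exact: dP|..].
  exact: C1_diff (C1_mul oA cP cP) Ax.
exact: C1_diff (C1_mul oA cQ cQ) Ax.
Qed.

Let der_invr (z : R) : 0 < z -> is_derive z 1 (fun z : R => z^-1) (- z ^- 2).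
Proof.
move=> z0; apply: (der_eq (der_inv (is_derive_id z 1) (lt0r_neq0 z0))).
by rewrite mulN1r.
Qed.

Lemma C1_inv_modulus2 : C1 A (fun x => (modulus2 x)^-1).
Proof.
apply: (@C1_comp _ A (fun z : R => z^-1) (fun z => - z ^- 2)) C1_modulus2 _ _ => //.
  by move=> x Ax; apply: der_invr; exact: mod0.
move=> x /mod0 m0; have m0' : modulus2 x != 0 by exact: lt0r_neq0.
have m2 : modulus2 x ^+ 2 != 0 by rewrite expf_neq0.
by cts.
Qed.

Lemma C1_log_modulus : C1 A (fun x => ln (modulus2 x)).
Proof.
apply: (@C1_comp _ A (@ln R) (fun z => z^-1)) C1_modulus2 _ _ => //.
  by move=> x /mod0; exact: is_derive1_ln.
move=> x /mod0 m0; have m0' : modulus2 x != 0 by exact: lt0r_neq0.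
by cts.
Qed.

Lemma pd_log_modulus b x : A x -> pd b (fun x => ln (modulus2 x)) x =
  (modulus2 x)^-1 * (2 * (P x * pd b P x + Q x * pd b Q x)).
Proof.
move=> Ax; rewrite (@pd_comp _ (@ln R) _ modulus2 x b (is_derive1_ln (mod0 Ax))) ?pd_modulus2//.
exact: C1_diff C1_modulus2 Ax.
Qed.

Let C1_cross b : C1 A (fun x => P x * pd b Q x - Q x * pd b P x).
Proof.
by apply: (C1_add oA); [exact: C1_mul|apply: C1_opp => //; exact: C1_mul].
Qed.

Lemma C1_arg_pd b : C1 A (arg_pd b).
Proof. exact: C1_mul oA C1_inv_modulus2 (C1_cross b). Qed.

Lemma arg_pd_closed x : A x -> px (arg_pd true) x = py (arg_pd false) x.
Proof.
move=> Ax.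
have d1 b := C1_diff (cPb b) Ax; have d2 b := C1_diff (cQb b) Ax.
have E b c : pd c (arg_pd b) x =
   - (modulus2 x) ^- 2 * (2 * (P x * pd c P x + Q x * pd c Q x)) * (P x * pd b Q x - Q x * pd b P x) +
   (modulus2 x)^-1 * (pd c P x * pd b Q x + P x * pd c (pd b Q) x - (pd c Q x * pd b P x + Q x * pd c (pd b P) x)).
  rewrite /arg_pd pd_mul; [|exact: C1_diff C1_inv_modulus2 Ax|exact: C1_diff (C1_cross b) Ax].
  rewrite (@pd_comp _ (fun z : R => z^-1) _ modulus2 x c (der_invr (mod0 Ax))); last exact: C1_diff C1_modulus2 Ax.
  rewrite pd_modulus2//; congr (_ + _ * _).
  have dPQ := C1_diff (C1_mul oA cP (cQb b)) Ax; have dQP := C1_diff (C1_mul oA cQ (cPb b)) Ax.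
  rewrite pd_add ?pd_opp//; last exact: differentiableN.
  by rewrite !pd_mul//; [exact: dQ|exact: dP].
rewrite !E (schwarz oA cP cPb Ax) (schwarz oA cQ cQb Ax).
have : modulus2 x != 0 by exact: lt0r_neq0 (mod0 Ax).
rewrite /modulus2; move: (P x) (Q x) (px P x) (py P x) (px Q x) (py Q x) (px (py P) x) (px (py Q) x).
by move=> *; field.
Qed.

(** Rotating the closed form d arg gives a divergence-free field. Its product with D ln|psi|^2 is 2
    J / |psi|^2, J the Jacobian, and the sign of J makes it positive. By [quasi], |J| bounds
    |Dpsi|^2, which yields both comparisons. *)
Lemma mpair_conformal :
  mpair A (fun x => ln (modulus2 x)) (fun x => Num.sg (jac x) * arg_pd true x)
     (fun x => - (Num.sg (jac x) * arg_pd false x)) (4 / ka) /\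
  forall x, A x -> zbound (4 / ka) (fun x => ln (modulus2 x)) (fun x => Num.sg (jac x) * arg_pd true x)
     (fun x => - (Num.sg (jac x) * arg_pd false x)) x.
Proof.
have cJ : C1 A jac.
  by apply: (C1_add oA); [exact: C1_mul|apply: C1_opp => //; exact: C1_mul].
(* The sign of the Jacobian is locally constant, hence harmless in derivatives. *)
have [cs Es] : (forall b, C1 A (fun x => Num.sg (jac x) * arg_pd b x)) /\
    forall b c x, A x -> pd c (fun x => Num.sg (jac x) * arg_pd b x) x =
      Num.sg (jac x) * pd c (arg_pd b) x.
  pose B (s : R) := [set x | A x /\ 0 < s * jac x].
  have oB s : open (B s).
    rewrite openE => x [Ax jx]; rewrite /interior/=.
    have h1 : nbhs x A by exact: open_nbhs_nbhs.
    have h2 : \forall y \near x, 0 < s * jac y.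
      have c : continuous_at x (fun y => s * jac y) by have ? := C1_cts cJ Ax; cts.
      near=> y; have : `|s * jac x - s * jac y| < s * jac x.
        by near: y; move/cvgrPdist_lt: c; apply.
      by rewrite ltr_norml => /andP[_]; lra.
    by apply: filterS2 h1 h2 => y; split.
  have BA s : B s `<=` A by move=> x [].
  have Bs x : A x -> B (Num.sg (jac x)) x.
    by move=> Ax; split => //; rewrite -normrEsg normr_gt0 jac0.
  have BE x y b : A x -> B (Num.sg (jac x)) y -> Num.sg (jac x) * arg_pd b y = Num.sg (jac y) * arg_pd b y.
    move=> Ax [Ay]; have := jac0 Ax; have := jac0 Ay; case: sgrP => // jx _ _.
      by rewrite mul1r => /gtr0_sg ->.
    by rewrite mulN1r oppr_gt0 => /ltr0_sg ->.
  have cB x b : A x -> C1 (B (Num.sg (jac x))) (fun y => Num.sg (jac x) * arg_pd b y).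
    by move=> Ax; apply: C1_mul; [exact: oB|exact: C1_cst|exact: C1_sub (@BA _) (C1_arg_pd b)].
  split => [b x Ax|b c x Ax].
    exact: C1_eq (oB _) (fun y By => BE x y b Ax By) (cB x b Ax) _ (Bs x Ax).
  rewrite -(near_pd c (oB _) (Bs x Ax) (fun y By => BE x y b Ax By)).
  have d0 : differentiable (fun _ : 'rV[R]_2 => Num.sg (jac x)) x by exact: differentiable_cst.
  by rewrite (pd_mul c d0 (C1_diff (C1_arg_pd b) Ax)) pd_cst mul0r add0r.
have main x : A x ->
   [/\ px (fun x => ln (modulus2 x)) x ^+ 2 + py (fun x => ln (modulus2 x)) x ^+ 2 <=
     4 / ka * edens (fun x => ln (modulus2 x)) (fun x => Num.sg (jac x) * arg_pd true x)
     (fun x => - (Num.sg (jac x) * arg_pd false x)) x &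
   zbound (4 / ka) (fun x => ln (modulus2 x)) (fun x => Num.sg (jac x) * arg_pd true x)
     (fun x => - (Num.sg (jac x) * arg_pd false x)) x].
  move=> Ax; rewrite /zbound /edens !pd_log_modulus//.
  have j0 := jac0 Ax; have q := quasi Ax; have m0 := mod0 Ax.
  have sg1 : Num.sg (jac x) ^+ 2 = 1 by rewrite sqr_sg j0.
  have -> : Num.sg (jac x) * arg_pd true x * ((modulus2 x)^-1 * (2 * (P x * px P x + Q x * px Q x))) +
     - (Num.sg (jac x) * arg_pd false x) * ((modulus2 x)^-1 * (2 * (P x * py P x + Q x * py Q x))) =
     (modulus2 x)^-1 * (2 * `|jac x|).
    rewrite [`|jac x|]normrEsg; move: (Num.sg _) => s; rewrite /arg_pd /jac.
    have : modulus2 x != 0 by exact: lt0r_neq0.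
    rewrite /modulus2; move: (P x) (Q x) (px P x) (py P x) (px Q x) (py Q x).
    by move=> *; field.
  have i0 : 0 < (modulus2 x)^-1 by rewrite invr_gt0.
  have im : (modulus2 x)^-1 * modulus2 x = 1 by rewrite mulVf ?lt0r_neq0.
  have E : 4 / ka * ((modulus2 x)^-1 * (2 * `|jac x|)) =
     (modulus2 x)^-1 * (4 * (2 * `|jac x| / ka)) by ring.
  have T : px P x ^+ 2 + py P x ^+ 2 + px Q x ^+ 2 + py Q x ^+ 2 <= 2 * `|jac x| / ka.
    by rewrite ler_pdivlMr// mulrC.
  rewrite E sqrrN !(exprMn _ (Num.sg _)) sg1 !mul1r /arg_pd.
  move: T im i0; move: (2 * `|jac x| / ka) => t; rewrite /modulus2; move: ((_ + _)^-1) => i.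
  move: (P x) (Q x) (px P x) (py P x) (px Q x) (py Q x) => a b c d e f T im i0.
  have cs1 : (a * c + b * e) ^+ 2 + (a * d + b * f) ^+ 2 <= (a ^+ 2 + b ^+ 2) * (c ^+ 2 + d ^+ 2 + e ^+ 2 + f ^+ 2).
    rewrite -subr_ge0 (_ : _ - _ = (a * e - b * c) ^+ 2 + (a * f - b * d) ^+ 2); last by ring.
    by rewrite addr_ge0 ?sqr_ge0.
  have cs2 : (a * f - b * d) ^+ 2 + (a * e - b * c) ^+ 2 <= (a ^+ 2 + b ^+ 2) * (c ^+ 2 + d ^+ 2 + e ^+ 2 + f ^+ 2).
    rewrite -subr_ge0 (_ : _ - _ = (a * c + b * e) ^+ 2 + (a * d + b * f) ^+ 2); last by ring.
    by rewrite addr_ge0 ?sqr_ge0.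
  have S0 : 0 <= c ^+ 2 + d ^+ 2 + e ^+ 2 + f ^+ 2 by rewrite !addr_ge0 ?sqr_ge0.
  have S1 : i ^+ 2 * ((a ^+ 2 + b ^+ 2) * (c ^+ 2 + d ^+ 2 + e ^+ 2 + f ^+ 2)) = i * (c ^+ 2 + d ^+ 2 + e ^+ 2 + f ^+ 2).
    by rewrite mulrA expr2 -(mulrA i i) im mulr1.
  have S2 : i * (c ^+ 2 + d ^+ 2 + e ^+ 2 + f ^+ 2) <= i * t by rewrite ler_pM2l.
  have i2 : 0 <= i ^+ 2 by exact: sqr_ge0.
  have it0 : 0 <= i * t by rewrite mulr_ge0 ?(ltW i0)// (le_trans S0 T).
  split.
    rewrite (_ : _ + _ = 4 * (i ^+ 2 * ((a * c + b * e) ^+ 2 + (a * d + b * f) ^+ 2))); last by ring.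
    rewrite (_ : i * (4 * t) = 4 * (i * t)); last by ring.
    by rewrite ler_pM2l// (le_trans _ S2)// -S1 ler_wpM2l.
  rewrite (_ : _ + _ = (i ^+ 2 * ((a * f - b * d) ^+ 2 + (a * e - b * c) ^+ 2))); last by ring.
  rewrite (_ : i * (4 * t) = i * t + 3 * (i * t)); last by ring.
  apply: (@le_trans _ _ (i * t)); last by rewrite lerDl mulr_ge0.
  by rewrite (le_trans _ S2)// -S1 ler_wpM2l.
split; last by move=> x /main[].
split => //.
- by rewrite divr_gt0.
- exact: C1_log_modulus.
- exact: C1_opp.
- move=> x Ax; rewrite pd_opp; last exact: C1_diff (cs false) Ax.
  by rewrite !Es// arg_pd_closed// subrr.
- by move=> x /main[].
Unshelve. all: by end_near. Qed.

End ConformalPair.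


Lemma pd_min A f x (r : R) b : C1 A f -> 0 < r -> (forall y, enorm (y - x) < r -> A y /\ f x <= f y) ->
  pd b f x = 0.
Proof.
move=> cf r0 hr.
have nd (t : R) : enorm (x + t *: dir R b - x) = `|t|.
  rewrite addrAC subrr add0r enormZ (_ : enorm (dir R b) = 1) ?mulr1//.
  apply/eqP; rewrite -(@eqrXn2 _ 2) ?enorm_ge0// enorm_mk expr1n.
  by case: b => /=; rewrite expr0n expr1n ?addr0 ?add0r.
have I t : t \in `]-r, r[ -> enorm (x + t *: dir R b - x) < r.
  by rewrite in_itv/= nd ltr_norml.
pose g t := f (x + t *: dir R b).
have D t : t \in `]-r, r[ -> is_derive t 1 g (pd b f (x + t *: dir R b)).
  by move=> /I/hr[At _]; apply: der_dir; exact: C1_diff cf At.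
have h0 : (0 : R) \in `]-r, r[ by rewrite in_itv/= oppr_lt0 r0.
have x0 : x + 0 *: dir R b = x by rewrite scale0r addr0.
have m : is_derive (0 : R) 1 g 0.
  apply: (@derive1_at_min R g (- r) r 0) => //.
  - by clear -r0; lra.
  - by move=> t /D[].
  - by move=> t /I/hr[_]; rewrite /g x0.
have := D 0 h0; rewrite x0 => d.
have e1 := @derive_val _ _ _ _ _ _ _ d; have e2 := @derive_val _ _ _ _ _ _ _ m.
by rewrite -e1 e2.
Qed.

(** The surjective half of the inverse function theorem, by minimising |(P, Q) - (a, b)|^2 over a
    disc. The minimum is interior, as the values on the boundary circle keep a positive distance
    from (P x, Q x); there the invertible differential forces the minimum to be 0. *)
Lemma local_onto A P Q x (r : R) : C1 A P -> C1 A Q -> (forall y, A y -> jac P Q y != 0) ->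
  0 < r -> (forall y, enorm (y - x) <= r -> A y) ->
  (forall y, enorm (y - x) = r -> P y = P x -> Q y = Q x -> False) ->
  exists2 e : R, 0 < e & forall a b : R, (a - P x) ^+ 2 + (b - Q x) ^+ 2 < e ->
    exists2 y, enorm (y - x) < r & P y = a /\ Q y = b.
Proof.
move=> cP cQ hJ r0 hA hinj.
have cf (a b : R) y : A y -> continuous_at y (fun y => (P y - a) ^+ 2 + (Q y - b) ^+ 2).
  by move=> Ay; have ? := C1_cts cP Ay; have ? := C1_cts cQ Ay; cts.
have cg y : A y -> continuous_at y (fun y => - ((P y - P x) ^+ 2 + (Q y - Q x) ^+ 2)).
  by move=> Ay; have ? := C1_cts cP Ay; have ? := C1_cts cQ Ay; cts.
have hA' y : enorm (y - x) = r -> A y by move=> e; apply: hA; rewrite e.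
have [c cr hc] := max_circle r0 cg hA'.
pose m := (P c - P x) ^+ 2 + (Q c - Q x) ^+ 2.
have m0 : 0 < m.
  rewrite lt_neqAle addr_ge0 ?sqr_ge0// andbT eq_sym.
  apply/negP; rewrite paddr_eq0 ?sqr_ge0// !sqrf_eq0 !subr_eq0 => /andP[/eqP h1 /eqP h2].
  exact: hinj cr h1 h2.
have mc y : enorm (y - x) = r -> m <= (P y - P x) ^+ 2 + (Q y - Q x) ^+ 2.
  by move=> /hc; rewrite lerN2.
(* Values on the circle are at distance at least sqrt m from the value at x; a target within sqrt m
   / 2 of the latter is nearer to it than to any of them. *)
exists (m / 4) => [|a b ab]; first by rewrite divr_gt0.
pose Kc := [set y | 0 <= enorm (y - x) <= r].
have Kx : Kc x by rewrite /Kc/= subrr enorm0 lexx ltW.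
have [|||y Ky hy] := @compact_EVT_min _ _ (fun y => (P y - a) ^+ 2 + (Q y - b) ^+ 2) Kc.
- by exists x.
- exact: compact_annulus.
- apply: continuous_in_subspaceT => y; rewrite inE => /andP[_ Ky].
  exact: cf (hA _ Ky).
have fx : (P y - a) ^+ 2 + (Q y - b) ^+ 2 < m / 4.
  apply: le_lt_trans ab; rewrite -![(a - P x)]opprB -![(b - Q x)]opprB !sqrrN.
  by apply: hy; rewrite inE.
have yr : enorm (y - x) < r.
  rewrite inE in Ky; case/andP: Ky => _; rewrite le_eqVlt => /predU1P[/mc yc|//].
  move: ab fx yc; clear; move: m (P x) (Q x) (P y) (Q y) => m p q p' q' ab fx yc; exfalso.
  have := sqr_ge0 (p' - a - (a - p)); have := sqr_ge0 (q' - b - (b - q)); nra.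
have Ay := hA _ (ltW yr).
exists y => //.
have oA' : open [set z | enorm (z - x) < r] by exact: open_eball.
have BA : [set z | enorm (z - x) < r] `<=` A by move=> z /= h; apply: hA; exact: ltW.
have cP' := C1_sub BA cP; have cQ' := C1_sub BA cQ.
have cc (k : R) : C1 [set z | enorm (z - x) < r] (fun=> - k) by exact: C1_cst.
have c1 := C1_add oA' cP' (cc a); have c2 := C1_add oA' cQ' (cc b).
have cF := C1_add oA' (C1_mul oA' c1 c1) (C1_mul oA' c2 c2).
have d1 := C1_diff c1 yr; have d2 := C1_diff c2 yr.
have dP := C1_diff cP' yr; have dQ := C1_diff cQ' yr.
have st b' : (P y - a) * pd b' P y + (Q y - b) * pd b' Q y = 0.
  have r1 : 0 < r - enorm (y - x) by rewrite subr_gt0.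
  have := @pd_min _ _ y _ b' cF r1 _.
  rewrite pd_add; [|exact: C1_diff (C1_mul oA' c1 c1) yr|exact: C1_diff (C1_mul oA' c2 c2) yr].
  rewrite !pd_mul// !pd_add//; try exact: differentiable_cst.
  rewrite !pd_cst !addr0 => st; apply: (@mulfI _ 2) => //; rewrite mulr0 -st; first by ring.
  move=> z hz; have hz' : enorm (z - x) < r.
    by have := enorm_sub z y x; clear -hz; lra.
  split => //; rewrite -!expr2; apply: hy; rewrite inE /Kc/= enorm_ge0 ltW//.
have := st false; have := st true; have := hJ _ Ay; rewrite /jac.
move: (P y) (Q y) (px P y) (py P y) (px Q y) (py Q y) => p q a1 a2 b1 b2; clear => J e2 e1.
have E1 : (p - a) * (a1 * b2 - a2 * b1) = 0.
  have -> : (p - a) * (a1 * b2 - a2 * b1) = b2 * ((p - a) * a1 + (q - b) * b1) - b1 * ((p - a) * a2 + (q - b) * b2) by ring.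
  by rewrite e1 e2 !mulr0 subrr.
have E2 : (q - b) * (a1 * b2 - a2 * b1) = 0.
  have -> : (q - b) * (a1 * b2 - a2 * b1) = a1 * ((p - a) * a2 + (q - b) * b2) - a2 * ((p - a) * a1 + (q - b) * b1) by ring.
  by rewrite e1 e2 !mulr0 subrr.
split; apply/eqP; rewrite -subr_eq0.
  by move/eqP: E1; rewrite mulf_eq0 (negPf J) orbF.
by move/eqP: E2; rewrite mulf_eq0 (negPf J) orbF.
Qed.

(** The derivative in the direction Du is |Du|^2, while the hypothesis bounds it by th |Du|. *)
Lemma lipschitz_slope u x th (r : R) : differentiable u x -> 0 <= th -> 0 < r ->
  (forall h, enorm h <= r -> `|u (x + h) - u x| <= th * enorm h) -> slope2 u x <= th ^+ 2.
Proof.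
move=> du th0 r0 hl.
have D : is_derive (0 : R) 1 (fun t => u (x + t *: mk (px u x) (py u x))) (slope2 u x).
  have := @der_line _ u x (mk (px u x) (py u x)) 0; rewrite scale0r addr0 mk0 mk1 -!expr2.
  exact.
set n := enorm (mk (px u x) (py u x)); have n2 : n ^+ 2 = slope2 u x by rewrite enorm_mk.
have n0 : 0 <= n by exact: enorm_ge0.
suff : slope2 u x <= th * n.
  rewrite -n2 ler_sqr ?nnegrE//; have [->|npos] := eqVneq n 0; first by [].
  by rewrite expr2 ler_pM2r// lt_neqAle eq_sym npos.
have [n1|n1] := eqVneq n 0; first by rewrite -n2 n1 mulr0 expr0n.
have npos : 0 < n by rewrite lt_neqAle eq_sym n1.
have rn0 : 0 < r / n by rewrite divr_gt0.
have cv := @ex_derive _ _ _ _ _ _ _ D; rewrite -(@derive_val _ _ _ _ _ _ _ D).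
apply: limr_le => //; near=> t.
have t0 : t != 0 by near: t; exact: nbhs_dnbhs_neq.
have tr : `|t| * n <= r.
  by rewrite -ler_pdivlMr//; near: t; apply: nbhs_dnbhs; exact: (@nbhs0_le R R (r / n)).
rewrite /= scale0r !addr0; apply: le_trans (ler_norm _) _.
rewrite normrZ normfV -ler_pdivlMl ?invr_gt0 ?normr_gt0// invrK.
have -> : t *: 1 = t by rewrite -[LHS]/(t * 1) mulr1.
have := hl (t *: mk (px u x) (py u x)); rewrite enormZ -/n => /(_ tr).
by rewrite mulrCA.
Unshelve. all: by end_near. Qed.


(* If |Du| <= th < 1 near [p], the induced metric is comparable to the Euclidean
   one, so ln|psi| and arg psi form a monotone pair and the maximum principle for
   ln|psi| and -ln|psi| keeps psi in a compact subannulus.  A cluster value of psi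
   at [p] is then also taken, with all nearby values, around a point of [U `\ p],
   which contradicts the injectivity of psi. *)
Lemma conelike_not_lipschitz u p th (r : R) : conelike_singularity u p -> 0 <= th -> th < 1 -> 0 < r ->
  (forall x h, enorm (x - p) <= r -> enorm h <= r -> `|u (x + h) - u x| <= th * enorm h) -> False.
Proof.
move=> [U [r0 [psi [hh [[[oU Up] mU /andP[r00 r01]] [bij sm hE _]]]]]] th0 th1 rp hlip.
pose A := U `\ p.
have oA : open A by apply: openI => //; rewrite openC; exact: finite_closed (finite_set1 p).
have mg := maximal_mgraph oA mU.
pose P : 'rV[R]_2 -> R := fun x => psi x 0 0; pose Q : 'rV[R]_2 -> R := fun x => psi x 0 1.
have sP : smooth_on A P by exact: smooth_on_row.
have sQ : smooth_on A Q by exact: smooth_on_row.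
have cP := smooth_on_C1 sP; have cQ := smooth_on_C1 sQ.
have cPb b := smooth_on_C1 (smooth_on_pd b sP); have cQb b := smooth_on_C1 (smooth_on_pd b sQ).
have [d0 d00 hd0] := nbhs_eball (open_nbhs_nbhs (conj oU Up)).
pose dl := Num.min d0 r.
have dl0 : 0 < dl by rewrite lt_min d00.
have dlr : dl <= r by rewrite ge_min lexx orbT.
pose D := [set x | enorm (x - p) < dl] `\ p.
have oD : open D.
  by apply: openI; [exact: open_eball|rewrite openC; exact: finite_closed (finite_set1 p)].
have inD x : 0 < enorm (x - p) -> enorm (x - p) < dl -> D x.
  by move=> x0 xd; split => //= xp; move: x0; rewrite xp subrr enorm0 ltxx.
have DA : D `<=` A.
  by move=> x [/= xd xp]; split => //; apply: hd0; apply: lt_le_trans xd _; rewrite ge_min lexx.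
have slope x : D x -> slope2 u x <= th ^+ 2.
  move=> Dx; have Ax := DA _ Dx; case: Dx => /= xd _.
  apply: (lipschitz_slope (C1_diff (mg_C1 mg) Ax) th0 rp) => h hr.
  by apply: hlip => //; apply: le_trans (ltW xd) dlr.
have row0 x (b : bool) : A x -> ('D_(delta_mx 0 (if b then 1 else 0)) psi x) 0 0 = pd b P x.
  by move=> Ax; rewrite derive_row; [rewrite pdE|exact: (sm [::])].
have row1 x (b : bool) : A x -> ('D_(delta_mx 0 (if b then 1 else 0)) psi x) 0 1 = pd b Q x.
  by move=> Ax; rewrite derive_row; [rewrite pdE|exact: (sm [::])].
(* Conformality in coordinates: I - Du^T Du = h Dpsi^T Dpsi, with h the conformal factor. Its
   determinant gives [jacE], its trace enters [quasi]. *)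
have ff x (b c : bool) : A x -> (b == c)%:R - pd b u x * pd c u x =
    hh x * (pd b P x * pd c P x + pd b Q x * pd c Q x).
  move=> Ax; have [_ /(_ (delta_mx 0 (if b then 1 else 0)) (delta_mx 0 (if c then 1 else 0)))] := hE _ Ax.
  rewrite dotE (first_formE _ _ (C1_diff (mg_C1 mg) Ax)) => E.
  transitivity (hh x * (('D_(delta_mx 0 (if b then 1 else 0)) psi x) 0 0 * ('D_(delta_mx 0 (if c then 1 else 0)) psi x) 0 0 +
    ('D_(delta_mx 0 (if b then 1 else 0)) psi x) 0 1 * ('D_(delta_mx 0 (if c then 1 else 0)) psi x) 0 1)).
    rewrite -E; congr (_ - _); last by rewrite !pdE.
    by rewrite !mxE/=; case: b {E}; case: c => /=; ring.
  congr (hh x * (_ * _ + _ * _)); [exact: row0|exact: row0|exact: row1|exact: row1].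
have hpos x : A x -> 0 < hh x by move=> /hE[].
have jacE x : A x -> (hh x * jac P Q x) ^+ 2 = 1 - slope2 u x.
  move=> Ax; have := ff x false false Ax; have := ff x false true Ax; have := ff x true true Ax.
  rewrite /jac /slope2 /=.
  move: (hh x) (px P x) (py P x) (px Q x) (py Q x) (px u x) (py u x) => h a b c d p' q' e1 e2 e3.
  transitivity ((h * (a * a + c * c)) * (h * (b * b + d * d)) - (h * (a * b + c * d)) ^+ 2); first by ring.
  by rewrite -e1 -e2 -e3; ring.
have jac0 x : A x -> jac P Q x != 0.
  move=> Ax; apply/eqP => j0; have := jacE x Ax; rewrite j0 mulr0 expr0n/=.
  by have := mg_slope mg Ax; lra.
have th2 : th ^+ 2 < 1 by rewrite expr_lt1.
(* The induced metric has trace 2 - |Du|^2 <= 2 and the root of its determinant is at least [ka];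
   their ratio bounds the distortion of psi. *)
pose ka := Num.sqrt (1 - th ^+ 2).
have ka0 : 0 < ka by rewrite sqrtr_gt0 subr_gt0.
have quasi x : D x -> ka * (px P x ^+ 2 + py P x ^+ 2 + px Q x ^+ 2 + py Q x ^+ 2) <= 2 * `|jac P Q x|.
  move=> Dx; have Ax := DA _ Dx; rewrite -(ler_pM2l (hpos x Ax)).
  have -> : hh x * (ka * (px P x ^+ 2 + py P x ^+ 2 + px Q x ^+ 2 + py Q x ^+ 2)) = ka * (2 - slope2 u x).
    have := ff x false false Ax; have := ff x true true Ax; rewrite /slope2/= !mulr1n => e1 e2.
    transitivity (ka * (hh x * (py P x * py P x + py Q x * py Q x) + hh x * (px P x * px P x + px Q x * px Q x))); first by ring.
    by rewrite -e1 -e2; ring.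
  have k1 : ka <= hh x * `|jac P Q x|.
    rewrite -[hh x](gtr0_norm (hpos x Ax)) -normrM -(@ler_sqr _ ka) ?nnegrE ?(ltW ka0)//.
    rewrite real_normK ?num_real// jacE// sqr_sqrtr; last by rewrite subr_ge0 ltW.
    by rewrite lerD2l lerN2 slope.
  rewrite mulrCA; apply: (@le_trans _ _ (2 * ka)); last by rewrite ler_pM2l.
  rewrite mulrC ler_wpM2r ?(ltW ka0)//.
  by have := slope2_ge0 u x; lra.
have [bA bI bS] := bij.
have modE x : modulus2 P Q x = enorm (psi x) ^+ 2 by rewrite enorm_sqr.
have ann x : A x -> r0 < enorm (psi x) < 1 by move=> /bA.
have mod0 x : D x -> 0 < modulus2 P Q x.
  move=> /DA/ann/andP[h _]; rewrite modE exprn_gt0//; exact: lt_trans h.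
have [mp mz] := mpair_conformal oD (C1_sub DA cP) (fun b => C1_sub DA (cPb b))
  (C1_sub DA cQ) (fun b => C1_sub DA (cQb b)) ka0 mod0 (fun x Dx => jac0 x (DA _ Dx)) quasi.
have L0 : 0 < 4 / ka by rewrite divr_gt0.
(* This is 2 ln|psi|, bounded because psi takes values between the radii r0 and 1. *)
pose s x := ln (modulus2 P Q x).
have sE x : D x -> s x = 2 * ln (enorm (psi x)).
  by move=> /DA/ann/andP[h _]; rewrite /s modE lnXn ?mulr_natl//; exact: lt_trans h.
have lr0 : ln r0 < 0 by rewrite ln_lt0// r00.
have sB x : D x -> `|s x| <= - (2 * ln r0).
  move=> Dx; have /andP[h1 h2] := ann x (DA _ Dx); have h0 : 0 < enorm (psi x) by exact: lt_trans h1.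
  have h3 : ln r0 < ln (enorm (psi x)) by rewrite ltr_ln ?posrE.
  have h4 : ln (enorm (psi x)) < 0 by rewrite ln_lt0// h0.
  by rewrite sE// ler_norml; apply/andP; split; clear -h3 h4; lra.
have B0 : 0 <= - (2 * ln r0) by clear -lr0; lra.
have d2 : 0 < dl / 2 by rewrite divr_gt0.
have d2l : dl / 2 < dl by clear -dl0; lra.
have cs x : D x -> continuous_at x s := C1_cts (mp_v mp).
have circ x : enorm (x - p) = dl / 2 -> D x by move=> e; apply: inD; rewrite e.
have cN x : D x -> continuous_at x (fun x => - s x) by move=> Dx; have := cs x Dx; exact: cts_opp.
have [x1 x1r hx1] := max_circle d2 cs circ.
have [x2 x2r hx2] := max_circle d2 cN circ.
have up := @mpair_puncture D s _ _ _ (4 / ka) (- (2 * ln r0)) p dl mp L0 B0 dl0 _ (dl / 2) (s x1) d2 d2l hx1.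
have dn := @mpair_puncture D (fun x => - s x) _ _ _ (4 / ka) (- (2 * ln r0)) p dl (mpair_opp mp) L0 B0 dl0 _ (dl / 2) (- s x2) d2 d2l hx2.
have {}up x : 0 < enorm (x - p) -> enorm (x - p) <= dl / 2 -> enorm (psi x) <= enorm (psi x1).
  move=> y0 y1; have Dx : D x by apply: inD => //; exact: le_lt_trans d2l.
  have Dx1 := circ _ x1r.
  have /andP[q1 _] := ann _ (DA _ Dx); have /andP[q2 _] := ann _ (DA _ Dx1).
  have := up _ x y0 y1; rewrite !sE// ler_pM2l// ler_ln ?posrE ?(lt_trans r00)//; apply.
  by move=> y z0 z1; have Dy := inD _ z0 z1; split; [exact: Dy|exact: mz|exact: sB].
have {}dn x : 0 < enorm (x - p) -> enorm (x - p) <= dl / 2 -> enorm (psi x2) <= enorm (psi x).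
  move=> y0 y1; have Dx : D x by apply: inD => //; exact: le_lt_trans d2l.
  have Dx1 := circ _ x2r.
  have /andP[q1 _] := ann _ (DA _ Dx); have /andP[q2 _] := ann _ (DA _ Dx1).
  have := dn _ x y0 y1; rewrite lerN2 !sE// ler_pM2l// ler_ln ?posrE ?(lt_trans r00)//; apply.
  move=> y z0 z1; have Dy := inD _ z0 z1; split; [exact: Dy| |by rewrite normrN; exact: sB].
  by have := mz y Dy; rewrite /zbound (edens_opp mp Dy) !sqrrN.
(* Points tending to p along a radius; their images stay in a compact annulus and so have a cluster
   value z. *)
pose xk (k : nat) := pol p (ln (dl / 2) - k%:R) 0.
have xkn k : enorm (xk k - p) = dl / 2 * expR (- k%:R) by rewrite enorm_pol expRD lnK ?posrE.
have xk0 k : 0 < enorm (xk k - p) by rewrite xkn mulr_gt0// expR_gt0.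
have xk1 k : enorm (xk k - p) <= dl / 2.
  by rewrite xkn ler_piMr ?(ltW d2)// expR_le1 oppr_le0.
pose Kc := [set z : 'rV[R]_2 | enorm (psi x2) <= enorm (z - 0) <= enorm (psi x1)].
have Fk : ((fun k => psi (xk k)) @ \oo) Kc.
  by exists 0%N => //= k _; rewrite /Kc/= subr0 up// dn.
have [z [Kz cz]] := @compact_annulus R 0 (enorm (psi x2)) (enorm (psi x1)) ((fun k => psi (xk k)) @ \oo) _ Fk.
(* The bounds of [Kc] are moduli of values of psi, so z lies in the open annulus and is taken at
   some x'. *)
have [x' Ax' e'] : (psi @` A) z.
  apply: bS; move: Kz; rewrite /annulus/= subr0 => /andP[z1 z2].
  have /andP[h1 _] := ann _ (DA _ (circ _ x2r)); have /andP[_ h2] := ann _ (DA _ (circ _ x1r)).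
  by rewrite (lt_le_trans h1 z1) (le_lt_trans z2 h2).
have n0 : 0 < enorm (x' - p) by rewrite enorm_gt0 subr_eq0; apply/eqP => xp; case: Ax' => _; apply.
have [q q0 hq] := nbhs_eball (open_nbhs_nbhs (conj oA Ax')).
(* Half the distance to p keeps the disc about x' disjoint from the points of the sequence that are
   close to p. *)
have [q' [q'0 qq' qn]] : exists q' : R, [/\ 0 < q', q' < q & q' <= enorm (x' - p) / 2].
  exists (Num.min (q / 2) (enorm (x' - p) / 2)); split; last by rewrite ge_min lexx orbT.
    by rewrite lt_min !divr_gt0.
  by rewrite gt_min; apply/orP; left; clear -q0; lra.
have hA' y : enorm (y - x') <= q' -> A y by move=> h; apply: hq; exact: le_lt_trans h qq'.
have injA y : A y -> forall y', A y' -> P y = P y' -> Q y = Q y' -> y = y'.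
  by move=> Ay y' Ay' e1 e2; apply: bI; rewrite ?inE//; exact: rV2P.
have hinj y : enorm (y - x') = q' -> P y = P x' -> Q y = Q x' -> False.
  move=> e e1 e2; have Ay : A y by apply: hA'; rewrite e.
  by move: q'0; rewrite -e (injA y Ay x' Ax' e1 e2) subrr enorm0 ltxx.
have [e0 e00 hloc] := local_onto cP cQ jac0 q'0 hA' hinj.
have Fs : ((fun k => psi (xk k)) @ \oo) [set w | exists2 x, enorm (x - p) < enorm (x' - p) / 2 /\ A x & w = psi x].
  have c0 : (fun k : nat => expR (- k%:R) : R) @ \oo --> (0 : R).
    have h1 : (fun k : nat => expR (- 1) ^+ k : R) @ \oo --> (0 : R).
      by apply: cvg_expr; rewrite ger0_norm ?expR_ge0// expR_lt1 oppr_lt0.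
    rewrite (_ : (fun k : nat => expR (- k%:R)) = (fun k : nat => expR (- 1) ^+ k))//.
    by apply/funext => k; rewrite -expRM_natl mulrN1.
  have q1 : 0 < enorm (x' - p) / dl by rewrite divr_gt0.
  have : \forall k \near \oo, expR (- k%:R) < enorm (x' - p) / dl.
    move/cvgrPdist_lt: c0 => /(_ _ q1); apply: filterS => k.
    by rewrite sub0r normrN gtr0_norm ?expR_gt0.
  apply: filterS => k hk; exists (xk k) => //; split.
    rewrite xkn mulrAC ltr_pM2r// mulrC -ltr_pdivlMr//.
  by apply: DA; apply: inD => //; exact: le_lt_trans d2l.
have Fz : nbhs z [set w : 'rV[R]_2 | enorm (w - z) < Num.sqrt e0] by apply: near_eball; rewrite sqrtr_gt0.
(* A value of psi at a point near p that is close enough to z to be taken near x' as well, against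
   injectivity. *)
have [w [[x [xn Ax] ->] /= wz]] := cz _ _ Fs Fz.
have := hloc (P x) (Q x); case.
  have : enorm (psi x - z) ^+ 2 < e0.
    by rewrite -[ltRHS](sqr_sqrtr (ltW e00)) ltr_sqr ?nnegrE ?enorm_ge0 ?sqrtr_ge0.
  rewrite enorm_sqr -e' /P /Q.
  have E (m m' : 'rV[R]_2) j : (m - m') 0 j = m 0 j - m' 0 j by rewrite !mxE.
  by rewrite !E.
move=> y yq [y1 y2]; have Ay := hA' _ (ltW yq).
have yx := injA y Ay x Ax y1 y2.
have := enorm_sub x' x p; rewrite (enorm_dist x' x).
by move: xn yq qn; rewrite yx; clear; move=> *; lra.
Qed.

End Puncture.

(** * The topology of marked graphs *)

Section MarkedTopology.
Variables (R : realType) (n : nat).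
Implicit Types (G : Gn R n) (M : Mn R n) (m : 'M[R]_(n.+1, 3)).

Lemma open_GnE (V : set (Gn R n)) :
  open V <-> exists2 W : set ('M[R]_(n.+1, 3) * R), open W & @s2 R n @^-1` W = @s1 R n @^-1` V.
Proof.
have -> : @open (Gn R n) V = @open (Mn R n) ((\pi_(Gn R n))%qT @^-1` V) by [].
by rewrite generic_quotient.pi.unlock.
Qed.

Lemma mark_point (u : 'rV[R]_2 -> R) m : is_mark u m ->
  exists f : 'I_n.+1 -> 'rV[R]_2, [/\ forall i, singular_set u (f i) /\ row i m = graph_map u (f i),
    injective f & forall p, singular_set u p -> exists i, p = f i].
Proof.
case=> m1 m2 m3.
have h i : exists p, singular_set u p /\ row i m = graph_map u p.
  by have [p sp e] := m1 i Logic.I; exists p.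
have [f fP] := choice h; exists f; split => [//|i j ij|p sp].
  apply: m2; rewrite ?inE//.
  by rewrite (fP i).2 (fP j).2 ij.
have [i _ e] := m3 _ (imageP (graph_map u) sp); exists i.
by apply/esym/(@graph_map_inj R u); rewrite -(fP i).2.
Qed.

Definition row_reindex (s : 'I_n.+1 -> 'I_n.+1) m : 'M[R]_(n.+1, 3) := \matrix_i row (s i) m.

Lemma mark_reindex (u : 'rV[R]_2 -> R) m s : injective s -> is_mark u m ->
  is_mark u (row_reindex s m).
Proof.
move=> si [m1 m2 m3]; have [t st ts] := injF_bij si.
rewrite /is_mark (_ : (fun i => row i _) = (fun i => row (s i) m)); last first.
  by apply/funext => i; rewrite rowK.
split => [i _|i j _ _ ij|x xS]; first exact: m1.
  by apply: si; apply: m2; rewrite ?inE.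
by have [i _ e] := m3 x xS; exists (t i) => //; rewrite ts.
Qed.

Lemma mark_unique (u : 'rV[R]_2 -> R) m m' : is_mark u m -> is_mark u m' ->
  exists2 s, injective s & m' = row_reindex s m.
Proof.
move=> [m1 m2 m3] [m1' m2' m3'].
have h i : exists j, row j m = row i m' by have [j _ e] := m3 _ (m1' i Logic.I); exists j.
have [s sP] := choice h; exists s; last by apply/row_matrixP => i; rewrite rowK.
by move=> i j ij; apply: m2'; rewrite ?inE// -!sP ij.
Qed.

Lemma row_reindex_continuous s :
  continuous (fun z : 'M[R]_(n.+1, 3) * R => (row_reindex s z.1, z.2)).
Proof.
move=> z; apply/cvg_ballP => e e0.
have hz : nbhs z (ball z e) by apply/nbhs_ballP; exists e.
apply: filterS hz => w [[_ h1] h2].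
split; last exact: h2.
split => [//|i j]; rewrite /= !mxE; exact: h1.
Qed.

(* Permuting the rows of a mark is a homeomorphism, so [s1] is an open map. *)
Lemma cvg_marked (G : nat -> Gn R n) M0 : (G @ \oo --> s1 M0) <->
  forall e : R, 0 < e -> \forall k \near \oo, exists2 M, s1 M = G k & ball (s2 M0) e (s2 M).
Proof.
split => [hG e e0|hG V].
  (* Balls need not be open, hence the interior. *)
  pose W : set ('M[R]_(n.+1, 3) * R) := (ball (s2 M0) e)^°.
  have oW : open W by exact: open_interior.
  have W0 : W (s2 M0) by exact: nbhsx_ballx.
  pose V := [set G' | exists2 M, s1 M = G' & W (s2 M)].
  have oV : open V.
    (* A marked graph lies over [V] exactly when some reordering of its mark lands in [W]; the union
       over reorderings is open as each of them is continuous. *)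
    apply/open_GnE; exists (\bigcup_(s in [set s : 'I_n.+1 -> 'I_n.+1 | injective s])
      ((fun z : 'M[R]_(n.+1, 3) * R => (row_reindex s z.1, z.2)) @^-1` W)).
      apply: bigcup_open => s _; apply: open_comp oW => z _; exact: row_reindex_continuous.
    apply/seteqP; split => M /=.
      move=> [s si Ws]; exists (MkMn (mark_reindex si (MnP M))) => //.
    move=> [M' MM' WM'].
    have mM' : is_mark (Mn_graph M) (Mn_mark M') by rewrite -[Mn_graph M]MM'; exact: MnP.
    have [s si ms] := mark_unique (MnP M) mM'.
    exists s => //; rewrite /preimage/= -ms; move: WM'; rewrite /s2.
    by rewrite -[Mn_graph M]/(s1 M) -MM'.
  have V0 : V (s1 M0) by exists M0.
  have hV : \forall k \near \oo, V (G k) by apply: hG; exact: open_nbhs_nbhs.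
  by apply: filterS hV => k [M h1 h2]; exists M => //; exact: interior_subset.
rewrite nbhsE => -[V' [/open_GnE[W oW WE] V'0] V'V].
have : W (s2 M0) by rewrite -[W _]/((@s2 R n @^-1` W) M0) WE.
move=> W0; have /nbhs_ballP[e e0 he] : nbhs (s2 M0) W by exact: open_nbhs_nbhs.
have hk : \forall k \near \oo, V (G k).
  apply: filterS (hG e e0) => k [M MG bM]; apply: V'V; rewrite -MG.
  by rewrite -[V' _]/((@s1 R n @^-1` V') M) -WE; exact: he.
exact: hk.
Qed.

Lemma s2_ballP M0 M (e : R) : 0 < e -> ball (s2 M0) e (s2 M) <->
  (forall i j, `|Mn_mark M0 i j - Mn_mark M i j| < e) /\
  `|log_growth (Mn_graph M0) - log_growth (Mn_graph M)| < e.
Proof.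
by move=> e0; split => [[[_ h1] h2]|[h1 h2]].
Qed.

End MarkedTopology.

(** * Convergence on compact sets in terms of discs *)

Section UniformOnCompacts.
Variable R : realType.
Implicit Types (u v : 'rV[R]_2 -> R) (x y p : 'rV[R]_2).

Lemma cvg_compactP (F : nat -> 'rV[R]_2 -> R) u :
  {family compact, F @ \oo --> u} <->
  forall rho e : R, 0 < e -> \forall k \near \oo, forall x, enorm x <= rho -> `|F k x - u x| <= e.
Proof.
split => [/fam_cvgP h rho e e0|h].
  have cK := @compact_annulus R 0 0 rho.
  pose E := [set xy : R * R | ball xy.1 e xy.2].
  have EE : entourage E by rewrite -entourage_ballE; exists e.
  have : nbhs (u : {uniform` _ -> R}) [set g : {uniform` [set x | 0 <= enorm (x - 0) <= rho] -> R} |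
      forall y, 0 <= enorm (y - 0) <= rho -> E (u y, g y)].
    by apply/uniform_nbhs; exists E; split.
  move=> /(h _ cK) hk; have hk' : \forall k \near \oo, forall y, 0 <= enorm (y - 0) <= rho -> E (u y, F k y) by exact: hk.
  apply: filterS hk' => k hE x xr; rewrite distrC ltW//.
  by apply: hE; rewrite subr0 enorm_ge0.
apply/fam_cvgP => K cK P /uniform_nbhs[E [EE EP]].
have [e /= e0 he] : exists2 e : R, 0 < e & [set xy : R * R | ball xy.1 e xy.2] `<=` E.
  by move: EE; rewrite -entourage_ballE => -[e e0 he]; exists e.
have [b [_ hb]] := compact_bounded cK.
have e2 : 0 < e / 2 by rewrite divr_gt0.
have hk : \forall k \near \oo, P (F k).
  (* Compact sets are bounded in the sup norm, and the Euclidean norm is at most twice the sup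
     norm. *)
  apply: filterS (h (2 * (b + 1)) (e / 2) e2) => k hF; apply: EP => y Ky; apply: he => /=.
  rewrite -ball_normE/= distrC (le_lt_trans (hF _ _))//; last by rewrite ltr_pdivrMr// ltr_pMr// ltr1n.
  apply: le_trans (enorm_le_norm _) _; rewrite ler_pM2l//; apply: hb Ky.
  by rewrite ltrDl.
exact: hk.
Qed.

Lemma graph_map_coord u x (j : 'I_3) :
  (exists k : 'I_2, forall v y, (graph_map v y) 0 j = y 0 k) \/ (forall v y, (graph_map v y) 0 j = v y).
Proof.
case: (split_ordP (j : 'I_(2 + 1))) => k ->; [left; exists k|right] => v y.
  exact: row_mxEl.
by apply: etrans (row_mxEr _ _ _ _) _; rewrite ord1 mxE eqxx mulr1n.
Qed.

Lemma graph_map_close u v x y (e : R) : 0 <= e ->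
  (forall j, `|graph_map u x 0 j - graph_map v y 0 j| <= e) ->
  enorm (x - y) <= 2 * e /\ `|u x - v y| <= e.
Proof.
move=> e0 h; split; last by have := h 2; rewrite /graph_map !row3_2.
have := h 0; have := h 1; rewrite /graph_map !row3_0 !row3_1 => h1 h0.
rewrite enorm_le ?mulr_ge0//.
have E k : (x - y) 0 k = x 0 k - y 0 k by rewrite !mxE.
rewrite !E; move: h0 h1; rewrite !ler_norml => /andP[? ?] /andP[? ?]; nra.
Qed.

Lemma graph_map_close_inv u v x y (e : R) : enorm (x - y) < e -> `|u x - v y| < e ->
  forall j, `|graph_map u x 0 j - graph_map v y 0 j| < e.
Proof.
move=> h1 h2 j; case: (graph_map_coord u x j) => [[k E]|E]; rewrite !E//.
apply: le_lt_trans h1; apply: le_trans (norm_le_enorm _).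
by have := coord_le_norm (x - y) k; rewrite !mxE.
Qed.

End UniformOnCompacts.

(** * Marks and growths against uniform convergence *)

Section Convergence.
Variable R : realType.
Implicit Types (u v : 'rV[R]_2 -> R) (x y p : 'rV[R]_2).

(* Otherwise [lipschitz_inside] would make [u0] a contraction near [p]. *)
Lemma sing_persist n u0 p (e0 : R) : in_Gn n u0 -> singular_set u0 p -> 0 < e0 ->
  exists2 e : R, 0 < e & forall v, in_Gn n v ->
    (forall x, enorm (x - p) <= e0 -> `|v x - u0 x| <= e) ->
    exists2 q, singular_set v q & enorm (q - p) < e0.
Proof.
move=> hu sp e00.
have fS : finite_set (singular_set u0 `\ p) by exact: finite_setD (Gn_finite hu).
have oS : open (~` (singular_set u0 `\ p)) by rewrite openC; exact: finite_closed.
have [d d0 hd] : exists2 d : R, 0 < d & forall x, enorm (x - p) < d -> (~` (singular_set u0 `\ p)) x.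
  by apply: nbhs_eball; apply: open_nbhs_nbhs; split => // -[_]; apply.
(* The disc of radius 2r contains no other singular point of [u0] and lies inside the disc of radius
   e0. *)
pose r := Num.min d e0 / 2.
have m0 : 0 < Num.min d e0 by rewrite lt_min d0.
have r0 : 0 < r by rewrite divr_gt0.
have r2 : 2 * r = Num.min d e0 by rewrite /r; field.
have rd : 2 * r <= d by rewrite r2 ge_min lexx.
have re : 2 * r <= e0 by rewrite r2 ge_min lexx orbT.
have iso x : 0 < enorm (x - p) -> enorm (x - p) < 2 * r -> ~ singular_set u0 x.
  move=> x0 xr sx; apply: (hd x (lt_le_trans xr rd)); split => //= xp.
  by move: x0; rewrite xp subrr enorm0 ltxx.
have [th [th0 th1 hth]] := lipschitz_inside hu r0 iso.
apply: contrapT => hn.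
have r20 : 0 < r / 2 by rewrite divr_gt0.
apply: (@conelike_not_lipschitz R u0 p th (r / 2) sp (ltW th0) th1 r20) => x h xr hr.
apply/ler_addgt0Pr => e ep.
have e4 : 0 < e / 4 by rewrite divr_gt0.
(* As persistence is supposed to fail, every tolerance admits a graph that is regular near p; e / 4
   compensates the 4e of [lipschitz_inside]. *)
have [v [hv vc vs]] : exists v, [/\ in_Gn n v,
    forall x, enorm (x - p) <= e0 -> `|v x - u0 x| <= e / 4 &
    forall q, enorm (q - p) < e0 -> ~ singular_set v q].
  apply: contrapT => hv; apply: hn; exists (e / 4) => // v hv' vc.
  apply: contrapT => hq; apply: hv; exists v; split => // q qp sq.
  by apply: hq; exists q.
have := hth n v (e / 4) hv; rewrite (_ : 4 * (e / 4) = e); last by field.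
apply.
- move=> y yr; have y1 := lt_le_trans yr re; split; first exact: vs.
  by apply: vc; exact: ltW.
- by apply: le_trans xr _; clear -r0; lra.
- exact: hr.
Qed.

(** Marks within d in the sup norm give |u - u0| <= 3d at the singular points of both graphs: 2d for
    moving the point, as graphs are 1-Lipschitz, and d for the height. Then [close_bound] applies to
    u - u0 and to u0 - u. *)
Lemma uniform_of_marked n u0 (m0 : 'M[R]_(n.+1, 3)) (rho e : R) : in_Gn n u0 -> is_mark u0 m0 ->
  0 < e -> exists2 d : R, 0 < d & forall u m, in_Gn n u -> is_mark u m ->
    (forall i j, `|m0 i j - m i j| < d) -> `|log_growth u0 - log_growth u| < d ->
    forall x, enorm x <= rho -> `|u x - u0 x| <= e.
Proof.
move=> hu0 km0 e0; have [f [fP finj fsurj]] := mark_point km0.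
have sg0 : 0 < e / 2 by rewrite divr_gt0.
pose a := f ord0.
have rh0 : 0 < `|rho| + enorm a + 1 by rewrite ltr_wpDl// addr_ge0// enorm_ge0.
have [d1 d10 hd1] := close_bound sg0 rh0.
(* 3d <= e / 8 lies below the level e / 2 asked at singular points and e / 4 asked at the centre
   [a]. *)
have [d [d0 dd1 de]] : exists d : R, [/\ 0 < d, d <= d1 & 24 * d <= e].
  exists (Num.min d1 (e / 24)); split; first by rewrite lt_min d10 divr_gt0.
    by rewrite ge_min lexx.
  by rewrite mulrC -ler_pdivlMr// ge_min lexx orbT.
exists d => // u m hu km md cd x xr.
have [g [gP ginj gsurj]] := mark_point km.
have close i : enorm (f i - g i) <= 2 * d /\ `|u0 (f i) - u (g i)| <= d.
  apply: graph_map_close; first exact: ltW.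
  move=> j; rewrite -(fP i).2 -(gP i).2 !mxE; exact: ltW.
have pt i : `|u (f i) - u0 (f i)| <= 3 * d /\ `|u (g i) - u0 (g i)| <= 3 * d.
  have [c1 c2] := close i.
  have l1 := le_trans (Gn_lipw hu (g i) (f i)) c1.
  have l2 := le_trans (Gn_lipw hu0 (g i) (f i)) c1.
  move: l1 l2 c2; rewrite !ler_norml => /andP[? ?] /andP[? ?] /andP[? ?].
  by split; apply/andP; split; lra.
have sing p : singular_set u p \/ singular_set u0 p -> `|u p - u0 p| <= 3 * d.
  by case=> [/gsurj|/fsurj] [i ->]; have [] := pt i.
have xa : enorm (x - a) <= `|rho| + enorm a + 1.
  have := enorm_sub x 0 a; rewrite subr0 sub0r enormN => h.
  by have := ler_norm rho; lra.
have sa : singular_set u0 a by have [] := fP ord0.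
have E : 2 * (e / 2) = e by field.
rewrite ler_norml -[e]E lerNl opprB; apply/andP; split.
- apply: (hd1 n u0 u a hu0 hu _ _ _ x xa).
  + move=> p /or_comm/sing; rewrite ler_norml => /andP[? ?]; lra.
  + have := sing a (or_intror sa); rewrite ler_norml => /andP[? ?]; lra.
  + by rewrite ltW// (lt_le_trans cd).
- apply: (hd1 n u u0 a hu hu0 _ _ _ x xa).
  + move=> p /sing; rewrite ler_norml => /andP[? ?]; lra.
  + have := sing a (or_intror sa); rewrite ler_norml => /andP[? ?]; lra.
  + by rewrite distrC ltW// (lt_le_trans cd).
Qed.

Lemma finite_lower_bound (T : finType) (g : T -> R) : (forall i, 0 < g i) ->
  exists2 d : R, 0 < d & forall i, d <= g i.
Proof.
move=> g0; exists (\big[Num.min/1]_i g i); last by move=> i; exact: bigmin_le.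
by apply: lt_bigmin => // i _; exact: g0.
Qed.

(** Near every singular point of [u0] there is one of u. The discs about the former are disjoint, so
    the assignment is injective, and as both graphs have n + 1 singular points it exhausts those of
    u; the mark is reordered along it. *)
Lemma marked_of_uniform n u0 (m0 : 'M[R]_(n.+1, 3)) (e : R) : in_Gn n u0 -> is_mark u0 m0 ->
  0 < e -> exists rho e' : R, 0 < e' /\ forall u (mk : 'M[R]_(n.+1, 3)), in_Gn n u -> is_mark u mk ->
    (forall x, enorm x <= rho -> `|u x - u0 x| <= e') ->
    exists m : 'M[R]_(n.+1, 3), [/\ is_mark u m, forall i j, `|m0 i j - m i j| < e &
      `|log_growth u0 - log_growth u| < e].
Proof.
move=> hu0 km0 e0; have [f [fP finj fsurj]] := mark_point km0.
pose B := \sum_i enorm (f i).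
have fB i : enorm (f i) <= B.
  rewrite /B (bigD1 i)//= lerDl; apply: sumr_ge0 => j _; exact: enorm_ge0.
have B0 : 0 <= B by apply: sumr_ge0 => j _; exact: enorm_ge0.
have [dl dl0 hdl] : exists2 d : R, 0 < d & forall i j, i != j -> d <= enorm (f i - f j).
  have [|d d0 hd] := @finite_lower_bound ('I_n.+1 * 'I_n.+1)%type
    (fun ij => if ij.1 == ij.2 then 1 else enorm (f ij.1 - f ij.2)).
    move=> [i j] /=; have [//|ij] := eqVneq i j.
    by rewrite enorm_gt0 subr_eq0; apply: contra_neq ij; exact: finj.
  by exists d => // i j ij; have := hd (i, j); rewrite /= (negPf ij).
(* 2 eb <= dl makes the discs disjoint, eb <= e / 2 makes the marks close, and eb <= 1 keeps all
   singular points in the disc of radius B + 1. *)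
have [eb [eb0 ebd ebe eb1]] : exists b : R, [/\ 0 < b, 2 * b <= dl, b <= e / 2 & b <= 1].
  exists (Num.min (dl / 2) (Num.min (e / 2) 1)); split.
  - by rewrite !lt_min !divr_gt0//=.
  - by rewrite mulrC -ler_pdivlMr// ge_min lexx.
  - by rewrite !ge_min lexx !orbT.
  - by rewrite !ge_min lexx !orbT.
have hpers i : exists e' : R, 0 < e' /\ forall v, in_Gn n v ->
    (forall x, enorm (x - f i) <= eb -> `|v x - u0 x| <= e') ->
    exists2 q, singular_set v q & enorm (q - f i) < eb.
  by have [e' e'0 h] := sing_persist hu0 (fP i).1 eb0; exists e'.
have [es esP] := choice hpers.
have [e1 e10 he1] := finite_lower_bound (fun i => (esP i).1).
have B2 : 0 < B + 2 by rewrite ltr_wpDl.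
have e2 : 0 < e / 2 by rewrite divr_gt0.
have [T hT] := growth_close (log_growth u0) B2 e2.
have [e' [e'0 e'1 e'e e'u]] : exists b : R, [/\ 0 < b, b <= e1, b <= e / 2 & b <= 1].
  exists (Num.min e1 (Num.min (e / 2) 1)); split.
  - by rewrite !lt_min e10 e2/=.
  - by rewrite ge_min lexx.
  - by rewrite !ge_min lexx !orbT.
  - by rewrite !ge_min lexx !orbT.
exists (B + 1 + `|T|), e'; split => // u mk hu kmk huv.
have TT := normr_ge0 T.
have near_f i x : enorm (x - f i) <= eb -> enorm x <= B + 1.
  by move=> h; have := enorm_sub x (f i) 0; rewrite !subr0 => h'; have := fB i; lra.
have hq i : exists q, singular_set u q /\ enorm (q - f i) < eb.
  have [|q sq qf] := (esP i).2 u hu; last by exists q.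
  move=> x /near_f h; apply: le_trans (le_trans e'1 (he1 i)); apply: huv; lra.
have [q qP] := choice hq.
have [g [gP ginj gsurj]] := mark_point kmk.
have [s sP] := choice (fun i => gsurj _ (qP i).1).
have sinj : injective s.
  move=> i j ij; apply/eqP/negPn/negP => /hdl d.
  have := enorm_sub (f i) (q i) (f j); rewrite (enorm_dist (f i) (q i)) {2}(sP i) ij -(sP j).
  by have := (qP i).2; have := (qP j).2; lra.
have [t st ts] := injF_bij sinj.
have snear p : singular_set u p -> enorm p <= B + 1.
  move=> /gsurj[j ->]; rewrite -(ts j) -sP; apply: (near_f (t j)).
  exact: ltW (qP (t j)).2.
exists (row_reindex s mk); split; first exact: mark_reindex.
- move=> i j.
  have -> : m0 i j = graph_map u0 (f i) 0 j by rewrite -(fP i).2 mxE.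
  have -> : row_reindex s mk i j = graph_map u (q i) 0 j by rewrite (sP i) -(gP (s i)).2 !mxE.
  have [sq qf] := qP i.
  apply: graph_map_close_inv; rewrite enorm_dist in qf *.
    by clear -qf ebe e0; lra.
  have l1 := Gn_lipw hu0 (q i) (f i).
  have l2 : `|u (q i) - u0 (q i)| <= e' by apply: huv; have := snear _ sq; lra.
  by move: l1 l2; rewrite !ler_norml => /andP[? ?] /andP[? ?]; rewrite ltr_norml; apply/andP; split; lra.
- rewrite distrC; apply: (@le_lt_trans _ _ (e / 2)); last by clear -e0; lra.
  apply: (hT n u u0 hu hu0 erefl) => [x xB|x xT].
    split; first by move=> /snear; lra.
    by move=> /fsurj[i xi]; have := fB i; rewrite -xi; lra.
  apply: le_trans e'u; apply: huv; apply: le_trans xT _.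
  by have := ler_norm T; lra.
Qed.

End Convergence.

Theorem theorem4p2 (R : realType) (n : nat) (n_ge1 : (1 <= n)%N)
    (G : nat -> Gn R n) (G0 : Gn R n) :
  (G @ \oo --> G0) <->
  {family compact, (fun k => G k : 'rV[R]_2 -> R) @ \oo --> (G0 : 'rV[R]_2 -> R)}.
Proof.
(* Any mark of [G0] serves: [cvg_marked] reads the convergence off the marked graphs around it. *)
have [M0 M0E] := s1_surj G0; rewrite -M0E; have km0 := MnP M0; have hu0 := GnP (s1 M0).
split.
- move=> /cvg_marked hG; apply/cvg_compactP => rho e e0.
  have [d d0 hd] := uniform_of_marked rho hu0 km0 e0.
  apply: filterS (hG d d0) => k [M MG /(s2_ballP _ _ d0)[h1 h2]] x xr; rewrite -MG.
  exact: (hd _ (Mn_mark M) (GnP (s1 M)) (MnP M) h1 h2).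
move=> /cvg_compactP hG; apply/cvg_marked => e e0.
have [rho [e' [e'0 h]]] := marked_of_uniform hu0 km0 e0.
apply: filterS (hG rho e' e'0) => k hk.
have [M ME] := s1_surj (G k).
have [|m [km h1 h2]] := h (s1 M) (Mn_mark M) (GnP _) (MnP M); first by rewrite ME.
by exists (MkMn km).
Qed.
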